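(* For each $c\in(0,1)$ let $R^*(c)$ be the Bayes risk of the DGF(L) policy with parameter $c$ (defined in the context). Then, as $c\to0$, $$R^*(c)\;\sim\;\frac{-c\log c}{I^*(M,K,L)}\;\sim\;\inf_\Gamma R(\Gamma),$$ where the infimum is over all admissible policies and $a(c)\sim b(c)$ means $\lim_{c\to 0}a(c)/b(c)=1$.
   Context: Model with $L$ targets. Fix integers $M\ge2$, $1\le L\le M-1$ and $1\le K\le M$. Exactly $L$ of the $M$ cells are abnormal, $L$ known. The hypotheses $H_{m'}$ are indexed by the $\binom ML$ subsets $A_{m'}\subset\{1,\dots,M\}$ of size $L$ ($H_{m'}$: the abnormal cells are exactly $A_{m'}$), with priors $\pi_{m'}\in(0,1)$ summing to $1$. $f,g$ are probability densities w.r.t. a common measure with $0<D(g\|f),D(f\|g)<\infty$ ($D(p\|q)=\int p\log(p/q)$), and $\log(g(Y)/f(Y))$ has finite moment generating function near $0$ for $Y\sim f$ and $Y\sim g$. At each time $n$ a set $\phi(n)$ of $K$ distinct cells is selected, and an observation $y_k(n)$ is obtained from each selected cell; under $H_{m'}$ observations are independent, with law $g$ for cells in $A_{m'}$ and $f$ otherwise. An admissible policy consists of a (possibly randomized, history-dependent) selection rule, a stopping time $\tau$, and a decision $\delta$ (a size-$L$ subset) at $\tau$. $\alpha_{m'}=\mathbf P_{m'}(\delta\neq A_{m'})$, $P_e=\sum\pi_{m'}\alpha_{m'}$, and $R(\Gamma)=P_e(\Gamma)+c\sum_{m'}\pi_{m'}\mathbf E_{m'}(\tau)$ for cost $c>0$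 per time step. Notation. $\ell_k(n)=\log\frac{g(y_k(n))}{f(y_k(n))}$, $\mathbf 1_k(n)$ indicates cell $k$ is observed at time $n$, $S_k(n)=\sum_{t\le n}\ell_k(t)\mathbf1_k(t)$, $m^{(i)}(n)$ is the cell with $i$-th largest $S_k(n)$ (ties arbitrary), and $\Delta_LS(n)=S_{m^{(L)}(n)}(n)-S_{m^{(L+1)}(n)}(n)$. DGF(L) policy with parameter $c$: at each time (ranking by current sums), if $D(g\|f)/L\ge D(f\|g)/(M-L)$ select $m^{(1)},\dots,m^{(K)}$ when $K\ge L$ and $m^{(L-K+1)},\dots,m^{(L)}$ when $K<L$; if $D(g\|f)/L< D(f\|g)/(M-L)$ select $m^{(M-K+1)},\dots,m^{(M)}$ when $K>M-L$ and $m^{(L+1)},\dots,m^{(L+K)}$ when $K\le M-L$. Stop at $\tau=\inf\{n:\Delta_LS(n)\ge-\log c\}$ and declare $\delta=\{m^{(1)}(\tau),\dots,m^{(L)}(\tau)\}$. Rate. $I^*(M,K,L)=I_g^*$ if $D(g\|f)/L\ge D(f\|g)/(M-L)$ and $I_f^*$ otherwise, where $I_g^*=D(g\|f)+\frac{(K-L)D(f\|g)}{M-L}$ if $K\ge L$, $I_g^*=\frac{KD(g\|f)}{L}$ if $K<L$; and $I_f^*=D(f\|g)+\frac{(K-M+L)D(g\|f)}{L}$ if $K>M-L$, $I_f^*=\frac{KD(f\|g)}{M-L}$ if $K\le M-L$. *)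

(* Defs.v *)
From HB Require Import structures.
From mathcomp Require Import all_boot all_order all_algebra fingroup perm.
From mathcomp Require Import all_classical all_reals all_analysis.
Set Implicit Arguments. Unset Strict Implicit. Unset Printing Implicit Defensive.
Import Order.TTheory GRing.Theory Num.Theory.
Import numFieldNormedType.Exports.
Local Open Scope classical_set_scope.
Local Open Scope ring_scope.

Definition KL {R : realType} {d} {Y : measurableType d}
  (mu : {measure set Y -> \bar R}) (p q : Y -> R) : \bar R :=
  if pselect ({ae mu, forall x, q x = 0 -> p x = 0})
  then (\int[mu]_x (p x * ln (p x / q x))%:E)%E
  else +oo%E.

Definition is_density {R : realType} {d} {Y : measurableType d}
  (mu : {measure set Y -> \bar R}) (p : Y -> R) : Prop :=
  measurable_fun setT p /\ (forall x, 0 <= p x) /\ (\int[mu]_x (p x)%:E = 1)%E.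

Definition llr {R : realType} {Y : Type} (f g : Y -> R) (y : Y) : R :=
  ln (g y / f y).

(* The asymptotic rate I*(M,K,L); Dgf = D(g||f), Dfg = D(f||g). *)
Definition I_g {R : realType} (M K L : nat) (Dgf Dfg : R) : R :=
  if (L <= K)%N then Dgf + (K - L)%:R * Dfg / (M - L)%:R
  else K%:R * Dgf / L%:R.
Definition I_f {R : realType} (M K L : nat) (Dgf Dfg : R) : R :=
  if (M - L < K)%N then Dfg + (K + L - M)%:R * Dgf / L%:R
  else K%:R * Dfg / (M - L)%:R.
Definition I_star {R : realType} (M K L : nat) (Dgf Dfg : R) : R :=
  if Dfg / (M - L)%:R <= Dgf / L%:R then I_g M K L Dgf Dfg
  else I_f M K L Dgf Dfg.

(* 0-based index of the first selected rank in the DGF(L) policy: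
   ranks lo+1, ..., lo+K (1-based) are selected. *)
Definition dgf_lo {R : realType} (M K L : nat) (Dgf Dfg : R) : nat :=
  if Dfg / (M - L)%:R <= Dgf / L%:R then
    (if (L <= K)%N then 0%N else (L - K)%N)
  else (if (M - L < K)%N then (M - K)%N else L).

(* sigma lists the cells in nonincreasing order of S:
   sigma i = m^(i+1) (ties broken arbitrarily). *)
Definition is_ranking {R : realType} {M : nat} (S : 'I_M -> R)
  (sigma : {perm 'I_M}) : Prop :=
  forall i j : 'I_M, (i <= j)%N -> S (sigma j) <= S (sigma i).

Definition DeltaL {R : realType} {M : nat} (L : nat) (S : 'I_M -> R) : R :=
  let s := sort (fun a b : R => b <= a) [seq S k | k <- enum 'I_M] in
  nth 0 s L.-1 - nth 0 s L.

(* Time is 0-based: at time t = 0,1,2,... the set sel t of cells is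
   observed; stop = Some n means the policy stops after the n time steps
   0..n-1 (so tau = n), stop = None means it never stops; dec is the
   declared set of abnormal cells. *)
Record policy (Omega : Type) (M : nat) := Policy {
  sel : nat -> Omega -> {set 'I_M};
  stop : Omega -> option nat;
  dec : Omega -> {set 'I_M} }.

(* Generators of the sigma-algebra F_n of the information available
   after the first n time steps: the randomization variable U and the
   observations y t k for t < n and k selected at time t. *)
Definition hist_gen {dO dV dY} {Omega : measurableType dO}
  {V : measurableType dV} {Y : measurableType dY} {M : nat}
  (U : Omega -> V) (y : nat -> 'I_M -> Omega -> Y)
  (G : policy Omega M) (n : nat) : set (set Omega) :=
  [set E | (exists A0 : set V, measurable A0 /\ E = U @^-1` A0)
        \/ (exists t k (B : set Y), (t < n)%N /\ measurable B /\
              E = [set w | k \in sel G t w /\ B (y t k w)])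
        \/ (exists t k, (t < n)%N /\ E = [set w | k \notin sel G t w])].

Definition hist_sigma {dO dV dY} {Omega : measurableType dO}
  {V : measurableType dV} {Y : measurableType dY} {M : nat}
  (U : Omega -> V) (y : nat -> 'I_M -> Omega -> Y)
  (G : policy Omega M) (n : nat) : set (set Omega) :=
  <<s hist_gen U y G n >>.

Definition admissible {dO dV dY} {Omega : measurableType dO}
  {V : measurableType dV} {Y : measurableType dY} {M : nat} (K L : nat)
  (U : Omega -> V) (y : nat -> 'I_M -> Omega -> Y)
  (G : policy Omega M) : Prop :=
  [/\ forall n w, #|sel G n w| = K,
      forall w, #|dec G w| = L,
      forall n (S : {set 'I_M}), hist_sigma U y G n [set w | sel G n w = S],
      forall n, hist_sigma U y G n [set w | stop G w = Some n]
    & forall n (S : {set 'I_M}),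
        hist_sigma U y G n [set w | stop G w = Some n /\ dec G w = S]].

Definition indep_model {R : realType} {dO dV dY} {Omega : measurableType dO}
  {V : measurableType dV} {Y : measurableType dY} {M : nat}
  (P : probability Omega R) (U : Omega -> V)
  (y : nat -> 'I_M -> Omega -> Y) : Prop :=
  forall (s : seq (nat * 'I_M)) (B : nat * 'I_M -> set Y) (A0 : set V),
    uniq s -> measurable A0 -> (forall i, measurable (B i)) ->
    fine (P (U @^-1` A0 `&` \bigcap_(i in [set` s]) (y i.1 i.2 @^-1` B i)))
    = fine (P (U @^-1` A0)) * \prod_(i <- s) fine (P (y i.1 i.2 @^-1` B i)).

(* The model of the paper (realized on the full array of potential
   observations): for each hypothesis A (|A| = L), under P A the
   variables y n k are independent of each other and of U, y n k has
   density g if k \in A and f otherwise, and U has a law that does not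
   depend on the hypothesis. *)
Definition search_model {R : realType} {dO dV dY} {Omega : measurableType dO}
  {V : measurableType dV} {Y : measurableType dY} (M L : nat)
  (mu : {measure set Y -> \bar R}) (f g : Y -> R)
  (P : {set 'I_M} -> probability Omega R) (U : Omega -> V)
  (y : nat -> 'I_M -> Omega -> Y) : Prop :=
  [/\ measurable_fun setT U,
      forall n k, measurable_fun setT (y n k),
      forall A : {set 'I_M}, #|A| = L -> indep_model (P A) U y,
      forall (A : {set 'I_M}) n k (B : set Y), #|A| = L -> measurable B ->
        P A (y n k @^-1` B) =
        (\int[mu]_(x in B) ((if k \in A then g x else f x)%:E))%E
    & forall (A A' : {set 'I_M}) (B : set V), #|A| = L -> #|A'| = L ->
        measurable B -> P A (U @^-1` B) = P A' (U @^-1` B)].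

Definition err_prob {R : realType} {dO} {Omega : measurableType dO} {M : nat}
  (PA : probability Omega R) (A : {set 'I_M}) (G : policy Omega M) : \bar R :=
  PA [set w | stop G w = None \/ dec G w != A].

Definition tau_e {R : realType} {Omega : Type} {M : nat}
  (G : policy Omega M) (w : Omega) : \bar R :=
  match stop G w with Some n => (n%:R)%:E | None => +oo%E end.

Definition bayes_risk {R : realType} {dO} {Omega : measurableType dO}
  {M : nat} (L : nat) (pi : {set 'I_M} -> R)
  (P : {set 'I_M} -> probability Omega R) (c : R)
  (G : policy Omega M) : \bar R :=
  (\sum_(A : {set 'I_M} | #|A| == L) (pi A)%:E * err_prob (P A) A G
   + c%:E * \sum_(A : {set 'I_M} | #|A| == L)
              (pi A)%:E * \int[P A]_w tau_e G w)%E.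

Definition Ssum {R : realType} {Omega Y : Type} {M : nat} (f g : Y -> R)
  (y : nat -> 'I_M -> Omega -> Y) (G : policy Omega M)
  (n : nat) (w : Omega) (k : 'I_M) : R :=
  \sum_(t < n) (if k \in sel G t w then llr f g (y t k w) else 0).

(* G is a DGF(L) policy with parameter c (ties broken arbitrarily, but
   in an admissible way). *)
Definition is_DGF {R : realType} {dO dV dY} {Omega : measurableType dO}
  {V : measurableType dV} {Y : measurableType dY} {M : nat} (K L : nat)
  (Dgf Dfg : R) (f g : Y -> R) (U : Omega -> V)
  (y : nat -> 'I_M -> Omega -> Y) (c : R) (G : policy Omega M) : Prop :=
  [/\ admissible K L U y G,
      forall n w, exists sigma : {perm 'I_M},
        is_ranking (Ssum f g y G n w) sigma /\
        sel G n w = [set sigma i | i : 'I_M &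
          (dgf_lo M K L Dgf Dfg <= i < dgf_lo M K L Dgf Dfg + K)%N],
      forall w n, stop G w = Some n <->
        (- ln c <= DeltaL L (Ssum f g y G n w) /\
         forall m, (m < n)%N -> DeltaL L (Ssum f g y G m w) < - ln c)
    & forall w n, stop G w = Some n -> exists sigma : {perm 'I_M},
        is_ranking (Ssum f g y G n w) sigma /\
        dec G w = [set sigma i | i : 'I_M & (i < L)%N]].

(* Main.v *)
Require Import Defs.
From HB Require Import structures.
From mathcomp Require Import all_boot all_order all_algebra fingroup perm.
From mathcomp Require Import all_classical all_reals all_analysis.
From mathcomp Require Import measurable_realfun zify lra ring.
Import Order.TTheory GRing.Theory Num.Theory.
Import numFieldNormedType.Exports.
Local Open Scope classical_set_scope.
Local Open Scope ring_scope.
Set Implicit Arguments. Unset Strict Implicit. Unset Printing Implicit Defensive.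

(** Lower bound. For [A' = A - i + j], integrating a tangent-line bound for the
    exponential of the log-likelihood ratio, stopped at [min(tau, n)], against
    the change of measure from [P A] to [P A'] gives
    [E_A N_i D(g||f) + E_A N_j D(f||g) >= (1 - o(1)) |ln c|], where [N_k] counts the
    visits of cell [k]. Averaging over [i] in [A] and [j] outside [A], together
    with [sum_k N_k = K tau] and [N_k <= tau], yields [I* E_A tau >= (1 - o(1)) |ln c|].

    Upper bound. Write [S_k] as drift times number of visits plus a martingale.
    By Chernoff's bound all the martingale parts stay below [eta n] up to time [n],
    except on an event of summable probability; off that event a deterministic
    balancing argument for the greedy selection gives
    [Delta_L S(n) >= I* n - C (eta n + 1)], so that [tau] is at most
    [|ln c| / (I* - eps)] up to a variable of bounded mean. The change of measure
    bounds the error probability by a multiple of [c], as [S_j - S_i >= |ln c|]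
    whenever a wrong set is declared. *)

(** * Integrals and pi-systems *)

Import HBNNSimple.

(** The model grants independence only for the full array of potential observations, whereas a
    policy chooses adaptively which of them enter its history. [weight_indep] bridges this gap:
    integrated over an event of the history, a product over the cells observed so far factors out
    every observation not yet made. It is used with three weights: the constant 1 (Wald's identity
    for visit counts), the likelihood ratio of two hypotheses (change of measure), and an
    exponential tilt of one cell (Chernoff). Means are handled through positive and negative parts,
    so that almost only nonnegative integrands occur and no integrability has to be carried along.
    The rate is the value of a linear program: [I_star * T] is the largest information that [K * T]
    visits can bring when no cell receives more than [T] of them. The lower bound argues by
    contradiction: a risk below [(1 - eps) c |ln c| / I*] would push every error probability below
    [p = c^(1 - delta)], and [|ln p|] is still [(1 - delta) |ln c|]. *)

Lemma eq_integral_pi_system (R : realType) (d : measure_display)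
  (T : measurableType d) (P1 P2 : {measure set T -> \bar R})
  (F1 F2 : T -> \bar R) (G : set (set T)) :
  measurable_fun setT F1 -> measurable_fun setT F2 ->
  (forall x, 0 <= F1 x)%E -> (forall x, 0 <= F2 x)%E ->
  (\int[P1]_x F1 x < +oo)%E -> (\int[P1]_x F1 x = \int[P2]_x F2 x)%E ->
  setI_closed G -> G `<=` measurable ->
  (forall E, G E -> (\int[P1]_(x in E) F1 x = \int[P2]_(x in E) F2 x)%E) ->
  forall E, <<s G >> E -> (\int[P1]_(x in E) F1 x = \int[P2]_(x in E) F2 x)%E.
Proof.
move=> mF1 mF2 F10 F20 fin eqT GI Gm GE E.
rewrite -setI_closed_g_dynkin_g_sigma_algebra// => GsE.
have mS (A : set T) (F : T -> \bar R) : measurable_fun setT F -> measurable_fun A F.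
  by apply: measurable_funS.
have spl (P : {measure set T -> \bar R}) (F : T -> \bar R) A : measurable A ->
    measurable_fun setT F -> (forall x, 0 <= F x)%E ->
    (\int[P]_x F x = \int[P]_(x in A) F x + \int[P]_(x in ~` A) F x)%E.
  move=> mA mF F0; rewrite -ge0_integral_setU ?setUv//.
  - exact: measurableC.
  - by rewrite disj_set2E setICr.
pose H := [set A | measurable A /\
  (\int[P1]_(x in A) F1 x = \int[P2]_(x in A) F2 x)%E].
suff : H E by case.
apply: GsE; split; last by move=> A GA; split; [exact: Gm|exact: GE].
split; first by split.
- move=> A [mA eA]; split; first exact: measurableC.
  have [h1 h2] := (spl P1 F1 A mA mF1 F10, spl P2 F2 A mA mF2 F20).
  (* Passing to a complement subtracts, hence the finite total. Equality over the whole space is a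
     separate assumption because [G] need not contain [setT]. *)
  have fA : (\int[P1]_(x in A) F1 x)%E \is a fin_num.
    rewrite ge0_fin_numE ?integral_ge0//; apply: le_lt_trans fin.
    by rewrite h1 leeDl// integral_ge0.
  by rewrite -[LHS](addeK _ fA) [X in (X - _)%E]addeC -h1 eqT h2 -eA [X in (X - _)%E]addeC addeK.
- move=> F tF HF; split; first by apply: bigcupT_measurable => k; case: (HF k).
  rewrite !ge0_integral_bigcup//; do ?[by move=> k; case: (HF k)|exact: mS].
  by apply: eq_eseriesr => k _; case: (HF k).
Qed.

(** Simple functions and monotone convergence extend the hypothesis from indicators to [h]. Allowing
    two spaces and two weights makes one lemma serve both for splitting off an independent factor
    and for computing an expectation from a density. *)
Lemma eq_integral_comp (R : realType) (d1 d2 d3 : measure_display)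
  (T1 : measurableType d1) (T2 : measurableType d2) (T3 : measurableType d3)
  (P1 : {measure set T1 -> \bar R}) (P2 : {measure set T2 -> \bar R})
  (Y1 : T1 -> T3) (Y2 : T2 -> T3) (G1 : T1 -> R) (G2 : T2 -> R) :
  measurable_fun setT Y1 -> measurable_fun setT Y2 ->
  measurable_fun setT G1 -> measurable_fun setT G2 ->
  (forall x, 0 <= G1 x) -> (forall x, 0 <= G2 x) ->
  (forall B, measurable B -> (\int[P1]_(x in Y1 @^-1` B) (G1 x)%:E =
                             \int[P2]_(x in Y2 @^-1` B) (G2 x)%:E)%E) ->
  forall h : T3 -> R, measurable_fun setT h -> (forall y, 0 <= h y) ->
  (\int[P1]_x (G1 x * h (Y1 x))%:E = \int[P2]_x (G2 x * h (Y2 x))%:E)%E.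
Proof.
move=> mY1 mY2 mG1 mG2 G10 G20 eqB h mh h0.
have mh' : measurable_fun setT (EFin \o h) by exact/measurable_EFinP.
pose phi := nnsfun_approx measurableT mh'.
have lim (d : measure_display) (T : measurableType d)
    (P : {measure set T -> \bar R}) (Y : T -> T3) (G : T -> R) :
    measurable_fun setT Y -> measurable_fun setT G -> (forall x, 0 <= G x) ->
    (\int[P]_x (G x * phi n (Y x))%:E)%E @[n --> \oo]
      --> (\int[P]_x (G x * h (Y x))%:E)%E.
  move=> mY mG G0.
  have <- : (\int[P]_x limn (fun n => (G x * phi n (Y x))%:E) =
            \int[P]_x (G x * h (Y x))%:E)%E.
    apply: eq_integral => x _; apply/cvg_lim => //.
    under eq_fun do rewrite EFinM.
    rewrite EFinM; apply: cvgeZl => //.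
    by apply: (cvg_nnsfun_approx measurableT mh') => // y _; rewrite lee_fin.
  apply: (@cvg_monotone_convergence _ _ _ P setT measurableT
    (fun n x => (G x * phi n (Y x))%:E)).
  - move=> n; apply/measurable_EFinP/measurable_funM => //.
    exact: measurableT_comp.
  - by move=> n x _; rewrite lee_fin mulr_ge0.
  - move=> x _ m n mn; rewrite lee_fin ler_wpM2l//.
    exact/lefP/nd_nnsfun_approx.
have spl (d : measure_display) (T : measurableType d)
    (P : {measure set T -> \bar R}) (Y : T -> T3) (G : T -> R) n :
    measurable_fun setT Y -> measurable_fun setT G -> (forall x, 0 <= G x) ->
    (\int[P]_x (G x * phi n (Y x))%:E = \sum_(r \in range (phi n))
       (r%:E * \int[P]_(x in Y @^-1` (phi n @^-1` [set r])) (G x)%:E))%E.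
  move=> mY mG G0.
  have mI r : measurable (phi n @^-1` [set r]) by [].
  have mIY r : measurable (Y @^-1` (phi n @^-1` [set r])).
    by rewrite -[X in measurable X]setTI; apply: mY.
  have mGr r : measurable_fun setT
      (fun x => (r * (\1_(Y @^-1` (phi n @^-1` [set r])) x * G x))%:E).
    apply/measurable_EFinP/measurable_funM => //; apply: measurable_funM => //.
  have -> : (\int[P]_x (G x * phi n (Y x))%:E = \int[P]_x (\sum_(r \in
      range (phi n)) (r * (\1_(Y @^-1` (phi n @^-1` [set r])) x * G x))%:E))%E.
    apply: eq_integral => x _; rewrite fsumEFin//; congr EFin.
    rewrite {1}fimfunE mulrC fsbig_finite//= big_distrl/= [RHS]fsbig_finite//=.
    apply: eq_bigr => r _.
    by rewrite mulrA.
  rewrite ge0_integral_fsum//; last first.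
    move=> r x _; rewrite lee_fin indicE; case: (boolP (_ \in _)) => [|_].
      by rewrite inE /= => <-; rewrite mul1r mulr_ge0.
    by rewrite mul0r mulr0.
  apply: eq_fsbigr => r; rewrite inE => -[y _ yr].
  have r0 : 0 <= r by rewrite -yr.
  under eq_integral do rewrite EFinM.
  rewrite ge0_integralZl_EFin//; first last.
  - by apply/measurable_EFinP/measurable_funM.
  - by move=> x _; rewrite lee_fin mulr_ge0.
  congr (_ * _)%E; rewrite [RHS]integral_mkcond; apply: eq_integral => x _.
  by rewrite patchE indicE; case: ifP => _; rewrite ?mul1r ?mul0r.
have c1 := lim _ _ P1 _ _ mY1 mG1 G10.
have c2 := lim _ _ P2 _ _ mY2 mG2 G20.
apply: cvg_unique c1 _ => //.
suff -> : (fun n => \int[P1]_x (G1 x * phi n (Y1 x))%:E)%E =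
          (fun n => \int[P2]_x (G2 x * phi n (Y2 x))%:E)%E by exact: c2.
apply/funext => n; rewrite !spl//; apply: eq_fsbigr => r _.
by rewrite eqB.
Qed.

(** * Histories of a policy *)

Unset Implicit Arguments.
Section History.
Context (R : realType) (dO dV dY : measure_display) (Omega : measurableType dO)
  (V : measurableType dV) (Y : measurableType dY) (M : nat).
Variables (U : Omega -> V) (y : nat -> 'I_M -> Omega -> Y) (G : policy Omega M).
Hypothesis mU : measurable_fun setT U.
Hypothesis my : forall n k, measurable_fun setT (y n k).
Hypothesis adaptG : forall n (S : {set 'I_M}),
  hist_sigma U y G n [set w | sel G n w = S].

Local Notation F_ n := (hist_sigma U y G n).

Lemma hist_fin_bigcup n (I : finType) (D : set I) (A : I -> set Omega) :
  (forall i, D i -> F_ n (A i)) -> F_ n (\bigcup_(i in D) A i).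
Proof.
move=> FA; exact: (@fin_bigcup_measurable _ (g_sigma_algebraType _)).
Qed.

Lemma histC n A : F_ n A -> F_ n (~` A).
Proof. exact: (@measurableC _ (g_sigma_algebraType _)). Qed.

Lemma histI n A B : F_ n A -> F_ n B -> F_ n (A `&` B).
Proof. exact: (@measurableI _ (g_sigma_algebraType _)). Qed.

Lemma histT n : F_ n setT.
Proof. exact: (@measurableT _ (g_sigma_algebraType _)). Qed.

Lemma hist_sel n (p : pred {set 'I_M}) : F_ n [set w | p (sel G n w)].
Proof.
have -> : [set w | p (sel G n w)] =
    \bigcup_(S in [set S : {set 'I_M} | p S]) [set w | sel G n w = S].
  apply/seteqP; split => w /=; first by move=> pw; exists (sel G n w).
  by case=> S pS /= ->.
exact: hist_fin_bigcup.
Qed.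

Lemma hist_sigma_le n m : (n <= m)%N -> F_ n `<=` F_ m.
Proof.
move=> nm; apply: sub_sigma_algebra2 => A [|[|]]; first by left.
- move=> [t [k [B [tn h]]]]; right; left; exists t, k, B.
  by split => //; apply: leq_trans nm.
- move=> [t [k [tn h]]]; right; right; exists t, k.
  by split => //; apply: leq_trans nm.
Qed.

(** Strong induction, because the generators of [F_ n] involve the selections at times [t < n],
    whose measurability comes from that of [F_ t]. *)
Lemma hist_sigma_measurable n : F_ n `<=` measurable.
Proof.
elim/ltn_ind: n => n IH.
apply: smallest_sub; first exact: sigma_algebra_measurable.
move=> A [[A0 [mA0 ->]]|[]].
- by rewrite -[X in measurable X]setTI; apply: mU.
- move=> [t [k [B [tn [mB ->]]]]].
  rewrite (_ : [set w | _] = [set w | k \in sel G t w] `&` (y t k @^-1` B))//.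
  apply: measurableI; last by rewrite -[X in measurable X]setTI; apply: my.
  exact: (IH t tn _ (hist_sel t (fun S => k \in S))).
- move=> [t [k [tn ->]]].
  exact: (IH t tn _ (hist_sel t (fun S => k \notin S))).
Qed.

(** [hist_gen] is not closed under intersection in general. Fixing the whole selected set [S] cures
    this: distinct [S] give disjoint sets, and for one [S] the constraints intersect cell by cell.
    On such a slice the observations made at time [n] have fixed indices. *)
Definition pi_gen n (A : set Omega) := exists E (S : {set 'I_M}) (B : 'I_M -> set Y),
  [/\ F_ n E, forall k, measurable (B k) & A = E `&` [set w | sel G n w = S] `&`
     [set w | forall k, k \in S -> B k (y n k w)]].

Lemma pi_gen_setI n : setI_closed (pi_gen n).
Proof.
move=> A A' [E [S [B [hE mB ->]]]] [E' [S' [B' [hE' mB' ->]]]].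
have [<-{S'}|SS'] := eqVneq S S'.
  exists (E `&` E'), S, (fun k => B k `&` B' k); split.
  - exact: histI.
  - by move=> k; apply: measurableI.
  - apply/seteqP; split => w /=.
      move=> [[[Ew Sw] Bw] [[E'w _] B'w]]; split => // k kS.
      by split; [exact: Bw|exact: B'w].
    move=> [[[Ew E'w] Sw] BBw]; split; split => // k /BBw; by case.
exists set0, S, (fun=> setT); split => //; last first.
  apply/seteqP; split => w /=; last by case => -[].
  by move=> [[[_ Sw] _] [[_ S'w] _]]; move: SS'; rewrite -Sw -S'w eqxx.
by rewrite -setCT; apply: histC; apply: histT.
Qed.

Lemma pi_gen_measurable n : pi_gen n `<=` measurable.
Proof.
move=> A [E [S [B [hE mB ->]]]]; apply: measurableI.
  by apply: measurableI; [exact: hist_sigma_measurable hE|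
    exact: hist_sigma_measurable (adaptG n S)].
rewrite (_ : [set w | _] =
    \big[setI/setT]_(k <- enum S) (y n k @^-1` (B k))); last first.
  rewrite -bigcap_seq; apply/seteqP; split => w /= h k.
    by rewrite /= mem_enum => kS; apply: h.
  by move=> kS; apply: (h k); rewrite /= mem_enum.
apply: bigsetI_measurable => k _.
by rewrite -[X in measurable X]setTI; apply: my.
Qed.

(** An event of [F_ n] is the union of its slices over the finitely many values of the selection.
    The only generators that may fall outside [F_ n] are the observations made at time [n], which
    are unions of slices with [k \in S]. *)
Lemma hist_sigmaS_pi n : F_ n.+1 `<=` <<s pi_gen n >>.
Proof.
have bigP (p : pred {set 'I_M}) (E : set Omega) (B : 'I_M -> set Y) :
    F_ n E -> (forall k, measurable (B k)) ->
    <<s pi_gen n >> (\bigcup_(S in [set S : {set 'I_M} | p S])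
       (E `&` [set w | sel G n w = S] `&`
        [set w | forall k, k \in S -> B k (y n k w)])).
  move=> hE mB; apply: (@fin_bigcup_measurable _ (g_sigma_algebraType _)).
    exact: finite_finset.
  by move=> S _; apply: sub_sigma_algebra; exists E, S, B.
have incl E : F_ n E -> <<s pi_gen n >> E.
  move=> hE; have := bigP predT E (fun=> setT) hE (fun=> measurableT).
  congr (<<s _ >> _); apply/seteqP; split => w /=; first by case=> S _ [[]].
  by move=> Ew; exists (sel G n w).
apply: smallest_sub; first exact: smallest_sigma_algebra.
move=> A [[A0 [mA0 ->]]|[]].
- by apply: incl; apply: sub_sigma_algebra; left; exists A0.
- move=> [t [k [B [tn [mB ->]]]]]; move: tn; rewrite ltnS leq_eqVlt.
  move=> /predU1P[->|tn]; last first.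
    by apply: incl; apply: sub_sigma_algebra; right; left; exists t, k, B.
  have := bigP (fun S => k \in S) setT (fun j => if j == k then B else setT)
    (histT n) _.
  set Z := \bigcup_(S in _) _; rewrite (_ : Z = [set w | k \in sel G n w /\ B (y n k w)]).
    by apply=> j; case: ifP.
  apply/seteqP; split => w; rewrite /Z /=.
    move=> [S /= kS [[_ ->] h]]; split => //.
    by have := h _ kS; rewrite eqxx.
  move=> [kw Bw]; exists (sel G n w) => //=; split => // j _.
  by case: eqP => // ->.
- move=> [t [k [tn ->]]]; move: tn; rewrite ltnS leq_eqVlt.
  move=> /predU1P[->|tn]; last first.
    by apply: incl; apply: sub_sigma_algebra; right; right; exists t, k.
  exact: incl (hist_sel n (fun S => k \notin S)).
Qed.

Lemma integral_split_sel (P : {measure set Omega -> \bar R})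
    (F : Omega -> \bar R) n :
  measurable_fun setT F -> (forall w, 0 <= F w)%E ->
  (\int[P]_w F w = \sum_(S : {set 'I_M}) \int[P]_(w in [set w | sel G n w = S]) F w)%E.
Proof.
move=> mF F0; rewrite -[in RHS]big_enum/= -ge0_integral_bigsetU//.
- congr (integral _ _ _); apply/esym; rewrite -bigcup_seq -subTset => w _ /=.
  by exists (sel G n w); rewrite //= mem_enum.
- by move=> S; exact: hist_sigma_measurable (adaptG n S).
- exact: enum_uniq.
- by apply/trivIsetP => S S' _ _ /eqP SS'; apply/seteqP; split => w //= [->].
- exact: measurable_funS mF.
Qed.

End History.

Arguments hist_fin_bigcup {dO dV dY Omega V Y M U y G n I D A}.
Arguments histC {dO dV dY Omega V Y M U y G n A}.
Arguments histI {dO dV dY Omega V Y M U y G n A B}.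
Arguments histT {dO dV dY Omega V Y M U y G}.
Arguments hist_sel {dO dV dY Omega V Y M U y G}.
Arguments hist_sigma_le {dO dV dY Omega V Y M U y G n m}.
Arguments hist_sigma_measurable {dO dV dY Omega V Y M U y G} mU my adaptG n.
Arguments pi_gen {dO dV dY Omega V Y M}.
Arguments pi_gen_setI {dO dV dY Omega V Y M}.
Arguments pi_gen_measurable {dO dV dY Omega V Y M U y G} mU my adaptG n.
Arguments hist_sigmaS_pi {dO dV dY Omega V Y M U y G} adaptG n.
Arguments integral_split_sel {R dO dV dY Omega V Y M U y G} mU my adaptG P {F} n.
Set Implicit Arguments.

(** * Greedy balancing *)

Definition visits {M : nat} (sel : nat -> {set 'I_M}) (m : nat) (k : 'I_M) : nat :=
  \sum_(t < m) (k \in sel t).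

(** The factor [2 / a + 2 / b + 1] bounds [q / (delta + 1)] for the visit gap [q] below, [M.*2.+1]
    counts how often [q] visits may be lost, [a + b] converts visits into drift, and the final 2
    pays for the error [delta] of both cells. *)
Definition greedy_const {R : realType} (M : nat) (a b : R) : R :=
  (a + b) * (M.*2.+1)%:R * (2 / a + 2 / b + 1) + 2.

Lemma greedy_constC {R : realType} (M : nat) (a b : R) :
  greedy_const M a b = greedy_const M b a.
Proof. by rewrite /greedy_const [a + b]addrC [2 / a + _]addrC. Qed.

(** Inductive step of the balancing invariants: [x] and [z] count the visits of two cells, [u] and
    [v] tell whether they are selected now, [w] and [w'] are the slack before and after. The gap
    widens only if [u] holds without [v], and then either there was room or the slack grows. *)
Lemma visit_gap_step (x z q w w' : nat) (u v : bool) :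
  (x <= z + q + w -> w <= w' -> (u -> ~~ v -> x < z + q \/ w < w') ->
   x + u <= z + v + q + w')%N.
Proof. by case: u; case: v => h1 h2 h3; try have := h3 isT isT; lia. Qed.

Lemma visit_bound_step (x q : nat) (u : bool) :
  (x <= q -> (u -> x < q) -> x + u <= q)%N.
Proof. by case: u => h1 h2; try have := h2 isT; lia. Qed.

Section Greedy.
Context (R : realType) (M K : nat) (A : {set 'I_M}) (a b delta : R) (n : nat)
  (S : nat -> 'I_M -> R) (sel : nat -> {set 'I_M}).
Local Notation L := #|A|.
Local Notation N := (visits sel).
Hypotheses (a0 : 0 < a) (b0 : 0 < b) (delta0 : 0 <= delta).
Hypotheses (L0 : (0 < L)%N) (LM : (L < M)%N).
Hypothesis cardsel : forall m, #|sel m| = K.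
Hypothesis close : forall m k, (m <= n)%N ->
  `|S m k - (if k \in A then a * (N m k)%:R else - (b * (N m k)%:R))| <= delta.

(** When two cells of the same kind differ by [q] visits, their drifts differ by more than the
    combined error [2 * delta], so the order of their sums is forced. Adding both quotients makes
    one [q] serve both drifts. *)
Let q := (Num.truncn (2 * delta / a + 2 * delta / b)).+1.

Let visitsS m k : N m.+1 k = (N m k + (k \in sel m))%N.
Proof. by rewrite /visits big_ord_recr. Qed.

Let sum_visits m : (\sum_k N m k = K * m)%N.
Proof.
rewrite exchange_big/= (eq_bigr (fun=> K)) => [|t _].
  by rewrite sum_nat_const card_ord mulnC.
by rewrite -(cardsel t) -sum1_card [RHS]big_mkcond.
Qed.

Let split_visits m : (\sum_(k in A) N m k + \sum_(k in ~: A) N m k = K * m)%N.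
Proof.
rewrite -sum_visits [RHS](bigID (mem A))/=; congr (_ + _)%N.
by apply: eq_bigl => k; rewrite inE.
Qed.

Let visits_le m k : (N m k <= m)%N.
Proof.
elim: m => [|m IH]; first by rewrite /visits big_ord0.
by rewrite visitsS; case: (k \in _); lia.
Qed.

Let cardAC : #|~: A| = (M - L)%N.
Proof. by rewrite cardsCs finset.setCK card_ord. Qed.

Let bnd x y : b * x%:R <= 2 * delta + b * y%:R -> (x < y + q)%N.
Proof.
move=> h; rewrite ltnNge; apply/negP => yqx.
have : (q%:R : R) <= 2 * delta / a + 2 * delta / b.
  have h1 : (y%:R + q%:R : R) <= x%:R by rewrite -natrD ler_nat.
  have h2 : x%:R - y%:R <= 2 * delta / b.
    by rewrite ler_pdivlMr//; lra.
  have h3 : 0 <= 2 * delta / a by rewrite divr_ge0 ?mulr_ge0// ltW.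
  lra.
by rewrite leNgt /q truncnS_gt.
Qed.

Let bnda x y : a * x%:R <= 2 * delta + a * y%:R -> (x < y + q)%N.
Proof.
move=> h; rewrite ltnNge; apply/negP => yqx.
have : (q%:R : R) <= 2 * delta / a + 2 * delta / b.
  have h1 : (y%:R + q%:R : R) <= x%:R by rewrite -natrD ler_nat.
  have h2 : x%:R - y%:R <= 2 * delta / a.
    by rewrite ler_pdivlMr//; lra.
  have h3 : 0 <= 2 * delta / b by rewrite divr_ge0 ?mulr_ge0// ltW.
  lra.
by rewrite leNgt /q truncnS_gt.
Qed.

Let closeA m k : (m <= n)%N -> k \in A ->
  a * (N m k)%:R - delta <= S m k <= a * (N m k)%:R + delta.
Proof.
move=> mn kA; have := close k mn; rewrite kA ler_norml => /andP[h1 h2].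
by apply/andP; split; lra.
Qed.

Let closeAC m k : (m <= n)%N -> k \notin A ->
  - (b * (N m k)%:R) - delta <= S m k <= - (b * (N m k)%:R) + delta.
Proof.
move=> mn /negbTE kA; have := close k mn; rewrite kA ler_norml => /andP[h1 h2].
by apply/andP; split; lra.
Qed.

Let q_le : (q%:R : R) <= (2 / a + 2 / b + 1) * (delta + 1).
Proof.
have : (q%:R : R) <= 2 * delta / a + 2 * delta / b + 1.
  rewrite /q -addn1 natrD lerD2r truncn_le//.
  by rewrite addr_ge0// divr_ge0 ?mulr_ge0// ltW.
have h1 : 0 <= 2 / a by rewrite divr_ge0// ltW.
have h2 : 0 <= 2 / b by rewrite divr_ge0// ltW.
rewrite [2 * delta / a]mulrAC [2 * delta / b]mulrAC => h.
move: (2 / a) (2 / b) h1 h2 h => u v h1 h2 h.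
apply: le_trans h _; rewrite -subr_ge0.
rewrite (_ : _ - _ = u + v + delta); last by ring.
by rewrite !addr_ge0.
Qed.

Let aN0 m k : 0 <= a * (N m k)%:R. Proof. by rewrite mulr_ge0// ltW. Qed.
Let bN0 m k : 0 <= b * (N m k)%:R. Proof. by rewrite mulr_ge0// ltW. Qed.

(* An abnormal cell is skipped only while some selected normal cell still has
   fewer than [q] visits, and normal cells are visited evenly up to [q]. *)
Lemma greedy_top (LK : (L <= K)%N) (i j : 'I_M) :
  (forall m k k', (m < n)%N -> k \in sel m -> k' \notin sel m ->
     S m k' <= S m k) ->
  i \in A -> j \notin A ->
  (a + (K - L)%:R * b / (M - L)%:R) * n%:R
    - greedy_const M a b * (delta + 1) <= S n i - S n j.
Proof.
move=> top iA jA.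
have skip m : (m <= n)%N ->
    (m <= N m i + \sum_(k in ~: A) minn (N m k) q)%N.
  elim: m => [//|m IH] mn; have {}IH := IH (ltnW mn).
  have mono (k : 'I_M) : (minn (N m k) q <= minn (N m.+1 k) q)%N.
    by rewrite leq_min geq_minr (leq_trans (geq_minl _ _))// visitsS leq_addr.
  rewrite visitsS; have [iS|iS] := boolP (i \in sel m).
    rewrite addnAC addn1 ltnS; apply: leq_trans IH _; rewrite leq_add2l.
    by apply: leq_sum => k _; exact: mono.
  (* If [i] is skipped, fewer than [L] abnormal cells are selected, so with [K >= L] some normal
     cell is. Its sum is at least that of [i], hence at least [- delta], which leaves it fewer than
     [q] visits; the lost round is charged to it. *)
  have [k ks kA] : exists2 k, k \in sel m & k \notin A.
    apply/subsetPn; apply/negP => sA; move: LK; rewrite -(cardsel m) leqNgt.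
    move=> /negP; apply; apply: proper_card; rewrite properE sA/=.
    by apply/subsetPn; exists i.
  have Nk : (N m k < q)%N.
    rewrite -[q]add0n; apply: bnd.
    have /andP[h1 _] := closeA (ltnW mn) iA.
    have /andP[_ h2] := closeAC (ltnW mn) kA.
    have h3 := top m k i mn ks iS; have := aN0 m i.
    by rewrite mulr0 addr0; lra.
  rewrite addn0 (bigD1 k) ?inE//= visitsS ks addn1 (minn_idPl Nk).
  rewrite addSn addnS ltnS; apply: leq_trans IH _; rewrite leq_add2l.
  rewrite (bigD1 k) ?inE//= (minn_idPl (ltnW Nk)) leq_add2l.
  by apply: leq_sum => k0 _; exact: mono.
have bal m j' : (m <= n)%N -> j' \notin A -> (N m j' <= N m j + q)%N.
  elim: m => [|m IH] mn j'A; first by rewrite /visits !big_ord0.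
  have {}IH := IH (ltnW mn) j'A.
  rewrite !visitsS -[X in (_ <= X)%N]addn0.
  apply: (@visit_gap_step _ _ _ 0); rewrite ?addn0// => j's js; left.
  apply: bnd.
  have /andP[h1 _] := closeAC (ltnW mn) jA.
  have /andP[_ h2] := closeAC (ltnW mn) j'A.
  have h3 := top m j' j mn j's js.
  by lra.
have h1 : (n <= N n i + M * q)%N.
  apply: leq_trans (skip n (leqnn n)) _; rewrite leq_add2l.
  apply: (@leq_trans (\sum_(k in ~: A) q)).
    by apply: leq_sum => k _; exact: geq_minr.
  by rewrite sum_nat_const cardAC leq_mul2r leq_subr orbT.
(* The abnormal cells absorb at most [L * n] of the [K * n] visits; the rest falls on normal cells,
   none of which exceeds [j] by more than [q]. *)
have h2 : ((K - L) * n <= (M - L) * (N n j + q))%N.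
  have s1 : (\sum_(k in A) N n k <= L * n)%N.
    by rewrite -sum_nat_const; apply: leq_sum => k _; exact: visits_le.
  have s2 : (\sum_(k in ~: A) N n k <= (M - L) * (N n j + q))%N.
    rewrite -cardAC -sum_nat_const; apply: leq_sum => k; rewrite inE => kA.
    exact: bal.
  by rewrite mulnBl leq_subLR -split_visits leq_add.
have ML0 : (0 : R) < (M - L)%:R by rewrite ltr0n subn_gt0.
have h2' : (K - L)%:R * b / (M - L)%:R * n%:R <= b * ((N n j)%:R + q%:R).
  rewrite mulrAC ler_pdivrMr//.
  have : ((K - L)%:R * n%:R : R) <= (M - L)%:R * ((N n j)%:R + q%:R).
    by rewrite -natrD -!natrM ler_nat.
  move=> h; rewrite (_ : _ * b * n%:R = b * ((K - L)%:R * n%:R)); last by ring.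
  rewrite (_ : b * _ * _ = b * ((M - L)%:R * ((N n j)%:R + q%:R))); last by ring.
  by rewrite ler_wpM2l// ltW.
have h1' : a * n%:R <= a * (N n i)%:R + a * (M%:R * q%:R).
  by rewrite -mulrDr ler_wpM2l ?(ltW a0)// -natrM -natrD ler_nat.
have /andP[c1 _] := closeA (leqnn n) iA.
have /andP[_ c2] := closeAC (leqnn n) jA.
have Q : a * (M%:R * q%:R) + b * q%:R <=
    (a + b) * (M.*2.+1)%:R * ((2 / a + 2 / b + 1) * (delta + 1)).
  apply: (@le_trans _ _ ((a + b) * (M.*2.+1)%:R * q%:R)); last first.
    by apply: ler_wpM2l; [rewrite mulr_ge0// addr_ge0// ltW|exact: q_le].
  rewrite -addn1 -addnn !natrD.
  have Mq : (0 : R) <= M%:R * q%:R by rewrite -natrM.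
  have q0 : (0 : R) <= q%:R by [].
  rewrite -subr_ge0 (_ : _ - _ = a * (M%:R * q%:R) + a * q%:R +
    (b * (M%:R * q%:R) + b * (M%:R * q%:R))); last by ring.
  by rewrite !addr_ge0// mulr_ge0// ltW.
have -> : greedy_const M a b * (delta + 1) = (a + b) * (M.*2.+1)%:R *
    ((2 / a + 2 / b + 1) * (delta + 1)) + 2 * (delta + 1).
  by rewrite /greedy_const mulrDl mulrA.
move: Q; set Q := (a + b) * _ * _ => hQ.
rewrite mulrDl; move: h2'; set t := _ / _ * _ => h2'; lra.
Qed.

(* A normal cell enters the top set [T] only while it has fewer than [q] visits;
   apart from these rounds, the least visited abnormal cells catch up. *)
Lemma greedy_bottom_of_top (KL : (K <= L)%N) (i j : 'I_M) :
  (forall m, (m < n)%N -> exists T : {set 'I_M},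
     [/\ sel m \subset T, #|T| = L,
         forall k k', k \in T -> k' \notin T -> S m k' <= S m k &
         forall k k', k \in sel m -> k' \in T -> k' \notin sel m ->
           S m k <= S m k']) ->
  i \in A -> j \notin A ->
  (K%:R * a / L%:R) * n%:R
    - greedy_const M a b * (delta + 1) <= S n i - S n j.
Proof.
move=> top iA jA.
pose W m := (\sum_(k in ~: A) N m k)%N.
have notsub (T : {set 'I_M}) k : #|T| = L -> k \in T -> k \notin A ->
    exists2 k', k' \in A & k' \notin T.
  move=> cT kT kA; apply/subsetPn; apply/negP => AT.
  have AeqT : A = T by apply/eqP; rewrite eqEcard AT cT leqnn.
  by move: kA; rewrite AeqT kT.
have notsub' (T : {set 'I_M}) k : #|T| = L -> k \in A -> k \notin T ->
    exists2 k', k' \in T & k' \notin A.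
  move=> cT kA kT; apply/subsetPn; apply/negP => TA.
  have AeqT : T = A by apply/eqP; rewrite eqEcard TA cT leqnn.
  by move: kT; rewrite AeqT kA.
(* A selected normal cell lies in [T], so some abnormal [k'] is left out of [T]. The sum of [k'] is
   at least [- delta] and at most that of the normal cell, whose drift is negative. *)
have normal m k : (m <= n)%N -> k \notin A -> (N m k <= q)%N.
  elim: m => [|m IH] mn kA; first by rewrite /visits big_ord0.
  have {}IH := IH (ltnW mn) kA.
  rewrite visitsS; apply: visit_bound_step => // ks.
  have [T [sT cT h _]] := top m mn.
  have kT := fintype.subsetP sT _ ks.
  have [k' k'A k'T] := notsub T k cT kT kA.
  rewrite -[q]add0n; apply: bnd.
  have /andP[h1 _] := closeA (ltnW mn) k'A.
  have /andP[_ h2] := closeAC (ltnW mn) kA.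
  have h3 := h _ _ kT k'T; have := aN0 m k'.
  by rewrite mulr0 addr0; lra.
have Wmono m : (W m <= W m.+1)%N.
  by apply: leq_sum => k _; rewrite visitsS leq_addr.
(* If [i'] is selected without [i], there are three cases: [i] is in [T] and ranks above [i']; or a
   normal cell of [T] is selected and [W] grows; or a normal cell of [T] is not selected and ranks
   above [i'], which then has fewer than [q] visits. *)
have bal m i' : (m <= n)%N -> i' \in A -> (N m i' <= N m i + q + W m)%N.
  elim: m => [|m IH] mn i'A; first by rewrite /visits !big_ord0.
  have {}IH := IH (ltnW mn) i'A; have Wm := Wmono m.
  rewrite !visitsS; apply: visit_gap_step IH Wm _ => i's is_.
  have [T [sT cT h h']] := top m mn.
  have /andP[h1 _] := closeA (ltnW mn) i'A.
  have [iT|iT] := boolP (i \in T).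
    left; apply: bnda.
    have /andP[_ h2] := closeA (ltnW mn) iA.
    by have h3 := h' _ _ i's iT is_; lra.
  have [k kT kA] := notsub' T i cT iA iT.
  have [ks|ks] := boolP (k \in sel m).
    right; rewrite /W (bigD1 k) ?inE//= [X in (_ < X)%N](bigD1 k) ?inE//= visitsS ks.
    rewrite addnAC addn1 ltnS leq_add2l.
    by apply: leq_sum => k0 _; rewrite visitsS leq_addr.
  left; apply: (@leq_trans (0 + q)); last by rewrite leq_add2r.
  apply: bnda.
  have /andP[_ h2] := closeAC (ltnW mn) kA.
  have h3 := h' _ _ i's kT ks; have := bN0 m k.
  by rewrite mulr0 addr0; lra.
have Wn : (W n <= M * q)%N.
  apply: (@leq_trans (\sum_(k in ~: A) q)).
    by apply: leq_sum => k; rewrite inE => kA; exact: normal.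
  by rewrite sum_nat_const cardAC leq_mul2r leq_subr orbT.
(* One [M * q] is the slack [W n] in [bal], the other bounds the visits spent on normal cells. *)
have h2 : (K * n <= L * (N n i + q + 2 * (M * q)))%N.
  rewrite -split_visits -/(W n).
  have s2 : (\sum_(k in A) N n k <= L * (N n i + q + M * q))%N.
    rewrite -sum_nat_const; apply: leq_sum => k kA.
    by apply: leq_trans (bal n k (leqnn n) kA) _; rewrite leq_add2l.
  have s3 : (M * q <= L * (M * q))%N by rewrite leq_pmull.
  apply: leq_trans (leq_add s2 (leq_trans Wn s3)) _.
  by rewrite -mulnDr leq_mul2l -!addnA mul2n -addnn leqnn orbT.
have L0' : (0 : R) < L%:R by rewrite ltr0n.
have h2' : K%:R * a / L%:R * n%:R <=
    a * ((N n i)%:R + q%:R + 2 * (M%:R * q%:R)).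
  rewrite mulrAC ler_pdivrMr//.
  have : (K%:R * n%:R : R) <= L%:R * ((N n i)%:R + q%:R + 2 * (M%:R * q%:R)).
    by rewrite -!natrM -!natrD -natrM ler_nat.
  move=> h; rewrite (_ : _ * a * n%:R = a * (K%:R * n%:R)); last by ring.
  rewrite -mulrA [_ * L%:R]mulrC.
  by rewrite ler_wpM2l// ltW.
have /andP[c1 _] := closeA (leqnn n) iA.
have /andP[_ c2] := closeAC (leqnn n) jA.
have Q : a * (q%:R + 2 * (M%:R * q%:R)) <=
    (a + b) * (M.*2.+1)%:R * ((2 / a + 2 / b + 1) * (delta + 1)).
  apply: (@le_trans _ _ ((a + b) * (M.*2.+1)%:R * q%:R)); last first.
    by apply: ler_wpM2l; [rewrite mulr_ge0// addr_ge0// ltW|exact: q_le].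
  rewrite -addn1 -addnn !natrD.
  have Mq : (0 : R) <= M%:R * q%:R by rewrite -natrM.
  have q0 : (0 : R) <= q%:R by [].
  rewrite -subr_ge0 (_ : _ - _ = b * (M%:R * q%:R) + b * q%:R +
    b * (M%:R * q%:R)); last by ring.
  by rewrite !addr_ge0// mulr_ge0// ltW.
(* The drift of the normal cell is merely dropped: in this regime it contributes nothing to the
   rate. *)
have bN := bN0 n j.
have -> : greedy_const M a b * (delta + 1) = (a + b) * (M.*2.+1)%:R *
    ((2 / a + 2 / b + 1) * (delta + 1)) + 2 * (delta + 1).
  by rewrite /greedy_const mulrDl mulrA.
move: Q; set Q := (a + b) * _ * _ => hQ.
move: h2'; set t := _ / _ * _ => h2'; lra.
Qed.

End Greedy.

(** * Independence and change of measure *)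

Lemma integral_indicI (R : realType) (d : measure_display)
  (T : measurableType d) (P : {measure set T -> \bar R}) (D C : set T)
  (F : T -> R) :
  (\int[P]_(x in D) (\1_C x * F x)%:E = \int[P]_(x in D `&` C) (F x)%:E)%E.
Proof.
rewrite integral_mkcondr; apply: eq_integral => x _.
by rewrite patchE indicE; case: ifP => _; rewrite ?mul1r ?mul0r.
Qed.

Lemma integral_indic_setT (R : realType) (d : measure_display)
  (T : measurableType d) (P : {measure set T -> \bar R}) (C : set T)
  (F : T -> R) :
  (\int[P]_x (\1_C x * F x)%:E = \int[P]_(x in C) (F x)%:E)%E.
Proof. by rewrite integral_indicI setTI. Qed.

Lemma integral_cst_probability (R : realType) (d : measure_display)
  (T : measurableType d) (P : probability T R) (c : R) :
  (\int[P]_x c%:E = c%:E)%E.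
Proof.
rewrite integral_cst// -[RHS]mule1; congr (_ * _)%E.
exact: probability_setT.
Qed.

Definition weight {R : realType} {Omega Y : Type} {M : nat}
  (y : nat -> 'I_M -> Omega -> Y) (G : policy Omega M) (r : 'I_M -> Y -> R)
  (n : nat) (w : Omega) : R :=
  \prod_(t < n) \prod_(k : 'I_M) (if k \in sel G t w then r k (y t k w) else 1).

Unset Implicit Arguments.
Section Independence.
Context (R : realType) (dO dV dY : measure_display) (Omega : measurableType dO)
  (V : measurableType dV) (Y : measurableType dY) (M : nat).
Variables (U : Omega -> V) (y : nat -> 'I_M -> Omega -> Y).
Hypothesis mU : measurable_fun setT U.
Hypothesis my : forall n k, measurable_fun setT (y n k).
Variables (P : probability Omega R).
Hypothesis ind : indep_model P U y.

(** The mean [m i] is a real number, so the integral equation also records that it is finite. *)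
Definition factors (h : nat * 'I_M -> Y -> R) (m : nat * 'I_M -> R) :=
  [/\ forall i, measurable_fun setT (h i), forall i x, 0 <= h i x
    & forall i, (\int[P]_w (h i (y i.1 i.2 w))%:E = (m i)%:E)%E].

Lemma factors_ge0 h m i : factors h m -> 0 <= m i.
Proof. by case=> _ h0 hm; rewrite -lee_fin -hm integral_ge0// => w _; rewrite lee_fin. Qed.

Lemma measurable_factors h m s : factors h m ->
  measurable_fun setT (fun w => \prod_(i <- s) h i (y i.1 i.2 w)).
Proof.
by case=> mh _ _; apply: measurable_prod => i _; apply: measurableT_comp.
Qed.

Lemma prod_factors_ge0 h m (s : seq (nat * 'I_M)) w : factors h m ->
  0 <= \prod_(i <- s) h i (y i.1 i.2 w).
Proof. by case=> _ h0 _; apply: prodr_ge0. Qed.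

Lemma preimage_measurable n k B : measurable B -> measurable (y n k @^-1` B).
Proof. by move=> mB; rewrite -[X in measurable X]setTI; apply: my. Qed.

(** Functions are peeled off one at a time: [eq_integral_comp] reduces the head of [s2] to
    indicators of sets, and these join the list [s1], which is there for this induction. With [s2]
    empty the statement is [indep_model]. *)
Lemma integral_prod_factors h m : factors h m ->
  forall s2 s1 (B : nat * 'I_M -> set Y) A0, uniq (s1 ++ s2) ->
  measurable A0 -> (forall i, measurable (B i)) ->
  (\int[P]_(w in U @^-1` A0 `&` \bigcap_(i in [set` s1]) (y i.1 i.2 @^-1` B i))
     (\prod_(i <- s2) h i (y i.1 i.2 w))%:E)%E
  = (fine (P (U @^-1` A0)) * \prod_(i <- s1) fine (P (y i.1 i.2 @^-1` B i))
     * \prod_(i <- s2) m i)%:E.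
Proof.
move=> hm; elim=> [|i s2 IH] s1 B A0 us mA0 mB.
  have mC : measurable (U @^-1` A0 `&`
      \bigcap_(i in [set` s1]) (y i.1 i.2 @^-1` B i)).
    apply: measurableI; first by rewrite -[X in measurable X]setTI; apply: mU.
    by rewrite bigcap_seq; apply: bigsetI_measurable => k _; exact: preimage_measurable.
  under eq_integral do rewrite big_nil.
  rewrite integral_cst// mul1e big_nil mulr1 -ind//; last by move: us; rewrite cats0.
  by rewrite fineK// fin_num_measure.
have {}us : uniq (i :: s1 ++ s2).
  by have := us; rewrite -cat1s uniq_catCA.
set C := _ `&` _.
have mC : measurable C.
  apply: measurableI; first by rewrite -[X in measurable X]setTI; apply: mU.
  by rewrite bigcap_seq; apply: bigsetI_measurable => k _; exact: preimage_measurable.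
rewrite -integral_indic_setT.
under eq_integral do rewrite big_cons mulrCA mulrC.
set c := fine _ * \prod_(i <- s1) _.
have c0 : 0 <= c by rewrite mulr_ge0 ?fine_ge0 ?prodr_ge0// => k _; rewrite fine_ge0.
case: (hm) => mh h0 hmi.
pose G1 w := \1_C w * \prod_(j <- s2) h j (y j.1 j.2 w).
pose G2 (w : Omega) := c * \prod_(j <- s2) m j.
have G20 : 0 <= c * \prod_(j <- s2) m j.
  by rewrite mulr_ge0// prodr_ge0// => j _; apply: factors_ge0 hm.
rewrite (@eq_integral_comp R _ _ _ Omega Omega Y P P (y i.1 i.2) (y i.1 i.2)
  G1 G2 _ _ _ _ _ _ _ (h i))//.
- under eq_integral do rewrite EFinM.
  rewrite ge0_integralZl_EFin//; first last.
  + by apply/measurable_EFinP; apply: measurableT_comp.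
  + by move=> w _; rewrite lee_fin.
  rewrite hmi -EFinM big_cons; congr EFin; ring.
- by apply: measurable_funM => //; exact: measurable_factors hm.
- exact: measurable_cst.
- by move=> w; rewrite /G1 mulr_ge0//; exact: prod_factors_ge0 hm.
- move=> B0 mB0; rewrite integral_indicI.
  pose B' j := if j == i then B0 else B j.
  have s1B' j : j \in s1 -> B' j = B j.
    by rewrite /B'; case: eqP => // -> is1; move: us; rewrite /= mem_cat is1.
  have -> : y i.1 i.2 @^-1` B0 `&` C =
     U @^-1` A0 `&` \bigcap_(j in [set` i :: s1]) (y j.1 j.2 @^-1` B' j).
    apply/seteqP; split => w.
      move=> [Bw [Uw Cw]]; split => // j /=; rewrite inE => /predU1P[->|js].
        by rewrite /B' eqxx.
      by rewrite /= s1B'//; apply: Cw.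
    move=> [Uw Bw]; split; last split => //.
      by have := Bw i; rewrite /= /B' eqxx; apply; rewrite mem_head.
    by move=> j js; have := Bw j; rewrite /= s1B'//; apply; rewrite inE js orbT.
  rewrite IH//; last by move=> j; rewrite /B'; case: ifP.
  rewrite /G2 integral_cst//; last exact: preimage_measurable.
  rewrite big_cons.
  have fB0 : P (y i.1 i.2 @^-1` B0) \is a fin_num.
    by rewrite fin_num_measure//; exact: preimage_measurable.
  rewrite -[X in _ = (_ * X)%E](fineK fB0) -EFinM; congr EFin.
  rewrite {1}/B' eqxx /c (@eq_big_seq _ _ _ _ s1 _ (fun j => fine (P (y j.1 j.2 @^-1` B j)))).
    ring.
  by move=> j js; rewrite s1B'.
Qed.

Section Weights.
Variables (G : policy Omega M) (r : 'I_M -> Y -> R).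
Hypothesis adaptG : forall n (S : {set 'I_M}),
  hist_sigma U y G n [set w | sel G n w = S].
Hypothesis mr : forall k, measurable_fun setT (r k).
Hypothesis r0 : forall k x, 0 <= r k x.
Hypothesis rfin : forall n k, (\int[P]_w (r k (y n k w))%:E < +oo)%E.

Local Notation F_ n := (hist_sigma U y G n).
Local Notation W := (weight y G r).

Lemma measurable_sel n k : measurable [set w | k \in sel G n w].
Proof.
apply: (hist_sigma_measurable mU my adaptG n).
exact: (hist_sel adaptG n (fun S => k \in S)).
Qed.

Lemma measurable_weight n : measurable_fun setT (W n).
Proof.
apply: measurable_prod => t _; apply: measurable_prod => k _.
apply: measurable_fun_ifT => //; last exact: measurableT_comp.
apply: (measurable_fun_bool true); rewrite setTI.
exact: measurable_sel.
Qed.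

Lemma weight_ge0 n w : 0 <= W n w.
Proof. by apply: prodr_ge0 => t _; apply: prodr_ge0 => k _; case: ifP. Qed.

Lemma weightS n w :
  W n.+1 w = W n w * \prod_(k in sel G n w) r k (y n k w).
Proof. by rewrite /weight big_ord_recr/= [X in _ = _ * X]big_mkcond. Qed.

Let mass n k B := fine (\int[P]_(w in y n k @^-1` B) (r k (y n k w))%:E)%E.

Lemma measurable_WP n h m s : factors h m ->
  measurable_fun setT (fun w => (W n w * \prod_(i <- s) h i (y i.1 i.2 w))%:E).
Proof.
move=> hm; apply/measurable_EFinP/measurable_funM; first exact: measurable_weight.
exact: measurable_factors hm.
Qed.

(** The list [s] may hold several observations, at time [n] or later, since the induction step adds
    to it all those made at time [n]. *)
Definition weight_factorizes n := forall E, F_ n E -> forall h m s,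
  factors h m -> uniq s -> (forall i, i \in s -> (n <= i.1)%N) ->
  (\int[P]_(w in E) (W n w * \prod_(i <- s) h i (y i.1 i.2 w))%:E =
   \int[P]_(w in E) (W n w)%:E * (\prod_(i <- s) m i)%:E)%E.

(** On a slice with selection [S], the new factors of [W n.+1] and the indicators of the [B k] are
    functions of the [y n k] with [k \in S]. They join [s], and the hypothesis at time [n] applies
    to the longer list. *)
Lemma weight_pi_step n : weight_factorizes n ->
  forall E S B, F_ n E -> (forall k, measurable (B k)) ->
  forall h m s, factors h m -> uniq s -> (forall i, i \in s -> (n < i.1)%N) ->
  (\int[P]_(w in E `&` [set w | sel G n w = S] `&`
       [set w | forall k, k \in S -> B k (y n k w)])
     (W n.+1 w * \prod_(i <- s) h i (y i.1 i.2 w))%:E =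
   \int[P]_(w in E `&` [set w | sel G n w = S]) (W n w)%:E *
    ((\prod_(k in S) mass n k (B k)) * \prod_(i <- s) m i)%:E)%E.
Proof.
move=> IH E S B hE mB h m s hm us ns.
pose h' i := if i.1 == n then (fun x => \1_(B i.2) x * r i.2 x) else h i.
pose m' i := if i.1 == n then mass n i.2 (B i.2) else m i.
pose s' := [seq (n, k) | k <- enum S] ++ s.
have hm' : factors h' m'.
  case: hm => mh h0 hmi; split => i; rewrite /h' ?/m'; case: eqP => // e.
  - exact: measurable_funM.
  - by move=> x; rewrite mulr_ge0.
  rewrite /mass fineK -?e.
    by rewrite -[RHS]integral_indic_setT; apply: eq_integral => w _; rewrite !indicE.
  have mB' : measurable (y i.1 i.2 @^-1` B i.2) by exact: preimage_measurable.
  rewrite ge0_fin_numE; last by apply: integral_ge0 => w _; rewrite lee_fin.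
  apply: le_lt_trans (rfin i.1 i.2); apply: ge0_subset_integral => //.
  - by apply/measurable_EFinP; apply: measurableT_comp.
  - by move=> w _; rewrite lee_fin.
have us' : uniq s'.
  rewrite cat_uniq us andbT map_inj_uniq ?enum_uniq; last by move=> k k' [].
  apply/hasPn => -[t k] ts; apply/negP => /mapP[k' _ [tn _]].
  by have := ns _ ts; rewrite /= tn ltnn.
have ns' i : i \in s' -> (n <= i.1)%N.
  by rewrite mem_cat => /orP[/mapP[k _ ->]//|/ns/ltnW].
rewrite [LHS](_ : _ = \int[P]_(w in E `&` [set w | sel G n w = S])
  (\1_[set w | forall k, k \in S -> B k (y n k w)] w *
    (W n.+1 w * \prod_(i <- s) h i (y i.1 i.2 w)))%:E)%E; last first.
  by rewrite integral_indicI.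
have := IH (E `&` [set w | sel G n w = S]) (histI hE (adaptG n S))
  h' m' s' hm' us' ns'.
rewrite {2}/s' big_cat big_map/= big_enum/=.
rewrite (eq_bigr (fun k => mass n k (B k))) => [|k _]; last by rewrite /m' eqxx.
rewrite (@eq_big_seq _ _ _ _ s m' m); last first.
  by move=> i /ns; rewrite /m' => ni; rewrite gtn_eqF.
move=> <-; apply: eq_integral => w; rewrite inE => -[_ /= Sw]; congr EFin.
rewrite weightS Sw /s' big_cat big_map/= big_enum/=.
rewrite [X in _ = _ * (_ * X)](@eq_big_seq _ _ _ _ s _
  (fun i => h i (y i.1 i.2 w))); last first.
  by move=> i /ns; rewrite /h' => ni; rewrite gtn_eqF.
rewrite [X in _ = _ * (X * _)](eq_bigr (fun k => \1_(B k) (y n k w) * r k (y n k w))) => [|k _]; last first.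
  by rewrite /h' eqxx.
rewrite big_split/=.
suff -> : (\1_[set w | forall k, k \in S -> B k (y n k w)] w : R) =
   \prod_(k in S) \1_(B k) (y n k w) by ring.
rewrite indicE; have [h1|h1] := boolP (w \in _).
  rewrite big1// => k kS; rewrite indicE mem_set//.
  by move: h1; rewrite inE => /(_ k kS).
have [k kS nB] : exists2 k, k \in S & ~ B k (y n k w).
  apply/not_exists2P => h2; move: h1; rewrite notin_setE; apply => k kS.
  by have [//|/contrapT] := h2 k.
by rewrite (bigD1 k)//= indicE memNset// mul0r.
Qed.

Lemma factors1 : factors (fun _ _ => 1) (fun=> 1).
Proof. by split => // i; rewrite integral_cst_probability. Qed.

Lemma weight_pi_step1 n : weight_factorizes n ->
  forall E S B, F_ n E -> (forall k, measurable (B k)) ->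
  (\int[P]_(w in E `&` [set w | sel G n w = S] `&`
       [set w | forall k, k \in S -> B k (y n k w)]) (W n.+1 w)%:E =
   \int[P]_(w in E `&` [set w | sel G n w = S]) (W n w)%:E *
    (\prod_(k in S) mass n k (B k))%:E)%E.
Proof.
move=> IH E S B hE mB.
have s0 (i : nat * 'I_M) : i \in [::] -> (n < i.1)%N by [].
have := @weight_pi_step n IH E S B hE mB _ _ [::] factors1 isT s0.
rewrite big_nil mulr1 => <-.
by apply: eq_integral => w _; rewrite ?big_nil mulr1.
Qed.

(** Each step is checked on [pi_gen n] and extended to [F_ n.+1] by uniqueness on pi-systems;
    finiteness is part of the induction because this uniqueness requires it. At time 0 the history
    consists of [U] alone. *)
Lemma weight_indep n : (\int[P]_w (W n w)%:E < +oo)%E /\ weight_factorizes n.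
Proof.
elim: n => [|n [IHfin IH]].
  have W0 w : W 0%N w = 1 by rewrite /weight big_ord0.
  split.
    under eq_integral do rewrite W0.
    by rewrite integral_cst_probability ltry.
  move=> E hE h m s hm us _.
  have mE : measurable E by exact: (hist_sigma_measurable mU my adaptG _ _ hE).
  under eq_integral do rewrite W0 mul1r.
  under [in RHS]eq_integral do rewrite W0.
  rewrite integral_cst// mul1e muleC -integral_cst//.
  have pm0 : 0 <= \prod_(i <- s) m i.
    by apply: prodr_ge0 => i _; apply: factors_ge0 hm.
  have eqU (A0 : set V) : measurable A0 ->
      (\int[P]_(x in U @^-1` A0) (\prod_(i <- s) h i (y i.1 i.2 x))%:E)%E =
      (\int[P]_(x in U @^-1` A0) cst (\prod_(i <- s) m i)%:E x)%E.
    move=> mA0; have mUA : measurable (U @^-1` A0).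
      by rewrite -[X in measurable X]setTI; apply: mU.
    have := @integral_prod_factors h m hm s [::] (fun=> setT) A0 us mA0
      (fun=> measurableT).
    rewrite big_nil (_ : [set` [::]] = set0); last by apply/seteqP; split.
    rewrite bigcap_set0 setIT => ->; rewrite integral_cst// mulr1 muleC EFinM fineK//.
    by rewrite fin_num_measure.
  have eT := eqU setT measurableT; rewrite preimage_setT in eT.
  apply: (@eq_integral_pi_system R _ Omega P P _ _ (hist_gen U y G 0)) => //.
  - by apply/measurable_EFinP; exact: measurable_factors hm.
  - by move=> w; rewrite lee_fin; exact: prod_factors_ge0 hm.
  - by rewrite eT integral_cst_probability ltry.
  - move=> A B [[A0 [mA0 ->]]|[[t [k [? []]]]|[t [k []]]]]//.
    move=> [[B0 [mB0 ->]]|[[t [k [? []]]]|[t [k []]]]]//.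
    left; exists (A0 `&` B0); split; first exact: measurableI.
    by rewrite preimage_setI.
  - move=> A [[A0 [mA0 ->]]|[[t [k [? []]]]|[t [k []]]]]//.
    by rewrite -[X in measurable X]setTI; apply: mU.
  - by move=> A [[A0 [mA0 ->]]|[[t [k [? []]]]|[t [k []]]]]//; exact: eqU.
have mW := measurable_weight.
have fin : (\int[P]_w (W n.+1 w)%:E < +oo)%E.
  rewrite (integral_split_sel mU my adaptG P n); last 2 first.
  - by apply/measurable_EFinP.
  - by move=> w; rewrite lee_fin weight_ge0.
  apply: lte_sum_pinfty => S _.
  have := @weight_pi_step1 n IH setT S (fun=> setT) (histT n) (fun=> measurableT).
  rewrite (_ : _ `&` _ `&` _ = [set w | sel G n w = S]); last first.
    by apply/seteqP; split => w //= [[]].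
  move=> ->//; rewrite setTI; apply: lte_mul_pinfty.
  - by apply: integral_ge0 => w _; rewrite lee_fin weight_ge0.
  - rewrite ge0_fin_numE; last by apply: integral_ge0 => w _; rewrite lee_fin weight_ge0.
    apply: le_lt_trans IHfin; apply: ge0_subset_integral => //.
    + exact: (hist_sigma_measurable mU my adaptG _ _ (adaptG n S)).
    + exact/measurable_EFinP.
    + by move=> w _; rewrite lee_fin weight_ge0.
  - exact: ltry.
split => // E hE h m s hm us ns.
have pm0 : 0 <= \prod_(i <- s) m i.
  by apply: prodr_ge0 => i _; apply: factors_ge0 hm.
have mE : measurable E by exact: (hist_sigma_measurable mU my adaptG _ _ hE).
have scal A : measurable A -> (\int[P]_(w in A) (W n.+1 w)%:E * (\prod_(i <- s) m i)%:E =
    \int[P]_(w in A) ((W n.+1 w)%:E * (\prod_(i <- s) m i)%:E))%E.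
  move=> mA; rewrite ge0_integralZr//.
  - by apply/measurable_EFinP; exact: measurable_funS (mW n.+1).
  - by move=> w _; rewrite lee_fin weight_ge0.
have eqPi A : pi_gen U y G n A ->
    (\int[P]_(w in A) (W n.+1 w * \prod_(i <- s) h i (y i.1 i.2 w))%:E =
     \int[P]_(w in A) ((W n.+1 w)%:E * (\prod_(i <- s) m i)%:E))%E.
  move=> pA; rewrite -scal; last exact: (pi_gen_measurable mU my adaptG _ _ pA).
  case: pA => [E' [S [B [hE' mB ->]]]].
  rewrite (@weight_pi_step n IH E' S B hE' mB h m s hm us ns).
  by rewrite EFinM muleA -(@weight_pi_step1 n IH E' S B hE' mB).
have mWm : measurable_fun setT (fun w => ((W n.+1 w)%:E * (\prod_(i <- s) m i)%:E)%E).
  by apply: emeasurable_funM => //; apply/measurable_EFinP.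
have Wm0 w : (0 <= (W n.+1 w)%:E * (\prod_(i <- s) m i)%:E)%E.
  by rewrite -EFinM lee_fin mulr_ge0// weight_ge0.
have Wh0 w : (0 <= (W n.+1 w * \prod_(i <- s) h i (y i.1 i.2 w))%:E)%E.
  by rewrite lee_fin mulr_ge0 ?weight_ge0//; exact: prod_factors_ge0 hm.
have eqT : (\int[P]_w (W n.+1 w * \prod_(i <- s) h i (y i.1 i.2 w))%:E =
     \int[P]_w ((W n.+1 w)%:E * (\prod_(i <- s) m i)%:E))%E.
  rewrite (integral_split_sel mU my adaptG P n)//; last first.
    exact: measurable_WP hm.
  rewrite [RHS](integral_split_sel mU my adaptG P n)//.
  apply: eq_bigr => S _; apply: eqPi; exists setT, S, (fun=> setT); split => //.
    exact: histT.
  by apply/seteqP; split => w //= [[]].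
rewrite scal//.
apply: (@eq_integral_pi_system R _ Omega P P _ _ (pi_gen U y G n)) => //.
- exact: measurable_WP hm.
- rewrite eqT -scal// lte_mul_pinfty ?ltry//.
  + by apply: integral_ge0 => w _; rewrite lee_fin weight_ge0.
  + rewrite ge0_fin_numE//.
    by apply: integral_ge0 => w _; rewrite lee_fin weight_ge0.
- exact: pi_gen_setI.
- exact: (pi_gen_measurable mU my adaptG).
- exact: (hist_sigmaS_pi adaptG _ _ hE).
Qed.

End Weights.
End Independence.
Set Implicit Arguments.

(** * Change of measure on the history of a policy *)

Unset Implicit Arguments.
Section ChangeOfMeasure.
Context (R : realType) (dO dV dY : measure_display) (Omega : measurableType dO)
  (V : measurableType dV) (Y : measurableType dY) (M : nat).
Variables (U : Omega -> V) (y : nat -> 'I_M -> Omega -> Y).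
Hypothesis mU : measurable_fun setT U.
Hypothesis my : forall n k, measurable_fun setT (y n k).
Variables (P P' : probability Omega R).
Hypothesis indP : indep_model P U y.
Hypothesis indP' : indep_model P' U y.
Variables (G : policy Omega M) (r : 'I_M -> Y -> R).
Hypothesis adaptG : forall n (S : {set 'I_M}),
  hist_sigma U y G n [set w | sel G n w = S].
Hypothesis mr : forall k, measurable_fun setT (r k).
Hypothesis r0 : forall k x, 0 <= r k x.
Hypothesis eqU : forall B, measurable B -> P (U @^-1` B) = P' (U @^-1` B).
Hypothesis ratio : forall n k B, measurable B ->
  (\int[P]_(w in y n k @^-1` B) (r k (y n k w))%:E = P' (y n k @^-1` B))%E.

Let integral1 A : measurable A -> (\int[P']_(w in A) 1%:E = P' A)%E.
Proof. by move=> mA; rewrite integral_cst// mul1e. Qed.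

Let rfin n k : (\int[P]_w (r k (y n k w))%:E < +oo)%E.
Proof.
have := ratio n k setT measurableT; rewrite preimage_setT => ->.
by apply: le_lt_trans (ltry 1); apply: probability_le1.
Qed.

(** Under [P'] the factorization is used with the constant weight [one]. On a slice both sides are
    then an earlier term, equal by induction, times a product of one-step masses, equal by
    [ratio]. *)
Lemma weight_change_of_measure n E : hist_sigma U y G n E ->
  (\int[P]_(w in E) (weight y G r n w)%:E = P' E)%E.
Proof.
move=> hE; rewrite -integral1; last exact: (hist_sigma_measurable mU my adaptG _ _ hE).
elim: n E hE => [|n IH] E hE.
  have W0 w : weight y G r 0 w = 1 by rewrite /weight big_ord0.
  under eq_integral do rewrite W0.
  apply: (@eq_integral_pi_system R _ Omega P P' (fun=> 1%:E) (fun=> 1%:E)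
    (hist_gen U y G 0)) => //.
  - by rewrite integral_cst_probability ltry.
  - by rewrite !integral_cst_probability.
  - move=> A B [[A0 [mA0 ->]]|[[t [k [? []]]]|[t [k []]]]]//.
    move=> [[B0 [mB0 ->]]|[[t [k [? []]]]|[t [k []]]]]//.
    left; exists (A0 `&` B0); split; first exact: measurableI.
    by rewrite preimage_setI.
  - move=> A [[A0 [mA0 ->]]|[[t [k [? []]]]|[t [k []]]]]//.
    by rewrite -[X in measurable X]setTI; apply: mU.
  - move=> A [[A0 [mA0 ->]]|[[t [k [? []]]]|[t [k []]]]]//.
    have mUA : measurable (U @^-1` A0) by rewrite -[X in measurable X]setTI; apply: mU.
    rewrite !integral_cst// !mul1e; exact: eqU.
have [_ Wn] := weight_indep _ _ _ _ _ _ _ _ _ _ mU my _ indP _ _ adaptG mr r0 rfin n.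
have [fin _] := weight_indep _ _ _ _ _ _ _ _ _ _ mU my _ indP _ _ adaptG mr r0 rfin n.+1.
pose one (k : 'I_M) (x : Y) : R := 1.
have mone k : measurable_fun setT (one k) by exact: measurable_cst.
have one0 k x : 0 <= one k x by [].
have onefin m k : (\int[P']_w (one k (y m k w))%:E < +oo)%E.
  by rewrite integral_cst_probability ltry.
have W1 m w : weight y G one m w = 1.
  by rewrite /weight big1// => t _; rewrite big1// => k _; case: ifP.
have [_ Vn] := weight_indep _ _ _ _ _ _ _ _ _ _ mU my _ indP' _ _ adaptG mone one0 onefin n.
have eqPi A : pi_gen U y G n A ->
    (\int[P]_(w in A) (weight y G r n.+1 w)%:E = \int[P']_(w in A) 1%:E)%E.
  case=> [E' [S [B [hE' mB ->]]]].
  rewrite (weight_pi_step1 _ _ _ _ _ _ _ _ _ _ my _ _ _ adaptG mr r0 rfin n Wn)//.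
  have := weight_pi_step1 _ _ _ _ _ _ _ _ _ _ my _ _ _ adaptG mone one0 onefin n Vn E' S B hE' mB.
  under eq_integral do rewrite W1.
  under [X in _ = (X * _)%E -> _]eq_integral do rewrite W1.
  move=> ->; rewrite IH; last exact: histI hE' (adaptG n S).
  congr (_ * (_)%:E)%E; apply: eq_bigr => k _.
  have mBk : measurable (y n k @^-1` B k) by rewrite -[X in measurable X]setTI; apply: my.
  by rewrite ratio// /one integral_cst// mul1e.
have mW : measurable_fun setT (fun w => (weight y G r n.+1 w)%:E).
  by apply/measurable_EFinP; exact: (measurable_weight _ _ _ _ _ _ _ _ _ _ mU my).
have W0 w : (0 <= (weight y G r n.+1 w)%:E)%E.
  by rewrite lee_fin; exact: weight_ge0.
apply: (@eq_integral_pi_system R _ Omega P P' _ (fun=> 1%:E) (pi_gen U y G n)) => //.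
- rewrite (integral_split_sel mU my adaptG P n)//.
  rewrite (integral_split_sel mU my adaptG P' (F := fun=> 1%:E) n)//.
  apply: eq_bigr => S _; apply: eqPi; exists setT, S, (fun=> setT); split => //.
    exact: histT.
  by apply/seteqP; split => w //= [[]].
- exact: pi_gen_setI.
- exact: (pi_gen_measurable mU my adaptG).
- exact: (hist_sigmaS_pi adaptG _ _ hE).
Qed.

End ChangeOfMeasure.
Set Implicit Arguments.

(** * Moment generating functions *)

Section IntegralGe0.
Context (R : realType) (d : measure_display) (T : measurableType d)
  (mu : {measure set T -> \bar R}).
Implicit Types F G : T -> R.

Lemma integral_addr F G : measurable_fun setT F -> measurable_fun setT G ->
  (forall x, 0 <= F x) -> (forall x, 0 <= G x) ->
  (\int[mu]_x (F x + G x)%:E = \int[mu]_x (F x)%:E + \int[mu]_x (G x)%:E)%E.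
Proof.
move=> mF mG F0 G0; under eq_integral do rewrite EFinD.
by rewrite ge0_integralD//; do ?[exact/measurable_EFinP|move=> x _; rewrite lee_fin].
Qed.

Lemma integral_scaler c F : 0 <= c -> measurable_fun setT F ->
  (forall x, 0 <= F x) ->
  (\int[mu]_x (c * F x)%:E = c%:E * \int[mu]_x (F x)%:E)%E.
Proof.
move=> c0 mF F0; under eq_integral do rewrite EFinM.
by rewrite ge0_integralZl_EFin//; do ?[exact/measurable_EFinP|move=> x _; rewrite lee_fin].
Qed.

Lemma integral_ler F G : measurable_fun setT F -> measurable_fun setT G ->
  (forall x, 0 <= F x) -> (forall x, F x <= G x) ->
  (\int[mu]_x (F x)%:E <= \int[mu]_x (G x)%:E)%E.
Proof.
move=> mF mG F0 FG; apply: ge0_le_integral => //.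
all: try by move=> x _; rewrite lee_fin.
all: exact/measurable_EFinP.
Qed.

End IntegralGe0.

Lemma expR_le_quadratic (R : realType) (u : R) :
  expR u <= 1 + u + u ^+ 2 * expR `|u|.
Proof.
have h1 : expR u - 1 <= u * expR u.
  have := expR_ge1Dx (- u); rewrite -(ler_pM2l (expR_gt0 u)) -expRD subrr expR0.
  by lra.
have [u0|u0] := leP 0 u.
  rewrite ger0_norm//.
  have h2 : u * (expR u - 1) <= u * (u * expR u) by rewrite ler_wpM2l.
  by rewrite expr2; lra.
have h2 : u * (expR u - 1) <= u * u.
  by apply: ler_wnM2l; [exact: ltW|have := expR_ge1Dx u; lra].
have h3 : u ^+ 2 <= u ^+ 2 * expR `|u|.
  by rewrite ler_peMr ?sqr_ge0// -expR0 ler_expR.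
by rewrite expr2 in h3 *; lra.
Qed.

(** The factor [x ^+ 2] costs [expR (2 * sigma * |x|)] and [expR |s * x|] costs another
    [expR (sigma * |x|)], hence the exponent [3 * sigma]. The sum of two exponentials replaces the
    absolute value. *)
Lemma expR_scale_le (R : realType) (s sigma x : R) : 0 < s -> s <= sigma ->
  expR (s * x) <= 1 + s * x + s ^+ 2 *
    (sigma ^- 2 * (expR (3 * sigma * x) + expR (- (3 * sigma * x)))).
Proof.
move=> s0 ss; have sigma0 : 0 < sigma by apply: lt_le_trans ss.
apply: le_trans (expR_le_quadratic _) _; rewrite lerD2l exprMn -[leLHS]mulrA.
apply: ler_wpM2l; first exact: sqr_ge0.
have h1 : x ^+ 2 <= sigma ^- 2 * expR (2 * sigma * `|x|).
  rewrite ler_pdivlMl ?exprn_gt0// -exprMn.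
  have h : sigma * `|x| <= expR (sigma * `|x|).
    by apply: le_trans (expR_ge1Dx _); rewrite lerDr.
  have -> : (sigma * x) ^+ 2 = (sigma * `|x|) ^+ 2.
    by rewrite !exprMn real_normK ?num_real.
  rewrite -mulrA expRM_natl.
  by rewrite lerXn2r// ?nnegrE ?expR_ge0// mulr_ge0// ltW.
have h2 : expR `|s * x| <= expR (sigma * `|x|).
  by rewrite ler_expR normrM gtr0_norm// ler_wpM2r.
apply: le_trans (ler_pM _ _ h1 h2) _; [exact: sqr_ge0|exact: expR_ge0|].
rewrite -[leLHS]mulrA -expRD; apply: ler_wpM2l.
  by rewrite invr_ge0 exprn_ge0 ?ltW.
have -> : 2 * sigma * `|x| + sigma * `|x| = 3 * sigma * `|x| by ring.
have [x0|x0] := leP 0 x.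
  by rewrite ger0_norm// lerDl expR_ge0.
by rewrite ltr0_norm// mulrN lerDr expR_ge0.
Qed.

(** The equal integrals [x] express mean zero. Then [E exp (s X) <= 1 + s^2 C <= exp (s^2 C)], which
    is below [exp (s eta)] as soon as [s C < eta]. The last conclusion serves later for rounds in
    which a cell is not observed, where the factor is 1 instead of [m]. *)
Lemma chernoff_mgf (R : realType) (d : measure_display) (T : measurableType d)
  (P : probability T R) (X : T -> R) (x theta eta : R) :
  measurable_fun setT X -> 0 < theta -> 0 < eta ->
  (\int[P]_w (Num.max (X w) 0)%:E = x%:E)%E ->
  (\int[P]_w (Num.max (- X w) 0)%:E = x%:E)%E ->
  (\int[P]_w (expR (theta * X w))%:E < +oo)%E ->
  (\int[P]_w (expR (- (theta * X w)))%:E < +oo)%E ->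
  exists s m, [/\ 0 < s, (\int[P]_w (expR (s * X w))%:E = m%:E)%E,
    expR (- (s * eta)) * m < 1 & expR (- (s * eta)) < 1].
Proof.
move=> mX theta0 eta0 xp xn fp fn.
pose sigma := theta / 3.
have sigma0 : 0 < sigma by rewrite divr_gt0.
have theta3 : 3 * sigma = theta by rewrite /sigma; lra.
have mE c : measurable_fun setT (fun w => expR (c * X w)).
  apply: measurableT_comp; first exact: measurable_expR.
  by apply: measurable_funM.
have mEN c : measurable_fun setT (fun w => expR (- (c * X w))).
  have -> : (fun w => expR (- (c * X w))) = (fun w => expR ((- c) * X w)).
    by apply/funext => w; rewrite mulNr.
  exact: mE.
have mp : measurable_fun setT (fun w => Num.max (X w) 0).
  by apply: measurable_maxr.
have mn : measurable_fun setT (fun w => Num.max (- X w) 0).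
  by apply: measurable_maxr => //; apply: measurableT_comp.
have p0 w : 0 <= Num.max (X w) 0 by rewrite le_max lexx orbT.
have n0 w : 0 <= Num.max (- X w) 0 by rewrite le_max lexx orbT.
pose a := fine (\int[P]_w (expR (theta * X w))%:E)%E.
pose b := fine (\int[P]_w (expR (- (theta * X w)))%:E)%E.
have ea : (\int[P]_w (expR (theta * X w))%:E = a%:E)%E.
  by rewrite fineK// ge0_fin_numE// integral_ge0// => w _; rewrite lee_fin expR_ge0.
have eb : (\int[P]_w (expR (- (theta * X w)))%:E = b%:E)%E.
  by rewrite fineK// ge0_fin_numE// integral_ge0// => w _; rewrite lee_fin expR_ge0.
pose C := sigma ^- 2 * (a + b).
have C0 : 0 <= C.
  apply: mulr_ge0; first by rewrite invr_ge0 exprn_ge0 ?ltW.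
  rewrite -lee_fin EFinD -ea -eb.
  by rewrite adde_ge0// integral_ge0// => w _; rewrite lee_fin expR_ge0.
pose s := Num.min sigma (eta / (2 * (C + 1))).
have C1 : 0 < 2 * (C + 1) by lra.
have s0 : 0 < s by rewrite lt_min sigma0 divr_gt0.
have ss : s <= sigma by rewrite ge_min lexx.
have sC : s * C < eta.
  have : s <= eta / (2 * (C + 1)) by rewrite ge_min lexx orbT.
  by rewrite ler_pdivlMr// => h; nra.
have msn : measurable_fun setT (fun w => s * Num.max (- X w) 0).
  exact: measurable_funM.
have msp : measurable_fun setT (fun w => s * Num.max (X w) 0).
  exact: measurable_funM.
have sn0 w : 0 <= s * Num.max (- X w) 0 by rewrite mulr_ge0// ltW.
have sp0 w : 0 <= s * Num.max (X w) 0 by rewrite mulr_ge0// ltW.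
have mee : measurable_fun setT (fun w => expR (theta * X w) + expR (- (theta * X w))).
  exact: measurable_funD.
have ee w : 0 <= expR (theta * X w) + expR (- (theta * X w)).
  by rewrite addr_ge0 ?expR_ge0.
have c0 : 0 <= s ^+ 2 * sigma ^- 2.
  by rewrite mulr_ge0 ?sqr_ge0// invr_ge0 sqr_ge0.
have mcee : measurable_fun setT (fun w => s ^+ 2 * sigma ^- 2 *
    (expR (theta * X w) + expR (- (theta * X w)))).
  exact: measurable_funM.
have cee w : 0 <= s ^+ 2 * sigma ^- 2 *
    (expR (theta * X w) + expR (- (theta * X w))).
  by rewrite mulr_ge0.
have m1sp : measurable_fun setT (fun w => 1 + s * Num.max (X w) 0).
  exact: measurable_funD.
have sp1 w : 0 <= 1 + s * Num.max (X w) 0 by rewrite addr_ge0.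
have exp0 c w : 0 <= expR (c * X w) by exact: expR_ge0.
have expN0 c w : 0 <= expR (- (c * X w)) by exact: expR_ge0.
(* The negative part of the linear term is moved to the left, so that both sides integrate
   nonnegative functions; the finite [s * x] cancels afterwards. *)
have key : (\int[P]_w (expR (s * X w))%:E + (s * x)%:E <=
    (1 + s * x + s ^+ 2 * C)%:E)%E.
  have -> : (\int[P]_w (expR (s * X w))%:E + (s * x)%:E =
      \int[P]_w (expR (s * X w) + s * Num.max (- X w) 0)%:E)%E.
    by rewrite integral_addr// integral_scaler ?(ltW s0)// xn.
  have -> : ((1 + s * x + s ^+ 2 * C)%:E = \int[P]_w (1 + s * Num.max (X w) 0 +
     s ^+ 2 * sigma ^- 2 * (expR (theta * X w) + expR (- (theta * X w))))%:E)%E.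
    rewrite integral_addr// integral_addr// integral_cst_probability.
    rewrite integral_scaler ?(ltW s0)// xp integral_scaler// integral_addr//.
    by rewrite ea eb /C mulrA.
  apply: integral_ler.
  - exact: measurable_funD.
  - exact: measurable_funD.
  - by move=> w; rewrite addr_ge0.
  - move=> w; have := @expR_scale_le _ s sigma (X w) s0 ss; rewrite theta3 !mulrA.
    have -> : s * X w = s * Num.max (X w) 0 - s * Num.max (- X w) 0.
      rewrite -mulrBr; congr (_ * _); rewrite /Num.max.
      by case: ltP => h1; case: ltP => h2; lra.
    by lra.
have fin : (\int[P]_w (expR (s * X w))%:E \is a fin_num)%E.
  rewrite ge0_fin_numE; last by apply: integral_ge0 => w _; rewrite lee_fin expR_ge0.
  rewrite ltey; apply: contraTneq key => ->; rewrite addye// -ltNge ltry//.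
exists s, (fine (\int[P]_w (expR (s * X w))%:E)%E); split => //.
- by rewrite fineK.
- have : fine (\int[P]_w (expR (s * X w))%:E)%E <= 1 + s ^+ 2 * C.
    by move: key; rewrite -(fineK fin) -EFinD lee_fin; lra.
  move=> h; apply: (@le_lt_trans _ _ (expR (- (s * eta)) * expR (s ^+ 2 * C))).
    rewrite ler_wpM2l ?expR_ge0//; apply: le_trans h _; exact: expR_ge1Dx.
  rewrite -expRD -expR0 ltr_expR.
  by rewrite expr2; nra.
- by rewrite -expR0 ltr_expR oppr_lt0 mulr_gt0.
Qed.

(** * Expectations as integrals against a density *)

Section Densities.
Context (R : realType) (dY : measure_display) (Y : measurableType dY)
  (mu : {measure set Y -> \bar R}).

Lemma law_integral (dO : measure_display) (Omega : measurableType dO)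
  (P : probability Omega R) (X : Omega -> Y) (p : Y -> R) :
  measurable_fun setT X -> measurable_fun setT p -> (forall x, 0 <= p x) ->
  (forall B, measurable B -> P (X @^-1` B) = \int[mu]_(x in B) (p x)%:E)%E ->
  forall h : Y -> R, measurable_fun setT h -> (forall x, 0 <= h x) ->
  (\int[P]_w (h (X w))%:E = \int[mu]_x (p x * h x)%:E)%E.
Proof.
move=> mX mp p0 law h mh h0.
rewrite -(@eq_integral_comp R _ _ _ Omega Y Y P mu X id (fun=> 1) p)//.
  by apply: eq_integral => w _; rewrite mul1r.
move=> B mB; rewrite integral_cst//; last by rewrite -[X in measurable X]setTI; apply: mX.
by rewrite mul1e; exact: law.
Qed.

Lemma law_integral_set (dO : measure_display) (Omega : measurableType dO)
  (P : probability Omega R) (X : Omega -> Y) (p : Y -> R) :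
  measurable_fun setT X -> measurable_fun setT p -> (forall x, 0 <= p x) ->
  (forall B, measurable B -> P (X @^-1` B) = \int[mu]_(x in B) (p x)%:E)%E ->
  forall (h : Y -> R) B, measurable_fun setT h -> (forall x, 0 <= h x) -> measurable B ->
  (\int[P]_(w in X @^-1` B) (h (X w))%:E = \int[mu]_(x in B) (p x * h x)%:E)%E.
Proof.
move=> mX mp p0 law h B mh h0 mB.
rewrite -[LHS]integral_indic_setT -[RHS]integral_indic_setT.
have := law_integral mX mp p0 law (h := fun x => \1_B x * h x).
move=> H; rewrite (eq_integral (fun w => (\1_B (X w) * h (X w))%:E)).
  rewrite H//.
  - by apply: eq_integral => x _; rewrite mulrCA.
  - by apply: measurable_funM.
  - by move=> x; rewrite mulr_ge0.
by move=> w _; rewrite !indicE.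
Qed.

Lemma KL_finiteE (p q : Y -> R) : (KL mu p q < +oo)%E ->
  {ae mu, forall x, q x = 0 -> p x = 0} /\
  KL mu p q = (\int[mu]_x (p x * ln (p x / q x))%:E)%E.
Proof. by rewrite /KL; case: pselect => //=; rewrite ltxx. Qed.

Lemma integral_pos_neg_parts (p h : Y -> R) (a b : R) : (forall x, 0 <= p x) ->
  (\int[mu]_x (p x * Num.max (h x) 0)%:E = a%:E)%E ->
  (\int[mu]_x (p x * Num.max (- h x) 0)%:E = b%:E)%E ->
  fine (\int[mu]_x (p x * h x)%:E)%E = a - b.
Proof.
move=> p0 ha hb; rewrite integralE.
rewrite (_ : (\int[mu]_x ((fun x => (p x * h x)%:E)^\+ x))%E = a%:E); last first.
  rewrite -ha; apply: eq_integral => x _; rewrite funeposE.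
  by rewrite maxr_pMr// mulr0 EFin_max.
rewrite (_ : (\int[mu]_x ((fun x => (p x * h x)%:E)^\- x))%E = b%:E)//.
rewrite -hb; apply: eq_integral => x _; rewrite funenegE.
by rewrite maxr_pMr// mulr0 EFin_max mulrN.
Qed.

Lemma max0_le_expR (s x : R) : 0 < s -> Num.max x 0 <= s^-1 * expR (s * x).
Proof.
move=> s0; rewrite ge_max; apply/andP; split; last first.
  by rewrite mulr_ge0 ?expR_ge0// invr_ge0 ltW.
by rewrite ler_pdivlMl//; apply: le_trans (expR_ge1Dx _); rewrite lerDr.
Qed.

Lemma integral_max0_lty (p h : Y -> R) (s : R) : 0 < s ->
  measurable_fun setT p -> measurable_fun setT h -> (forall x, 0 <= p x) ->
  (\int[mu]_x (p x * expR (s * h x))%:E < +oo)%E ->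
  exists2 a, 0 <= a & (\int[mu]_x (p x * Num.max (h x) 0)%:E = a%:E)%E.
Proof.
move=> s0 mp mh p0 fin.
have mm : measurable_fun setT (fun x => p x * Num.max (h x) 0).
  by apply: measurable_funM => //; exact: measurable_maxr.
have m0 x : 0 <= p x * Num.max (h x) 0.
  by rewrite mulr_ge0// le_max lexx orbT.
have me : measurable_fun setT (fun x => p x * expR (s * h x)).
  apply: measurable_funM => //; apply: measurableT_comp => //.
  exact: measurable_funM.
have e0 x : 0 <= p x * expR (s * h x) by rewrite mulr_ge0// expR_ge0.
have s'0 : 0 <= s^-1 by rewrite invr_ge0 ltW.
have ge0 : (0 <= \int[mu]_x (p x * Num.max (h x) 0)%:E)%E.
  by apply: integral_ge0 => x _; rewrite lee_fin.
have fn : (\int[mu]_x (p x * Num.max (h x) 0)%:E)%E \is a fin_num.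
  rewrite ge0_fin_numE//.
  apply: (@le_lt_trans _ _ (s^-1%:E * \int[mu]_x (p x * expR (s * h x))%:E)%E).
    rewrite -integral_scaler//; apply: integral_ler => //.
      exact: measurable_funM.
    by move=> x; rewrite mulrCA ler_wpM2l// max0_le_expR.
  apply: lte_mul_pinfty => //.
exists (fine (\int[mu]_x (p x * Num.max (h x) 0)%:E)%E); last by rewrite fineK.
exact: fine_ge0.
Qed.

End Densities.

Lemma max0B (R : realType) (u : R) : Num.max u 0 - Num.max (- u) 0 = u.
Proof.
have [u0|/ltW u0] := leP 0 u.
  by rewrite max_r ?subr0// oppr_le0.
by rewrite max_l ?oppr_ge0// sub0r opprK.
Qed.

Lemma chernoff_centered (R : realType) (d : measure_display) (T : measurableType d)
  (P : probability T R) (Z : T -> R) (a b theta eta : R) (sg : bool) :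
  measurable_fun setT Z -> 0 < theta -> 0 < eta ->
  (\int[P]_w (Num.max (Z w) 0)%:E = a%:E)%E ->
  (\int[P]_w (Num.max (- Z w) 0)%:E = b%:E)%E ->
  (\int[P]_w (expR (theta * Z w))%:E < +oo)%E ->
  (\int[P]_w (expR (- theta * Z w))%:E < +oo)%E ->
  exists s m, [/\ 0 < s,
    (\int[P]_w (expR (s * ((-1) ^+ sg * (Z w - (a - b)))))%:E = m%:E)%E,
    expR (- (s * eta)) * m < 1 & expR (- (s * eta)) < 1].
Proof.
move=> mZ theta0 eta0 ha hb fp fn.
pose X w := Z w - (a - b).
have mX : measurable_fun setT X by apply: measurable_funB.
have max_ge0 (u : R) : 0 <= Num.max u 0 by rewrite le_max lexx orbT.
have mm (F : T -> R) : measurable_fun setT F -> measurable_fun setT (fun w => Num.max (F w) 0).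
  by move=> mF; apply: measurable_maxr.
have mNX : measurable_fun setT (fun w => - X w) by apply: measurableT_comp.
have mNZ : measurable_fun setT (fun w => - Z w) by apply: measurableT_comp.
have fX (F : T -> R) (u : R) : measurable_fun setT F -> (forall w, F w <= Z w + u) ->
    (\int[P]_w (Num.max (F w) 0)%:E)%E \is a fin_num.
  move=> mF FZ; rewrite ge0_fin_numE; last first.
    by apply: integral_ge0 => w _; rewrite lee_fin.
  apply: (@le_lt_trans _ _ (\int[P]_w (Num.max (Z w) 0 + `|u|)%:E)%E).
    apply: integral_ler => //; first exact: mm.
      by apply: measurable_funD => //; exact: mm.
    move=> w; rewrite ge_max addr_ge0// andbT.
    by apply: le_trans (FZ w) _; rewrite lerD ?le_max ?lexx// ler_norm.
  rewrite integral_addr//; last exact: mm.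
  by rewrite ha integral_cst_probability -EFinD ltry.
have fNX (F : T -> R) (u : R) : measurable_fun setT F -> (forall w, F w <= - Z w + u) ->
    (\int[P]_w (Num.max (F w) 0)%:E)%E \is a fin_num.
  move=> mF FZ; rewrite ge0_fin_numE; last first.
    by apply: integral_ge0 => w _; rewrite lee_fin.
  apply: (@le_lt_trans _ _ (\int[P]_w (Num.max (- Z w) 0 + `|u|)%:E)%E).
    apply: integral_ler => //; first exact: mm.
      by apply: measurable_funD => //; exact: mm.
    move=> w; rewrite ge_max addr_ge0// andbT.
    by apply: le_trans (FZ w) _; rewrite lerD ?le_max ?lexx// ler_norm.
  rewrite integral_addr//; last exact: mm.
  by rewrite hb integral_cst_probability -EFinD ltry.
have f1 := fX X (- (a - b)) mX (fun w => lexx _).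
have f2 : (\int[P]_w (Num.max (- X w) 0)%:E)%E \is a fin_num.
  by apply: (fNX _ (a - b)) => // w; rewrite /X opprB addrC.
pose x := fine (\int[P]_w (Num.max (X w) 0)%:E)%E.
have ex1 : (\int[P]_w (Num.max (X w) 0)%:E = x%:E)%E by rewrite fineK.
(* From [X = Z - (a - b)] follows the pointwise identity [X^+ + Z^- + c = X^- + Z^+ + c'], where [c]
   and [c'] are the parts of [a - b]. All terms have finite integrals, and those of [Z] are [a] and
   [b]. *)
have ex2 : (\int[P]_w (Num.max (- X w) 0)%:E = x%:E)%E.
  pose c := Num.max (a - b) 0; pose c' := Num.max (- (a - b)) 0.
  have c0 : 0 <= c by exact: max_ge0.
  have c'0 : 0 <= c' by exact: max_ge0.
  have cc : c - c' = a - b.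
    exact: max0B.
  have : (\int[P]_w (Num.max (X w) 0 + Num.max (- Z w) 0 + c)%:E =
          \int[P]_w (Num.max (- X w) 0 + Num.max (Z w) 0 + c')%:E)%E.
    apply: eq_integral => w _; congr EFin.
    have h1 := max0B (X w); have h2 := max0B (Z w).
    have h3 : X w = Z w - (a - b) by [].
    have e4 (u1 u2 u3 u4 v v' s t q : R) : u1 - u2 = s -> u3 - u4 = t ->
        s = t - q -> v - v' = q -> u1 + u4 + v = u2 + u3 + v'.
      by move=> e1 e2 e3 e4; lra.
    exact: (e4 _ _ _ _ _ _ _ _ _ h1 h2 h3 cc).
  have mXm := mm _ mX; have mNXm := mm _ mNX; have mZm := mm _ mZ; have mNZm := mm _ mNZ.
  rewrite integral_addr//; last 2 first.
  - exact: measurable_funD.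
  - by move=> w; rewrite addr_ge0.
  rewrite integral_addr//.
  rewrite [RHS]integral_addr//; last 2 first.
  - exact: measurable_funD.
  - by move=> w; rewrite addr_ge0.
  have [x2 ex2] : exists x2, (\int[P]_w (Num.max (- X w) 0)%:E = x2%:E)%E.
    by exists (fine (\int[P]_w (Num.max (- X w) 0)%:E)%E); rewrite fineK.
  rewrite integral_addr// !integral_cst_probability ha hb ex1 ex2 -!EFinD => -[h].
  congr EFin; move: h cc {c0 c'0}; rewrite /x; move: (fine _) c c' => x1 c c'.
  by lra.
have fe (t : R) : (\int[P]_w (expR (t * Z w))%:E < +oo)%E ->
    (\int[P]_w (expR (t * X w))%:E < +oo)%E.
  move=> ft; have -> : (\int[P]_w (expR (t * X w))%:E =
     (expR (- (t * (a - b))))%:E * \int[P]_w (expR (t * Z w))%:E)%E.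
    rewrite -integral_scaler ?expR_ge0//.
    - by apply: eq_integral => w _; rewrite -expRD /X; congr (expR _)%:E; ring.
    - apply: measurableT_comp => //; exact: measurable_funM.
  by apply: lte_mul_pinfty; [rewrite lee_fin expR_ge0| |exact: ft].
have {}fp := fe _ fp; have {fn}fn := fe _ fn.
case: sg.
  have [|||s [m [s0 h1 h2 h3]]] := @chernoff_mgf R d T P (fun w => - X w) x theta eta
    mNX theta0 eta0 ex2 _ _ _.
  - by under eq_integral do rewrite opprK.
  - by under eq_integral do rewrite mulrN -mulNr.
  - by under eq_integral do rewrite mulrN opprK.
  exists s, m; split => //; rewrite -h1; apply: eq_integral => w _.
  by rewrite expr1 mulN1r.
have [|s [m [s0 h1 h2 h3]]] := @chernoff_mgf R d T P X x theta eta
    mX theta0 eta0 ex1 ex2 fp _.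
  by under eq_integral do rewrite -mulNr.
exists s, m; split => //; rewrite -h1; apply: eq_integral => w _.
by rewrite expr0 mul1r.
Qed.

(** * The observation model *)

Lemma card_ord_lt (M L : nat) : (L <= M)%N -> #|[set k : 'I_M | (k < L)%N]%SET| = L.
Proof.
move=> LM; have inj : injective (widen_ord LM).
  by move=> i j /(congr1 val) e; apply: val_inj.
rewrite -[RHS]card_ord -(card_imset _ inj).
apply: eq_card => k; rewrite inE; apply/idP/imsetP => [kL|[i _ ->]].
  by exists (Ordinal kL) => //; apply/val_inj.
by rewrite /= ltn_ord.
Qed.

(** Since [ln 0 = 0] and the inverse of 0 is 0, [llr] is a difference of logarithms where both
    densities are positive and 0 elsewhere. *)
Lemma measurable_llr (R : realType) (d : measure_display) (Y : measurableType d)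
  (f g : Y -> R) : measurable_fun setT f -> measurable_fun setT g ->
  (forall x, 0 <= f x) -> (forall x, 0 <= g x) -> measurable_fun setT (llr f g).
Proof.
move=> mf mg f0 g0.
have -> : llr f g = fun x => if 0 < f x then
    (if 0 < g x then ln (g x) - ln (f x) else 0) else 0.
  apply/funext => x; rewrite /llr; case: ltP => [fx|fx].
    case: ltP => [gx|gx]; first by rewrite ln_div.
    have /eqP -> : g x == 0 by rewrite eq_le gx g0.
    by rewrite mul0r ln0.
  have /eqP -> : f x == 0 by rewrite eq_le fx f0.
  by rewrite invr0 mulr0 ln0.
apply: measurable_fun_ifT => //; first exact: measurable_fun_ltr.
apply: measurable_fun_ifT => //; first exact: measurable_fun_ltr.
by apply: measurable_funB; apply: measurableT_comp => //; exact: measurable_ln.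
Qed.

Lemma llr_swap (R : realType) (Y : Type) (f g : Y -> R) x :
  (forall x, 0 <= f x) -> (forall x, 0 <= g x) -> llr g f x = - llr f g x.
Proof.
move=> f0 g0; rewrite /llr -[g x / f x]invf_div.
have := divr_ge0 (f0 x) (g0 x); rewrite le_eqVlt => /predU1P[<-|h].
  by rewrite invr0 ln0 ?oppr0.
by rewrite lnV// opprK.
Qed.

Unset Implicit Arguments.
Section Model.
Context (R : realType) (M L : nat) (dY : measure_display) (Y : measurableType dY)
  (mu : {measure set Y -> \bar R}) (f g : Y -> R)
  (dO : measure_display) (Omega : measurableType dO)
  (dV : measure_display) (V : measurableType dV)
  (P : {set 'I_M} -> probability Omega R) (U : Omega -> V)
  (y : nat -> 'I_M -> Omega -> Y).
Hypotheses (L0 : (0 < L)%N) (LM : (L < M)%N).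
Hypotheses (df : is_density mu f) (dg : is_density mu g).
Hypotheses (kgf : (0 < KL mu g f < +oo)%E) (kfg : (0 < KL mu f g < +oo)%E).
Hypothesis mgf : exists2 eps : R, 0 < eps & forall s : R, `|s| < eps ->
     (\int[mu]_x (f x * expR (s * llr f g x))%:E < +oo)%E /\
     (\int[mu]_x (g x * expR (s * llr f g x))%:E < +oo)%E.
Hypothesis model : search_model L mu f g P U y.

Let mf : measurable_fun setT f. Proof. by case: df. Qed.
Let mg : measurable_fun setT g. Proof. by case: dg. Qed.
Let f0 x : 0 <= f x. Proof. by case: df => _ []. Qed.
Let g0 x : 0 <= g x. Proof. by case: dg => _ []. Qed.
Let ml : measurable_fun setT (llr f g). Proof. exact: measurable_llr. Qed.
Local Notation D1 := (fine (KL mu g f)).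
Local Notation D2 := (fine (KL mu f g)).

Definition density_of (b : bool) : Y -> R := if b then g else f.

Let md b : measurable_fun setT (density_of b). Proof. by case: b. Qed.
Let d0 b x : 0 <= density_of b x. Proof. by case: b. Qed.

Lemma observation_measurable n k : measurable_fun setT (y n k).
Proof. by case: model. Qed.

Lemma observation_law (A : {set 'I_M}) n k B : #|A| = L -> measurable B ->
  (P A (y n k @^-1` B) = \int[mu]_(x in B) (density_of (k \in A) x)%:E)%E.
Proof.
case: model => _ _ _ law _ AL mB; rewrite law//.
by apply: eq_integral => x _; rewrite /density_of; case: ifP.
Qed.

Lemma observation_integral (A : {set 'I_M}) n k (h : Y -> R) : #|A| = L ->
  measurable_fun setT h -> (forall x, 0 <= h x) ->
  (\int[P A]_w (h (y n k w))%:E = \int[mu]_x (density_of (k \in A) x * h x)%:E)%E.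
Proof.
move=> AL mh h0; apply: (@law_integral _ _ _ _ _ _ _ (y n k)) => //.
- exact: observation_measurable.
- by move=> B mB; exact: observation_law.
Qed.

Let mgfs : exists2 theta : R, 0 < theta & forall b,
  (\int[mu]_x (density_of b x * expR (theta * llr f g x))%:E < +oo)%E /\
  (\int[mu]_x (density_of b x * expR (- theta * llr f g x))%:E < +oo)%E.
Proof.
case: mgf => eps eps0 h; exists (eps / 2); first by rewrite divr_gt0.
have e1 : `|eps / 2| < eps by rewrite ger0_norm; lra.
have e2 : `|- (eps / 2)| < eps by rewrite normrN.
by case; split; [case: (h _ e1)|case: (h _ e2)|case: (h _ e1)|case: (h _ e2)].
Qed.

Lemma density_moments : exists mp mn : bool -> R,
  [/\ forall b, 0 <= mp b /\ 0 <= mn b,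
      forall b, (\int[mu]_x (density_of b x * Num.max (llr f g x) 0)%:E = (mp b)%:E)%E,
      forall b, (\int[mu]_x (density_of b x * Num.max (- llr f g x) 0)%:E = (mn b)%:E)%E,
      mp true - mn true = D1 & mn false - mp false = D2].
Proof.
have [theta t0 ht] := mgfs.
have mnl : measurable_fun setT (fun x => - llr f g x) by apply: measurableT_comp.
have H1 b : exists a, 0 <= a /\
    (\int[mu]_x (density_of b x * Num.max (llr f g x) 0)%:E = a%:E)%E.
  by have [a ? ?] := integral_max0_lty t0 (md b) ml (d0 b) (ht b).1; exists a.
have H2 b : exists a, 0 <= a /\
    (\int[mu]_x (density_of b x * Num.max (- llr f g x) 0)%:E = a%:E)%E.
  have [|a ? ?] := integral_max0_lty (mu := mu) t0 (md b) mnl (d0 b); last by exists a.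
  by under eq_integral do rewrite mulrN -mulNr; exact: (ht b).2.
have [p1 [p10 hp1]] := H1 true; have [p2 [p20 hp2]] := H1 false.
have [n1 [n10 hn1]] := H2 true; have [n2 [n20 hn2]] := H2 false.
exists (fun b => if b then p1 else p2), (fun b => if b then n1 else n2).
split => //; do ?by case.
- have [_ ->] := KL_finiteE (proj2 (andP kgf)).
  exact/esym/(integral_pos_neg_parts (h := llr f g) g0).
- have [_ ->] := KL_finiteE (proj2 (andP kfg)).
  rewrite -(@integral_pos_neg_parts _ _ _ mu f (llr g f) n2 p2)//.
  + by rewrite -hn2; apply: eq_integral => x _; rewrite llr_swap.
  + by rewrite -hp2; apply: eq_integral => x _; rewrite llr_swap// opprK.
Qed.

Definition mean_llr (b : bool) : R := if b then D1 else - D2.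

Let A0 : {set 'I_M} := [set k : 'I_M | (k < L)%N].
Let cardA0 : #|A0| = L. Proof. exact/card_ord_lt/ltnW. Qed.

Let rep b : exists k, (k \in A0) = b.
Proof.
case: b.
  by exists (Ordinal (ltn_trans L0 LM)); rewrite inE.
by exists (Ordinal LM); rewrite inE ltnn.
Qed.

(** The law of an observation depends only on whether its cell is abnormal. So [s] and [m] are
    computed for one representative cell under the hypothesis [A0] and serve for all [A], [n] and
    [k]. *)
Lemma observation_chernoff b (sg : bool) eta : 0 < eta ->
  exists s m, [/\ 0 < s, expR (- (s * eta)) * m < 1, expR (- (s * eta)) < 1 &
    forall (A : {set 'I_M}) n k, #|A| = L -> (k \in A) = b ->
    (\int[P A]_w (expR (s * ((-1) ^+ sg * (llr f g (y n k w) - mean_llr b))))%:E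
      = m%:E)%E].
Proof.
move=> eta0; have [mp [mn [_ hp hn e1 e2]]] := density_moments.
have [theta t0 ht] := mgfs.
have [k kb] := rep b.
have mly : measurable_fun setT (fun w => llr f g (y 0%N k w)).
  by apply: measurableT_comp => //; exact: observation_measurable.
have mx0 (u : R) : 0 <= Num.max u 0 by rewrite le_max lexx orbT.
have mE (t : R) : measurable_fun setT (fun x => expR (t * llr f g x)).
  by apply: measurableT_comp => //; exact: measurable_funM.
have gE (t : R) x : 0 <= expR (t * llr f g x) by exact: expR_ge0.
have eb : mp b - mn b = mean_llr b.
  by rewrite /mean_llr; case: (b) => //; rewrite -e2 opprB.
have [||||s [m [s0 hm h1 h2]]] := @chernoff_centered R _ Omega (P A0)
  (fun w => llr f g (y 0%N k w)) (mp b) (mn b) theta eta sg mly t0 eta0 _ _ _ _.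
- rewrite (observation_integral _ _ _ (fun x => Num.max (llr f g x) 0))// ?kb//.
  exact: measurable_maxr.
- rewrite (observation_integral _ _ _ (fun x => Num.max (- llr f g x) 0))// ?kb//.
  by apply: measurable_maxr => //; exact: measurableT_comp.
- rewrite (observation_integral _ _ _ (fun x => expR (theta * llr f g x)))//.
  by rewrite kb; exact: (ht b).1.
- rewrite (observation_integral _ _ _ (fun x => expR (- theta * llr f g x)))//.
  by rewrite kb; exact: (ht b).2.
exists s, m; split => // A n k' AL k'b.
have mh : measurable_fun setT (fun x =>
    expR (s * ((-1) ^+ sg * (llr f g x - mean_llr b)))).
  apply: measurableT_comp => //; apply: measurable_funM => //.
  by apply: measurable_funM => //; exact: measurable_funB.
rewrite (observation_integral _ _ _ (fun x =>
  expR (s * ((-1) ^+ sg * (llr f g x - mean_llr b)))))//.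
rewrite -hm (observation_integral _ _ _ (fun x =>
  expR (s * ((-1) ^+ sg * (llr f g x - (mp b - mn b))))))//.
- by rewrite kb k'b eb.
- by rewrite eb.
Qed.

(** Likelihood ratio, for one observation of cell [k], of the hypothesis [j |: A :\ i] against [A],
    when [i] is in [A] and [j] is not. *)
Definition swap_ratio (i j k : 'I_M) (x : Y) : R :=
  if k == i then expR (- llr f g x) else if k == j then expR (llr f g x) else 1.

Lemma measurable_swap_ratio i j k : measurable_fun setT (swap_ratio i j k).
Proof.
rewrite /swap_ratio; case: (k == i); last case: (k == j).
- by apply: measurableT_comp => //; exact: measurableT_comp.
- exact: measurableT_comp.
- exact: measurable_cst.
Qed.

Lemma swap_ratio_ge0 i j k x : 0 <= swap_ratio i j k x.
Proof. by rewrite /swap_ratio; do 2 case: ifP => _ //; exact: expR_ge0. Qed.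

Lemma swap_card (A : {set 'I_M}) (i j : 'I_M) : #|A| = L -> i \in A ->
  j \notin A -> #|j |: A :\ i| = L.
Proof.
move=> AL iA jA; rewrite cardsU1 !inE (negbTE jA) andbF/=.
by have := cardsD1 i A; rewrite iA AL.
Qed.

(** As [ln 0 = 0], the exponential of [llr] is not the quotient of the densities where one of them
    vanishes. Finiteness of both divergences makes [f] and [g] vanish together almost everywhere,
    and there both integrands are 0. *)
Lemma swap_ratio_law (A : {set 'I_M}) (i j : 'I_M) : #|A| = L -> i \in A ->
  j \notin A -> forall n k B, measurable B ->
  (\int[P A]_(w in y n k @^-1` B) (swap_ratio i j k (y n k w))%:E
    = P (j |: A :\ i) (y n k @^-1` B))%E.
Proof.
move=> AL iA jA n k B mB; have A'L := swap_card A i j AL iA jA.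
rewrite observation_law//.
have sr0 := swap_ratio_ge0 i j k; have mr := measurable_swap_ratio i j k.
have my := observation_measurable n k.
rewrite (@law_integral_set _ _ _ mu _ _ _ (y n k) (density_of (k \in A)) my
  (md _) (d0 _) (fun B' mB' => observation_law A n k B' AL mB') (swap_ratio i j k))//.
have ij : i != j by apply: contraNneq jA => <-.
have [h1 _] := KL_finiteE (proj2 (andP kgf)).
have [h2 _] := KL_finiteE (proj2 (andP kfg)).
apply: ge0_ae_eq_integral => //.
- by apply/measurable_EFinP/measurable_funM; exact: measurable_funS measurableT _ _.
- by apply/measurable_EFinP; exact: measurable_funS measurableT _ _.
- by move=> x _; rewrite lee_fin mulr_ge0// swap_ratio_ge0.
- by move=> x _; rewrite lee_fin.
have H : {ae mu, forall x, (f x = 0 -> g x = 0) /\ (g x = 0 -> f x = 0)}.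
  by apply: filterS2 h1 h2 => x; split.
apply: filterS H => x [fg gf] _; congr EFin; rewrite /density_of /swap_ratio !inE.
have [->|ki] := eqVneq k i.
  rewrite iA (negbTE ij)/=.
  have := g0 x; rewrite le_eqVlt => /predU1P[gx|gx]; first by rewrite gf// -gx mul0r.
  have fx : 0 < f x.
    by rewrite lt_def f0 andbT; apply/eqP => /fg gx0; rewrite gx0 ltxx in gx.
  rewrite /llr expRN lnK ?posrE ?divr_gt0// invf_div mulrCA divff ?mulr1//.
  by rewrite gt_eqF.
have [->|kj] := eqVneq k j.
  rewrite (negbTE jA)/=.
  have := f0 x; rewrite le_eqVlt => /predU1P[fx|fx]; first by rewrite fg// -fx mul0r.
  have gx : 0 < g x.
    by rewrite lt_def g0 andbT; apply/eqP => /gf fx0; rewrite fx0 ltxx in fx.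
  rewrite /llr lnK ?posrE ?divr_gt0// mulrCA divff ?mulr1//.
  by rewrite gt_eqF.
by rewrite mulr1.
Qed.

Lemma swap_change_of_measure (G : policy Omega M) (A : {set 'I_M}) (i j : 'I_M) :
  (forall n (S : {set 'I_M}), hist_sigma U y G n [set w | sel G n w = S]) ->
  #|A| = L -> i \in A -> j \notin A ->
  forall n E, hist_sigma U y G n E ->
  (\int[P A]_(w in E) (expR (- (Ssum f g y G n w i - Ssum f g y G n w j)))%:E
    = P (j |: A :\ i) E)%E.
Proof.
move=> adaptG AL iA jA n E hE; case: (model) => mU my ind _ eqU.
have A'L := swap_card A i j AL iA jA.
rewrite -(weight_change_of_measure R _ _ _ Omega V Y M U y mU my (P A) (P (j |: A :\ i))
  (ind _ AL) (ind _ A'L) G (swap_ratio i j) adaptG (measurable_swap_ratio i j)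
  (swap_ratio_ge0 i j) (fun B => eqU _ _ B AL A'L) (swap_ratio_law A i j AL iA jA)
  n E hE).
have ij : i != j by apply: contraNneq jA => <-.
apply: eq_integral => w _; congr EFin.
rewrite opprB /Ssum -sumrB expR_sum; apply: eq_bigr => t _.
rewrite (bigD1 i)//= (bigD1 j) ?(eq_sym j)//= big1 ?mulr1; last first.
  move=> k /andP[ki kj]; rewrite /swap_ratio (negbTE ki) (negbTE kj).
  by case: ifP.
rewrite /swap_ratio eqxx (eq_sym j i) (negbTE ij) eqxx mulrC expRD.
by congr (_ * _); case: ifP; rewrite ?oppr0 ?expR0.
Qed.

End Model.
Set Implicit Arguments.
Arguments observation_measurable {R M L dY Y mu f g dO Omega dV V P U y} model n k.
Arguments observation_integral {R M L dY Y mu f g dO Omega dV V P U y} df dg model A n k h.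
Arguments density_of {R dY Y} f g b.
Arguments density_moments {R dY Y mu f g} df dg kgf kfg mgf.
Arguments observation_chernoff {R M L dY Y mu f g dO Omega dV V P U y} L0 LM df dg kgf kfg
  mgf model b sg eta.
Arguments mean_llr {R dY Y} mu f g b.
Arguments swap_card {M L A} i j.
Arguments swap_change_of_measure {R M L dY Y mu f g dO Omega dV V P U y} df dg kgf kfg model
  {G A} i j adaptG AL iA jA n E hE.

(** * Lower bound *)

(** A linear program in the visits [alpha] to abnormal and [beta] to normal cells: the optimum
    saturates the kind with the larger of [D1 / L] and [D2 / (M - L)] and gives what remains to the
    other. This comparison is the case split of [I_star]. *)
Lemma rate_upper (R : realType) (M K L : nat) (D1 D2 alpha beta T : R) :
  (0 < L)%N -> (L < M)%N -> 0 <= D1 -> 0 <= D2 -> 0 <= alpha -> 0 <= beta ->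
  alpha + beta = K%:R * T -> alpha <= L%:R * T -> beta <= (M - L)%:R * T ->
  alpha * (D1 / L%:R) + beta * (D2 / (M - L)%:R) <= I_star M K L D1 D2 * T.
Proof.
move=> L0 LM D10 D20 alpha0 beta0 ab aL bL.
have L0' : (0 : R) < L%:R by rewrite ltr0n.
have ML0' : (0 : R) < (M - L)%:R by rewrite ltr0n subn_gt0.
have e1 : D1 = D1 / L%:R * L%:R by rewrite divfK// gt_eqF.
have e2 : D2 = D2 / (M - L)%:R * (M - L)%:R by rewrite divfK// gt_eqF.
rewrite /I_star; case: ifP => [vu|/negbT]; rewrite ?/I_g ?/I_f.
  have {}vu : 0 <= D1 / L%:R - D2 / (M - L)%:R by rewrite subr_ge0.
  case: leqP => KL.
    rewrite -mulrA {2}e1 (natrB _ KL).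
    have := ler_wpM2r vu aL; set u := D1 / _; set v := D2 / _ => h.
    have -> : beta = K%:R * T - alpha by rewrite -ab addrC addKr.
    have -> : (u * L%:R + (K%:R - L%:R) * v) * T =
      L%:R * T * (u - v) + K%:R * T * v by ring.
    have -> : alpha * u + (K%:R * T - alpha) * v = alpha * (u - v) + K%:R * T * v by ring.
    by rewrite lerD2r.
  rewrite -[K%:R * D1 / _]mulrA; have := mulr_ge0 beta0 vu; set u := D1 / _; set v := D2 / _ => h.
  have -> : K%:R * u * T = (alpha + beta) * u by rewrite ab; ring.
  rewrite mulrDl lerD2l -subr_ge0.
  by have -> : beta * u - beta * v = beta * (u - v) by ring.
rewrite -ltNge => /ltW uv.
have {}uv : 0 <= D2 / (M - L)%:R - D1 / L%:R by rewrite subr_ge0.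
case: ltnP => KL.
  rewrite -mulrA {2}e2.
  have -> : (K + L - M)%:R = K%:R - (M - L)%:R :> R.
    rewrite -natrB; last exact: ltnW.
    by congr (_%:R); rewrite subnBA// ltnW.
  have := ler_wpM2r uv bL; set u := D1 / _; set v := D2 / _ => h.
  have -> : alpha = K%:R * T - beta by rewrite -ab addrK.
  have -> : (v * (M - L)%:R + (K%:R - (M - L)%:R) * u) * T =
    K%:R * T * u + (M - L)%:R * T * (v - u) by ring.
  have -> : (K%:R * T - beta) * u + beta * v = K%:R * T * u + beta * (v - u) by ring.
  by rewrite lerD2l.
rewrite -[K%:R * D2 / _]mulrA; have := mulr_ge0 alpha0 uv; set u := D1 / _; set v := D2 / _ => h.
have -> : K%:R * v * T = (alpha + beta) * v by rewrite ab; ring.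
rewrite mulrDl lerD2r -subr_ge0.
by have -> : alpha * v - alpha * u = alpha * (v - u) by ring.
Qed.

Definition alive {Omega : Type} {M : nat} (G : policy Omega M) (t : nat) (w : Omega) : bool :=
  if stop G w is Some m then (t < m)%N else true.

Unset Implicit Arguments.
Section LowerBound.
Context (R : realType) (M K L : nat) (dY : measure_display) (Y : measurableType dY)
  (mu : {measure set Y -> \bar R}) (f g : Y -> R)
  (dO : measure_display) (Omega : measurableType dO)
  (dV : measure_display) (V : measurableType dV)
  (P : {set 'I_M} -> probability Omega R) (U : Omega -> V)
  (y : nat -> 'I_M -> Omega -> Y).
Hypotheses (L0 : (0 < L)%N) (LM : (L < M)%N).
Hypotheses (df : is_density mu f) (dg : is_density mu g).
Hypotheses (kgf : (0 < KL mu g f < +oo)%E) (kfg : (0 < KL mu f g < +oo)%E).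
Hypothesis mgf : exists2 eps : R, 0 < eps & forall s : R, `|s| < eps ->
     (\int[mu]_x (f x * expR (s * llr f g x))%:E < +oo)%E /\
     (\int[mu]_x (g x * expR (s * llr f g x))%:E < +oo)%E.
Hypothesis model : search_model L mu f g P U y.
Variable G : policy Omega M.
Hypothesis admG : admissible K L U y G.

Local Notation F_ n := (hist_sigma U y G n).
Local Notation D1 := (fine (KL mu g f)).
Local Notation D2 := (fine (KL mu f g)).

Let mU : measurable_fun setT U. Proof. by case: model. Qed.
Let my n k : measurable_fun setT (y n k).
Proof. exact: (observation_measurable model). Qed.
Let adaptG n (S : {set 'I_M}) : F_ n [set w | sel G n w = S].
Proof. by case: admG. Qed.
Let mF n A : F_ n A -> measurable A.
Proof. exact: (hist_sigma_measurable mU my adaptG). Qed.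
Let ml : measurable_fun setT (llr f g).
Proof. by case: df dg => mf [f0 _] [mg [g0 _]]; exact: measurable_llr. Qed.

Lemma hist_stop n : F_ n [set w | stop G w = Some n].
Proof. by case: admG. Qed.

Lemma hist_not_alive n : F_ n [set w | exists2 m, (m <= n)%N & stop G w = Some m].
Proof.
have -> : [set w | exists2 m, (m <= n)%N & stop G w = Some m] =
    \bigcup_(m in [set: 'I_n.+1]) [set w | stop G w = Some (nat_of_ord m)].
  apply/seteqP; split => w /= [m mn sm]; last by exists m => //; rewrite -ltnS.
  by exists (Ordinal (mn : (m < n.+1)%N)).
apply: hist_fin_bigcup => m _; apply: (hist_sigma_le _ _ (hist_stop m)).
by rewrite -ltnS.
Qed.

Lemma aliveE n : [set w | alive G n w] =
  ~` [set w | exists2 m, (m <= n)%N & stop G w = Some m].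
Proof.
apply/seteqP; split => w /=; rewrite /alive.
  by case: (stop G w) => [m nm [m' mn [e]]|_ [m' _]//]; rewrite e ltnNge mn in nm.
move=> h; case e : (stop G w) => [m|//]; rewrite ltnNge; apply/negP => mn.
by apply: h; exists m.
Qed.

Lemma hist_alive n : F_ n [set w | alive G n w].
Proof. by rewrite aliveE; apply: histC; exact: hist_not_alive. Qed.

Definition live_visit t k : set Omega := [set w | alive G t w && (k \in sel G t w)].

Lemma hist_live_visit t k : F_ t (live_visit t k).
Proof.
rewrite (_ : live_visit t k = [set w | alive G t w] `&` [set w | k \in sel G t w]).
  exact: histI (hist_alive t) (hist_sel adaptG t (fun S => k \in S)).
apply/seteqP; split => w; first by move=> /andP[].
by move=> [? ?]; apply/andP.
Qed.

Section FixedHypothesis.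
Variable A : {set 'I_M}.
Hypothesis AL : #|A| = L.

Let one (k : 'I_M) (x : Y) : R := 1.
Let W1 n w : weight y G one n w = 1.
Proof. by rewrite /weight big1// => t _; rewrite big1// => k _; case: ifP. Qed.

(** This is [weight_indep] with weight 1. For [E] a live visit of [k] at time [t] it is one term of
    Wald's identity. *)
Lemma integral_hist_observation (h : Y -> R) (m : bool -> R) t k E :
  measurable_fun setT h -> (forall x, 0 <= h x) ->
  (forall b, \int[mu]_x (density_of f g b x * h x)%:E = (m b)%:E)%E ->
  F_ t E ->
  (\int[P A]_w (\1_E w * h (y t k w))%:E = (fine (P A E) * m (k \in A))%:E)%E.
Proof.
move=> mh h0 hm hE; rewrite integral_indic_setT.
have indA : indep_model (P A) U y by case: model => _ _ ind _ _; exact: ind.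
have mone k' : measurable_fun setT (one k') by exact: measurable_cst.
have one0 k' x : 0 <= one k' x by [].
have onefin n k' : (\int[P A]_w (one k' (y n k' w))%:E < +oo)%E.
  by rewrite integral_cst_probability ltry.
have [_ H] := weight_indep _ _ _ _ _ _ _ _ _ _ mU my _ indA G one adaptG mone one0 onefin t.
have fac : factors R dO dY Omega Y M y (P A) (fun=> h) (fun i => m (i.2 \in A)).
  by split => // i'; rewrite (observation_integral df dg model _ _ _ h).
have ts (i' : nat * 'I_M) : i' \in [:: (t, k)] -> (t <= i'.1)%N.
  by rewrite inE => /eqP ->.
transitivity (\int[P A]_(w in E) cst 1 w * (\prod_(i <- [:: (t, k)]) m (i.2 \in A))%:E)%E.
  rewrite (_ : (\int[P A]_(w in E) cst 1 w)%E = (\int[P A]_(w in E) (weight y G one t w)%:E)%E).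
    rewrite -(H E hE _ _ [:: (t, k)] fac isT ts).
    apply: eq_integral => w _; congr EFin.
    by rewrite big_seq1 [X in _ = X * _](_ : _ = 1) ?mul1r//; exact: W1.
  by apply: eq_integral => w _; rewrite [X in _ = X%:E](_ : _ = 1)//; exact: W1.
rewrite integral_cst ?mul1e ?big_seq1; last exact: mF hE.
by rewrite EFinM fineK// fin_num_measure//; exact: mF hE.
Qed.

Variables (i j : 'I_M).
Hypotheses (iA : i \in A) (jA : j \notin A).
Variable n : nat.

(** An arbitrary admissible policy may have an infinite mean stopping time or never stop. Truncation
    makes [Z] a sum of at most [n] rounds, with finite means. *)
Let tau w := if stop G w is Some m then minn m n else n.
Let Z w := Ssum f g y G (tau w) w i - Ssum f g y G (tau w) w j.

Let aliveP t w : (t < n)%N -> alive G t w = (t < tau w)%N.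
Proof. by rewrite /alive /tau => tn; case: (stop G w) => [m|//]; rewrite leq_min tn andbT. Qed.

Let tau_le w : (tau w < n.+1)%N.
Proof. by rewrite /tau ltnS; case: (stop G w) => // m; exact: geq_minr. Qed.

Let hist_tau m : (m <= n)%N -> F_ m [set w | tau w = m].
Proof.
rewrite leq_eqVlt => /predU1P[->|mn].
  have -> : [set w | tau w = n] = ~` \bigcup_(m' in [set: 'I_n])
      [set w | stop G w = Some (nat_of_ord m')].
    apply/seteqP; split => w /=; rewrite /tau.
      move=> h [m' _ /= e]; move: h; rewrite e (minn_idPl (ltnW (ltn_ord m'))) => e'.
      by have := ltn_ord m'; rewrite e' ltnn.
    case e : (stop G w) => [m'|//] h; apply/minn_idPr; rewrite leqNgt; apply/negP => mn.
    by apply: h; exists (Ordinal mn).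
  apply: histC; apply: hist_fin_bigcup => m' _.
  exact: (hist_sigma_le (ltnW (ltn_ord m')) _ (hist_stop m')).
have -> : [set w | tau w = m] = [set w | stop G w = Some m].
  apply/seteqP; split => w /=; rewrite /tau.
    case: (stop G w) => [m'|e]; last by rewrite e ltnn in mn.
    case: leqP => _ e; first by rewrite e.
    by rewrite e ltnn in mn.
  by move=> ->; rewrite (minn_idPl (ltnW mn)).
exact: hist_stop.
Qed.

(** The random number of terms becomes the fixed [n], with indicators of events in [F_ t], so that
    each term can be integrated by independence. *)
Let SumD (k : 'I_M) (F : nat -> Omega -> R) w :
  \sum_(t < tau w) (if k \in sel G t w then F t w else 0) =
  \sum_(t < n) \1_(live_visit t k) w * F t w.
Proof.
rewrite (big_ord_widen_cond n predT (fun t => if k \in sel G t w then F t w else 0)); last first.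
  by rewrite -ltnS.
rewrite big_mkcond/=; apply: eq_bigr => t _; rewrite indicE -(aliveP t w (ltn_ord t)).
have [lv|lv] := boolP (w \in live_visit t k).
  by move: lv; rewrite inE /live_visit/= => /andP[-> ->]; rewrite mul1r.
move: lv; rewrite notin_setE /live_visit/= mul0r; case: (alive G t w) => //=.
by case: ifP.
Qed.

Let Zpos w := \sum_(t < n) (\1_(live_visit t i) w * Num.max (llr f g (y t i w)) 0 +
   \1_(live_visit t j) w * Num.max (- llr f g (y t j w)) 0).
Let Zneg w := \sum_(t < n) (\1_(live_visit t i) w * Num.max (- llr f g (y t i w)) 0 +
   \1_(live_visit t j) w * Num.max (llr f g (y t j w)) 0).

Let ZE w : Z w = Zpos w - Zneg w.
Proof.
rewrite /Z /Ssum !(SumD _ (fun t w => llr f g (y t _ w))) -!sumrB.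
apply: eq_bigr => t _.
rewrite -{1}(max0B (llr f g (y t i w))) -{1}(max0B (llr f g (y t j w))); ring.
Qed.

Let m_llr t k : measurable_fun setT (fun w => llr f g (y t k w)).
Proof. exact: measurableT_comp. Qed.

Let max_ge0 (u : R) : 0 <= Num.max u 0.
Proof. by rewrite le_max lexx orbT. Qed.

Let m_max (F : Omega -> R) : measurable_fun setT F ->
  measurable_fun setT (fun w => Num.max (F w) 0).
Proof. by move=> ?; exact: measurable_maxr. Qed.

Let m_lv t k (F : Omega -> R) : measurable_fun setT F ->
  measurable_fun setT (fun w => \1_(live_visit t k) w * F w : R).
Proof.
move=> mF'; apply: measurable_funM => //.
by apply: measurable_indic; exact: mF (hist_live_visit t k).
Qed.

Let nv k := \sum_(t < n) fine (P A (live_visit t k)).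

(** Wald's identity, stated once for [Zpos] and [Zneg]: [F1] and [F2] are the identity and the
    opposite, in one order or the other. *)
Let integral_Z (F1 F2 : R -> R) (m1 m2 : bool -> R) :
  (forall b, \int[mu]_x (density_of f g b x * Num.max (F1 (llr f g x)) 0)%:E = (m1 b)%:E)%E ->
  (forall b, \int[mu]_x (density_of f g b x * Num.max (F2 (llr f g x)) 0)%:E = (m2 b)%:E)%E ->
  measurable_fun setT F1 -> measurable_fun setT F2 ->
  (\int[P A]_w (\sum_(t < n) (\1_(live_visit t i) w * Num.max (F1 (llr f g (y t i w))) 0 +
   \1_(live_visit t j) w * Num.max (F2 (llr f g (y t j w))) 0))%:E =
   (nv i * m1 true + nv j * m2 false)%:E)%E.
Proof.
move=> h1 h2 mF1 mF2; under eq_integral do rewrite -sumEFin.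
have mm t k (F : R -> R) : measurable_fun setT F -> measurable_fun setT
    (fun w => \1_(live_visit t k) w * Num.max (F (llr f g (y t k w))) 0 : R).
  by move=> mF'; apply: m_lv; apply: m_max; exact: measurableT_comp.
have ge0 t k (F : R -> R) w :
    0 <= (\1_(live_visit t k) w * Num.max (F (llr f g (y t k w))) 0 : R).
  by rewrite mulr_ge0.
rewrite ge0_integral_sum//; last 2 first.
- by move=> t; apply/measurable_EFinP/measurable_funD; exact: mm.
- by move=> t w _; rewrite lee_fin addr_ge0.
rewrite /nv !mulr_suml -big_split/= -sumEFin; apply: eq_bigr => t _.
rewrite integral_addr//; try exact: mm.
rewrite (integral_hist_observation (fun x => Num.max (F1 (llr f g x)) 0) m1)//; last 2 first.
- by apply: measurable_maxr => //; exact: measurableT_comp.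
- exact: hist_live_visit.
rewrite (integral_hist_observation (fun x => Num.max (F2 (llr f g x)) 0) m2)//; last 2 first.
- by apply: measurable_maxr => //; exact: measurableT_comp.
- exact: hist_live_visit.
by rewrite iA (negbTE jA) -EFinD.
Qed.

Let mZ : measurable_fun setT Z.
Proof.
have -> : Z = fun w => Zpos w - Zneg w by apply/funext => w; exact: ZE.
by apply: measurable_funB; apply: measurable_sum => t; apply: measurable_funD;
  apply: m_lv; apply: m_max => //; exact: measurableT_comp.
Qed.

Let mexpZ : measurable_fun setT (fun w => expR (- Z w)).
Proof. by apply: measurableT_comp => //; exact: measurableT_comp. Qed.

Local Notation A' := (j |: A :\ i).

Let integral_expZ_piece m E : (m <= n)%N -> F_ m E -> E `<=` [set w | tau w = m] ->
  (\int[P A]_(w in E) (expR (- Z w))%:E = P A' E)%E.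
Proof.
move=> mn hE Em.
rewrite -(swap_change_of_measure df dg kgf kfg model i j adaptG AL iA jA m E hE).
by apply: eq_integral => w; rewrite inE => /Em /= e; rewrite /Z e.
Qed.

(** Optional stopping for the likelihood ratio: on each of the finitely many events [tau = m] the
    change of measure at time [m] applies, and the [P A'] masses add up to 1. *)
Let integral_expZ : (\int[P A]_w (expR (- Z w))%:E = 1)%E.
Proof.
have mtau (m : 'I_n.+1) : measurable [set w | tau w = m].
  by apply: mF; apply: hist_tau; rewrite -ltnS.
have UT : \big[setU/set0]_(m <- enum 'I_n.+1) [set w | tau w = nat_of_ord m] = setT.
  rewrite -bigcup_seq -subTset => w _; exists (Ordinal (tau_le w)) => //=.
  by rewrite mem_enum.
have tI : trivIset [set` enum 'I_n.+1] (fun m : 'I_n.+1 => [set w | tau w = m]).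
  apply/trivIsetP => m m' _ _ mm'; apply/seteqP; split => w //= [e e'].
  by move/eqP: mm'; apply; apply/val_inj; rewrite /= -e -e'.
rewrite -UT ge0_integral_bigsetU//.
all: try exact: enum_uniq.
all: try by apply/measurable_EFinP; apply: measurable_funS mexpZ.
all: try by move=> w _; rewrite lee_fin expR_ge0.
rewrite (eq_bigr (fun m : 'I_n.+1 => P A' [set w | tau w = m])) => [|m _]; last first.
  have mn : (m <= n)%N by rewrite -ltnS.
  by apply: integral_expZ_piece; [exact: mn|exact: hist_tau|by []].
transitivity (P A' setT); last exact: probability_setT.
rewrite -(UT) [LHS](eq_bigr (fun m : 'I_n.+1 =>
  \int[P A']_(w in [set w | tau w = m]) 1%:E)%E) => [|m _]; last first.
  by rewrite integral_cst// mul1e.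
rewrite -ge0_integral_bigsetU//; last exact: enum_uniq.
by rewrite integral_cst ?mul1e// UT.
Qed.

Definition correct_by : set Omega := [set w | exists2 m, (m < n)%N &
  stop G w = Some m /\ dec G w = A].

Let correct_piece (m : 'I_n) := [set w | stop G w = Some (nat_of_ord m) /\ dec G w = A].

Let correct_byE : correct_by = \big[setU/set0]_(m <- enum 'I_n) correct_piece m.
Proof.
rewrite -bigcup_seq; apply/seteqP; split => w.
  by move=> [m mn h]; exists (Ordinal mn); rewrite //= mem_enum.
by move=> [m _ h]; exists (nat_of_ord m).
Qed.

Let hist_correct (m : 'I_n) : F_ m (correct_piece m).
Proof. by case: admG => _ _ _ _ h; exact: h. Qed.

Lemma correct_by_measurable : measurable correct_by.
Proof.
by rewrite correct_byE; apply: bigsetU_measurable => m _; exact: mF (hist_correct m).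
Qed.

Let correct_trivI : trivIset [set` enum 'I_n] correct_piece.
Proof.
apply/trivIsetP => m m' _ _ mm'; apply/seteqP; split => w //= [[e _] [e' _]].
by move/eqP: mm'; apply; apply/val_inj; move: e; rewrite e' => -[].
Qed.

Let integral_expZ_correct :
  (\int[P A]_(w in correct_by) (expR (- Z w))%:E = P A' correct_by)%E.
Proof.
have mc (m : 'I_n) : measurable (correct_piece m) by exact: mF (hist_correct m).
rewrite correct_byE ge0_integral_bigsetU//.
all: try exact: enum_uniq.
all: try by apply/measurable_EFinP; apply: measurable_funS mexpZ.
all: try by move=> w _; rewrite lee_fin expR_ge0.
rewrite (eq_bigr (fun m : 'I_n => P A' (correct_piece m))) => [|m _]; last first.
  apply: (integral_expZ_piece m); [exact/ltnW/ltn_ord|exact: hist_correct|].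
  by move=> w [/= e _]; rewrite /tau e (minn_idPl (ltnW (ltn_ord m))).
rewrite [LHS](eq_bigr (fun m : 'I_n => \int[P A']_(w in correct_piece m) 1%:E)%E) => [|m _].
  rewrite -ge0_integral_bigsetU//; last exact: enum_uniq.
  rewrite integral_cst ?mul1e//; exact: bigsetU_measurable.
by rewrite integral_cst// mul1e.
Qed.

(* With [a = - ln p], the tangent-line bounds [exp (a - Z) >= 1 + a - Z] on the
   event of a correct decision and [exp (- Z) >= 1 - Z] off it are integrated. *)
Lemma information_bound p : 0 < p <= 1 -> fine (P A' correct_by) <= p ->
  - ln p * fine (P A correct_by) - 1 <= nv i * D1 + nv j * D2.
Proof.
move=> /andP[p0 p1] hp.
have [mp [mn [mpn0 hmp hmn e1 e2]]] := density_moments df dg kgf kfg mgf.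
have a0 : 0 <= - ln p by rewrite oppr_ge0 ln_le0.
have mC := correct_by_measurable.
have fC B : P B correct_by \is a fin_num by rewrite fin_num_measure.
have mopp : measurable_fun setT (-%R : R -> R) by exact: oppr_measurable.
have mid : measurable_fun setT (idfun : R -> R) by exact: measurable_id.
have IP := integral_Z idfun (-%R) mp mn hmp hmn mid mopp.
have IN := integral_Z (-%R) idfun mn mp hmn hmp mopp mid.
have mZp : measurable_fun setT Zpos.
  by apply: measurable_sum => t; apply: measurable_funD;
    apply: m_lv; apply: m_max => //; exact: measurableT_comp.
have mZn : measurable_fun setT Zneg.
  by apply: measurable_sum => t; apply: measurable_funD;
    apply: m_lv; apply: m_max => //; exact: measurableT_comp.
have Zp0 w : 0 <= Zpos w by apply: sumr_ge0 => t _; rewrite addr_ge0// mulr_ge0.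
have Zn0 w : 0 <= Zneg w by apply: sumr_ge0 => t _; rewrite addr_ge0// mulr_ge0.
have e0 w : 0 <= expR (- Z w) by exact: expR_ge0.
have mI : measurable_fun setT (\1_correct_by : Omega -> R) by exact: measurable_indic.
have i0 w : (0 : R) <= \1_correct_by w by [].
have mIe : measurable_fun setT (fun w => \1_correct_by w * expR (- Z w)).
  exact: measurable_funM.
have Ie0 w : 0 <= \1_correct_by w * expR (- Z w) by rewrite mulr_ge0.
have mpIe : measurable_fun setT (fun w => p^-1 * (\1_correct_by w * expR (- Z w))).
  exact: measurable_funM.
have p'0 : 0 <= p^-1 by rewrite invr_ge0 ltW.
have pIe0 w : 0 <= p^-1 * (\1_correct_by w * expR (- Z w)) by rewrite mulr_ge0.
have maI : measurable_fun setT (fun w => - ln p * \1_correct_by w).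
  exact: measurable_funM.
have aI0 w : 0 <= - ln p * \1_correct_by w by rewrite mulr_ge0.
(* Both exponentials are kept on the right everywhere, so one inequality covers both cases. Their
   integrals are at most 1 and equal to 1, against a single 1 on the left, whence the [- 1] of the
   statement. *)
have le : (\int[P A]_w (Zneg w + - ln p * \1_correct_by w + 1)%:E <=
    \int[P A]_w (Zpos w + p^-1 * (\1_correct_by w * expR (- Z w)) + expR (- Z w))%:E)%E.
  apply: integral_ler.
  - by apply: measurable_funD => //; exact: measurable_funD.
  - by apply: measurable_funD => //; exact: measurable_funD.
  - by move=> w; rewrite !addr_ge0.
  - move=> w; have := ZE w; have h1 := expR_ge1Dx (- Z w).
    have h2 := expR_ge1Dx (- ln p - Z w).
    have eZ : expR (- ln p - Z w) = p^-1 * expR (- Z w).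
      by rewrite expRD expRN lnK ?posrE.
    rewrite eZ in h2; have h3 := e0 w.
    have h4 : 0 <= p^-1 * expR (- Z w) by rewrite mulr_ge0.
    rewrite indicE; case: (_ \in _); rewrite /= ?mul1r ?mul0r ?mulr1 ?mulr0; lra.
have mS1 : measurable_fun setT (fun w => Zneg w + - ln p * \1_correct_by w).
  exact: measurable_funD.
have S10 w : 0 <= Zneg w + - ln p * \1_correct_by w by rewrite addr_ge0.
have mS2 : measurable_fun setT (fun w => Zpos w + p^-1 * (\1_correct_by w * expR (- Z w))).
  exact: measurable_funD.
have S20 w : 0 <= Zpos w + p^-1 * (\1_correct_by w * expR (- Z w)) by rewrite addr_ge0.
have [q eq] : exists q, P A correct_by = q%:E.
  by exists (fine (P A correct_by)); rewrite fineK.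
have [q' eq'] : exists q', P A' correct_by = q'%:E.
  by exists (fine (P A' correct_by)); rewrite fineK.
have eI : (\int[P A]_w (\1_correct_by w)%:E = q%:E)%E.
  by rewrite integral_indic// setIT; exact: eq.
move: le hp; rewrite integral_addr// integral_addr// [X in (_ <= X)%E]integral_addr//.
rewrite [X in (_ <= X + _)%E]integral_addr// IP IN integral_expZ integral_cst_probability.
rewrite integral_scaler// integral_scaler// integral_indic_setT integral_expZ_correct.
rewrite eI eq eq' => le0 hp.
have {le0}le : nv i * mn true + nv j * mp false + (- ln p) * q + 1 <=
  nv i * mp true + nv j * mn false + p^-1 * q' + 1.
  exact: le0.
have : p^-1 * q' <= 1 by rewrite ler_pdivrMl// mulr1.
rewrite -e1 -e2 /=; move: le; set x := p^-1 * q' => le hx; lra.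
Qed.

End FixedHypothesis.
Lemma alive_measurable t : measurable [set w | alive G t w].
Proof. exact: mF (hist_alive t). Qed.

Lemma tau_eE w :
  tau_e G w = (\sum_(0 <= t <oo) (\1_[set w | alive G t w] w : R)%:E)%E.
Proof.
have ind t : (\1_[set w | alive G t w] w : R) = (alive G t w)%:R.
  rewrite indicE; congr (_%:R); congr nat_of_bool.
  by apply/idP/idP; rewrite inE.
under eq_eseriesr do rewrite ind.
rewrite /tau_e /alive; case: (stop G w) => [m|].
  rewrite (nneseries_split 0 m); last by move=> k _; rewrite lee_fin.
  rewrite eseries0 ?adde0; last by move=> k; rewrite add0n => mk _; rewrite ltnNge mk.
  rewrite add0n sumEFin; congr EFin.
  rewrite (@eq_big_nat _ _ _ _ _ _ (fun=> 1)) => [|k /andP[_ ->]//].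
  by rewrite sumr_const_nat subn0.
apply/esym/eq_infty => r.
apply: (@le_trans _ _ (Num.truncn `|r|).+1%:R%:E).
  by rewrite lee_fin (le_trans (ler_norm r))// ltW// truncnS_gt.
apply: le_trans (@nneseries_lim_ge R (fun=> 1%:E) predT 0 (Num.truncn `|r|).+1 _).
  by rewrite sumEFin sumr_const_nat subn0.
by move=> k _ _; rewrite lee_fin.
Qed.

Lemma integral_tau_e A : (\int[P A]_w tau_e G w =
  \sum_(0 <= t <oo) P A [set w | alive G t w])%E.
Proof.
under eq_integral do rewrite tau_eE.
rewrite integral_nneseries//.
all: try by move=> t w _; rewrite lee_fin.
all: try by move=> t; apply/measurable_EFinP/measurable_indic; exact: alive_measurable.
apply: eq_eseriesr => t _; rewrite integral_indic ?setIT//.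
exact: alive_measurable.
Qed.

Lemma expected_time_lower_n (A : {set 'I_M}) n p : #|A| = L -> (K <= M)%N ->
  0 < p <= 1 ->
  (forall i j, i \in A -> j \notin A -> fine (P (j |: A :\ i) (correct_by A n)) <= p) ->
  - ln p * fine (P A (correct_by A n)) - 1 <=
    I_star M K L D1 D2 * \sum_(t < n) fine (P A [set w | alive G t w]).
Proof.
move=> AL KM p01 hp.
pose nv k := \sum_(t < n) fine (P A (live_visit t k)).
pose T := \sum_(t < n) fine (P A [set w | alive G t w]).
set x := _ - 1.
have info i j : i \in A -> j \notin A -> x <= nv i * D1 + nv j * D2.
  by move=> iA jA; apply: information_bound => //; exact: hp.
have D10 : 0 <= D1 by apply: fine_ge0; apply: ltW; case/andP: kgf.
have D20 : 0 <= D2 by apply: fine_ge0; apply: ltW; case/andP: kfg.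
have mlv t k : measurable (live_visit t k) by exact: mF (hist_live_visit t k).
have mal := alive_measurable.
have nvT k : nv k <= T.
  apply: ler_sum => t _; apply: fine_le; rewrite ?fin_num_measure//.
  apply: le_measure; rewrite ?inE//.
  by move=> w /= /andP[].
have nv0 k : 0 <= nv k by apply: sumr_ge0 => t _; exact: fine_ge0.
have sumT : \sum_k nv k = K%:R * T.
  rewrite exchange_big mulr_sumr; apply: eq_bigr => t _ /=.
  apply: EFin_inj; rewrite -sumEFin EFinM fineK ?fin_num_measure//.
  under eq_bigr do rewrite fineK ?fin_num_measure//.
  transitivity (\int[P A]_w (K%:R * \1_[set w | alive G t w] w)%:E)%E; last first.
    rewrite integral_scaler//.
    all: try by apply: measurable_indic; exact: mal.
    by rewrite integral_indic ?setIT//; exact: mal.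
  transitivity (\int[P A]_w (\sum_k (\1_(live_visit t k) w : R)%:E))%E.
    rewrite ge0_integral_sum//.
    all: try by move=> k; apply/measurable_EFinP/measurable_indic.
    all: try by move=> k w _; rewrite lee_fin.
    by apply: eq_bigr => k _; rewrite integral_indic ?setIT.
  apply: eq_integral => w _; rewrite sumEFin; congr EFin.
  rewrite indicE; have [wa|wa] := boolP (w \in [set w | alive G t w]).
    rewrite mulr1; have <- : #|sel G t w| = K by case: admG.
    rewrite -sum1_card natr_sum [RHS]big_mkcond; apply: eq_bigr => k _.
    rewrite inE/= in wa; rewrite indicE; case: (boolP (k \in sel G t w)) => ks.
      by rewrite mem_set// /live_visit/= wa ks.
    by rewrite memNset// /live_visit/= (negbTE ks) andbF.
  rewrite mulr0 big1// => k _; rewrite indicE memNset// /live_visit/=.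
  by rewrite notin_setE/= in wa; move/negP/negbTE: wa => ->.
pose alpha := \sum_(k in A) nv k; pose beta := \sum_(k in ~: A) nv k.
have ab : alpha + beta = K%:R * T.
  rewrite -sumT [RHS](bigID (mem A))/=; congr (_ + _).
  by apply: eq_bigl => k; rewrite inE.
have cAC : #|~: A| = (M - L)%N by rewrite cardsCs finset.setCK card_ord AL.
have aL : alpha <= L%:R * T.
  by rewrite -AL mulr_natl -sumr_const; apply: ler_sum => k _.
have bL : beta <= (M - L)%:R * T.
  by rewrite -cAC mulr_natl -sumr_const; apply: ler_sum => k _.
have a0 : 0 <= alpha by apply: sumr_ge0.
have b0 : 0 <= beta by apply: sumr_ge0.
have L0' : (0 : R) < L%:R by rewrite ltr0n.
have ML0' : (0 : R) < (M - L)%:R by rewrite ltr0n subn_gt0.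
apply: le_trans (rate_upper L0 LM D10 D20 a0 b0 ab aL bL).
have h1 j : j \notin A -> L%:R * x <= alpha * D1 + L%:R * (nv j * D2).
  move=> jA; rewrite -AL !mulr_natl -!sumr_const mulr_suml -big_split/=.
  by apply: ler_sum => i iA; exact: info.
have h2 : (M - L)%:R * (L%:R * x) <= (M - L)%:R * (alpha * D1) + L%:R * (beta * D2).
  have -> : (M - L)%:R * (L%:R * x) = \sum_(j in ~: A) (L%:R * x).
    by rewrite sumr_const cAC mulr_natl.
  have -> : (M - L)%:R * (alpha * D1) + L%:R * (beta * D2) =
      \sum_(j in ~: A) (alpha * D1 + L%:R * (nv j * D2)).
    by rewrite big_split/= sumr_const cAC mulr_natl -mulr_sumr -mulr_suml.
  by apply: ler_sum => j; rewrite inE => jA; exact: h1.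
rewrite -(ler_pM2l L0') -(ler_pM2l ML0').
apply: le_trans h2 _.
have e1 : L%:R * (D1 / L%:R) = D1 by rewrite mulrC divfK// gt_eqF.
have e2 : (M - L)%:R * (D2 / (M - L)%:R) = D2 by rewrite mulrC divfK// gt_eqF.
move: e1 e2; set u := D1 / _; set v := D2 / _ => <- <-.
by rewrite le_eqVlt; apply/orP; left; apply/eqP; ring.
Qed.

(** Deciding [A] is an error under every swapped hypothesis, so [hp] supplies the premise of the
    truncated bound. As [n] grows, [correct_by A n] increases to the complement of the error event,
    which has probability at least [1 - p]. *)
Lemma expected_time_lower (A : {set 'I_M}) p : #|A| = L -> (K <= M)%N -> 0 < p <= 1 ->
  (forall B : {set 'I_M}, #|B| = L -> (err_prob (P B) B G <= p%:E)%E) ->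
  0 <= I_star M K L D1 D2 ->
  ((- ln p * (1 - p) - 1)%:E <=
    (I_star M K L D1 D2)%:E * \int[P A]_w tau_e G w)%E.
Proof.
move=> AL KM p01 hp I0.
have a0 : 0 <= - ln p by rewrite oppr_ge0 ln_le0//; case/andP: p01.
have mC n : measurable (correct_by A n) by exact: correct_by_measurable.
pose C := \bigcup_n correct_by A n.
have mCC : measurable C by apply: bigcupT_measurable.
have CE : ~` C = [set w | stop G w = None \/ dec G w != A].
  apply/seteqP; split => w.
    move=> nC; case e : (stop G w) => [m|]; last by left.
    right; apply/eqP => dA; apply: nC; exists m.+1 => //.
    by exists m.
  by move=> [e|/eqP e] [n _ [m _ [e1 e2]]]; [rewrite e1 in e|].
have step n : ((- ln p)%:E * P A (correct_by A n) <=
    (I_star M K L D1 D2)%:E * \int[P A]_w tau_e G w + 1)%E.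
  have h := expected_time_lower_n A n p AL KM p01 _.
  have {}h : - ln p * fine (P A (correct_by A n)) - 1 <=
     I_star M K L D1 D2 * \sum_(t < n) fine (P A [set w | alive G t w]).
    apply: h => i j iA jA; rewrite -lee_fin fineK ?fin_num_measure//.
    have A'L := swap_card i j AL iA jA.
    apply: le_trans (hp _ A'L); rewrite /err_prob; apply: le_measure; rewrite ?inE//.
      have -> : [set w | stop G w = None \/ dec G w != j |: A :\ i] =
          ~` \bigcup_n correct_by (j |: A :\ i) n.
        apply/seteqP; split => w.
          by move=> [e|/eqP e] [n' _ [m _ [e1 e2]]]; [rewrite e1 in e|].
        move=> nC; case e : (stop G w) => [m|]; last by left.
        right; apply/eqP => dA; apply: nC; exists m.+1 => //.
        by exists m.
      by apply/measurableC/bigcupT_measurable => n'; exact: correct_by_measurable.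
    by move=> w [m _ [_ dA]]; right; rewrite dA; apply/eqP => e; move: jA; rewrite e !inE eqxx.
  have -> : P A (correct_by A n) = (fine (P A (correct_by A n)))%:E.
    by rewrite fineK// fin_num_measure.
  rewrite -EFinM -leeBlDr// -EFinB; apply: le_trans (_ : _ <= (I_star M K L D1 D2 *
     \sum_(t < n) fine (P A [set w | alive G t w]))%:E)%E _; first by rewrite lee_fin.
  rewrite EFinM; apply: lee_wpmul2l; first by rewrite lee_fin.
  rewrite integral_tau_e -sumEFin.
  apply: le_trans (@nneseries_lim_ge R (fun t => P A [set w | alive G t w]) predT 0 n _) => //.
  rewrite big_mkord; rewrite le_eqVlt; apply/orP; left; apply/eqP.
  apply: eq_bigr => t _; rewrite fineK// fin_num_measure//.
  exact: alive_measurable.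
have lim : ((- ln p)%:E * P A (correct_by A n))%E @[n --> \oo] --> ((- ln p)%:E * P A C)%E.
  apply: cvgeZl => //; apply: nondecreasing_cvg_mu => //.
  move=> n m nm; apply/subsetPset => w [k kn h]; exists k => //.
  exact: leq_trans nm.
have PC : ((1 - p)%:E <= P A C)%E.
  have := hp A AL; rewrite /err_prob -CE probability_setC// => h.
  have -> : P A C = (fine (P A C))%:E by rewrite fineK// fin_num_measure.
  move: h; have -> : P A C = (fine (P A C))%:E by rewrite fineK// fin_num_measure.
  by rewrite -EFinB !lee_fin /=; lra.
have key : ((- ln p)%:E * P A C <= (I_star M K L D1 D2)%:E * \int[P A]_w tau_e G w + 1)%E.
  rewrite -(cvg_lim _ lim)//; apply: lime_le; first by apply/cvg_ex; eexists; exact: lim.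
  by apply: nearW.
rewrite EFinB leeBlDr//; apply: le_trans key.
by rewrite EFinM; apply: lee_wpmul2l; rewrite ?lee_fin.
Qed.

End LowerBound.
Set Implicit Arguments.

Arguments alive_measurable {R M K L dY Y mu f g dO Omega dV V P U y} model {G} admG t.
Arguments integral_tau_e {R M K L dY Y mu f g dO Omega dV V P U y} model {G} admG A.
Arguments hist_alive {M K L dY Y dO Omega dV V U y G} admG n.

(** * Upper bound *)

Section Ranking.
Context (R : realType) (M : nat) (S : 'I_M -> R) (sigma : {perm 'I_M}).
Hypothesis rk : is_ranking S sigma.

Lemma mem_rank (p : pred 'I_M) i : (sigma i \in [set sigma j | j : 'I_M & p j]) = p i.
Proof. by rewrite (mem_imset _ _ (@perm_inj _ sigma)) inE. Qed.

Lemma rank_antimono (i j : 'I_M) : (i <= j)%N -> S (sigma j) <= S (sigma i).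
Proof. exact: rk. Qed.

(** A sorted list of values is unique, so reading the sums along any ranking, however it breaks
    ties, gives the list inside [DeltaL]. *)
Lemma DeltaL_rankingE (L : nat) (i j : 'I_M) : nat_of_ord i = L.-1 -> nat_of_ord j = L ->
  DeltaL L S = S (sigma i) - S (sigma j).
Proof.
move=> iL jL; pose leT := fun a b : R => b <= a.
have tot : total leT by move=> a b; rewrite /leT; exact: le_total.
have tr : transitive leT by move=> b a c h1 h2; exact: le_trans h2 h1.
have asym : antisymmetric leT by move=> a b h; apply/le_anti; rewrite andbC.
have e : sort leT [seq S k | k <- enum 'I_M] = [seq S (sigma k) | k <- enum 'I_M].
  have srt : sorted leT [seq S (sigma k) | k <- enum 'I_M].
    rewrite sorted_map; apply: (@sub_sorted _ (fun a b : 'I_M => (a < b)%N)).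
      by move=> a b ab; apply: rank_antimono; exact: ltnW.
    have : sorted ltn (map val (enum 'I_M)) by rewrite val_enum_ord iota_ltn_sorted.
    by rewrite sorted_map.
  rewrite -[RHS](sorted_sort tr srt); apply/(perm_sortP tot tr asym).
  rewrite (map_comp S sigma) perm_map//.
  apply: uniq_perm; rewrite ?enum_uniq ?(map_inj_uniq (@perm_inj _ sigma)) ?enum_uniq//.
  move=> k; rewrite mem_enum inE; apply/esym/mapP.
  by exists (perm_inv sigma k); rewrite ?mem_enum// permKV.
rewrite /DeltaL -/leT e.
have ni : nth 0 [seq S (sigma k) | k <- enum 'I_M] L.-1 = S (sigma i).
  by rewrite -iL (nth_map i) ?size_enum_ord// nth_ord_enum.
have nj : nth 0 [seq S (sigma k) | k <- enum 'I_M] L = S (sigma j).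
  by rewrite -jL (nth_map j) ?size_enum_ord// nth_ord_enum.
by rewrite ni nj.
Qed.

Lemma DeltaL_le (L : nat) (i j : 'I_M) : (i < L)%N -> (L <= j)%N ->
  DeltaL L S <= S (sigma i) - S (sigma j).
Proof.
move=> iL jL; have LM : (L < M)%N by apply: leq_ltn_trans jL _.
have L'M : (L.-1 < M)%N by apply: leq_ltn_trans (leq_pred _) LM.
rewrite (@DeltaL_rankingE L (Ordinal L'M) (Ordinal LM))//.
apply: lerB; apply: rank_antimono => //=.
by rewrite -ltnS prednK//; apply: leq_ltn_trans iL.
Qed.

(** The strict separation [0 < b] forces the first [#|A|] ranks to be exactly the cells of [A]. *)
Lemma DeltaL_ge (A : {set 'I_M}) (b : R) : 0 < b -> (0 < #|A| < M)%N ->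
  (forall i j, i \in A -> j \notin A -> b <= S i - S j) -> b <= DeltaL #|A| S.
Proof.
move=> b0 /andP[A0 AM] h.
have A'M : (#|A|.-1 < M)%N by apply: leq_ltn_trans (leq_pred _) AM.
pose T := [set sigma i | i : 'I_M & (i < #|A|)%N].
have cT : #|T| = #|A|.
  rewrite card_imset; last exact: perm_inj.
  by rewrite -[RHS](card_ord_lt (ltnW AM)); apply: eq_card => k; rewrite !inE.
have TA : T \subset A.
  apply/fintype.subsetP => k kT; rewrite -[_ \in _]negbK; apply/negP => kA.
  have [a aA aT] : exists2 a, a \in A & a \notin T.
    apply/subsetPn; apply/negP => AT.
    have e : A = T by apply/eqP; rewrite eqEcard AT cT leqnn.
    by move: kA; rewrite e kT.
  case/imsetP: kT => i iA ki; rewrite inE in iA.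
  have ea : a = sigma (perm_inv sigma a) by rewrite permKV.
  rewrite ea mem_rank -leqNgt in aT.
  have := h _ _ aA kA; rewrite {1}ea ki.
  have := @rank_antimono i (perm_inv sigma a) (leq_trans (ltnW iA) aT); lra.
have eT : T = A by apply/eqP; rewrite eqEcard TA cT leqnn.
rewrite (@DeltaL_rankingE #|A| (Ordinal A'M) (Ordinal AM))//.
have memA k : (k \in A) = (k \in T) by rewrite eT.
by apply: h; rewrite memA mem_rank/= ?ltnn// prednK.
Qed.

End Ranking.

(** The right side is [1 - r] times a geometric sum of [t.+1] terms, the least of which is
    [r ^+ t]. *)
Lemma natmulX_bound (R : realType) (r : R) (t : nat) : 0 <= r <= 1 ->
  t.+1%:R * r ^+ t * (1 - r) <= 1 - r ^+ t.+1.
Proof.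
move=> /andP[r0 r1]; elim: t => [|t IH]; first by rewrite expr0 expr1 mul1r mul1r.
have h : 0 <= (1 - r) * (1 - r ^+ t.+1).
  by rewrite mulr_ge0 ?subr_ge0// exprn_ile1.
have IH' := ler_wpM2l r0 IH.
rewrite -[t.+2]addn1 natrD [r ^+ (t.+1 + 1)]exprD expr1 !exprS in IH' h *.
move: (r ^+ t) (t.+1%:R : R) IH' h => x s; rewrite !mulrDl !mulrDr !mulrN; lra.
Qed.

(** With [r = sqrt q], the term is [t.+1 * r^t] times [r^t]: the first factor is at most
    [1 / (1 - r)], the second sums geometrically. *)
Lemma sum_natmulX_bound (R : realType) (q : R) : 0 <= q < 1 ->
  exists2 C, 0 <= C & forall N, \sum_(t < N) t.+1%:R * q ^+ t <= C.
Proof.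
move=> /andP[q0 q1]; pose r := Num.sqrt q.
have r0 : 0 <= r by exact: sqrtr_ge0.
have qr : q = r * r by rewrite -expr2 sqr_sqrtr.
have r1 : r < 1.
  by rewrite ltNge; apply/negP => r1; move: q1; rewrite ltNge qr mulr_ege1.
have r1' : 0 < 1 - r by rewrite subr_gt0.
have geo N : \sum_(t < N) r ^+ t * (1 - r) = 1 - r ^+ N.
  elim: N => [|N IH]; first by rewrite big_ord0 expr0 subrr.
  by rewrite big_ord_recr/= IH exprS; ring.
exists ((1 - r)^-1 * (1 - r)^-1); first by rewrite mulr_ge0// invr_ge0 ltW.
move=> N; rewrite ler_pdivlMl//.
rewrite -(ler_pM2r r1') mulVf ?gt_eqF// -mulrA mulr_suml mulr_sumr.
apply: (@le_trans _ _ (\sum_(t < N) r ^+ t * (1 - r))); last first.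
  by rewrite geo lerBlDr lerDl exprn_ge0.
apply: ler_sum => t _; have := @natmulX_bound R r t; rewrite r0 (ltW r1) => /(_ isT) h.
have h1 : t.+1%:R * r ^+ t * (1 - r) <= 1.
  by apply: le_trans h _; rewrite lerBlDr lerDl exprn_ge0.
have h2 : 0 <= r ^+ t * (1 - r) by rewrite mulr_ge0 ?exprn_ge0// ltW.
have := ler_wpM2l h2 h1; rewrite mulr1 qr exprMn; apply: le_trans.
by rewrite le_eqVlt; apply/orP; left; apply/eqP; ring.
Qed.

Lemma measure_bigsetU_le (R : realType) (d : measure_display) (T : measurableType d)
  (P : probability T R) (I : Type) (s : seq I) (F : I -> set T) :
  (forall i, measurable (F i)) ->
  (P (\big[setU/set0]_(i <- s) F i) <= \sum_(i <- s) P (F i))%E.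
Proof.
move=> mF; elim: s => [|i s IH]; first by rewrite !big_nil measure0.
rewrite !big_cons; apply: le_trans (measureU2 _ _ _) _ => //.
  exact: bigsetU_measurable.
exact: leeD2l.
Qed.

Lemma sum_ltn_ord (n N : nat) : (\sum_(t < N) (t < n) = minn n N)%N.
Proof.
elim: N => [|N IH]; first by rewrite big_ord0 minn0.
rewrite big_ord_recr/= IH; have [h|h] : (N < n)%N \/ (n <= N)%N.
  by apply/orP; rewrite ltnNge orNb.
- by rewrite h (minn_idPr (ltnW h)) (minn_idPr h) addn1.
- by rewrite ltnNge h (minn_idPl h) (minn_idPl (leqW h)) addn0.
Qed.

(** In one round the mass [a] where a cell is selected is multiplied by [m], and the mass [b]
    elsewhere is unchanged. *)
Lemma lee_mix (R : realType) (a b : \bar R) (m c : R) : (0 <= a)%E -> (0 <= b)%E ->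
  m <= c -> 1 <= c -> (m%:E * a + b <= c%:E * (a + b))%E.
Proof.
move=> a0 b0 mc c1; rewrite ge0_muleDr//; apply: leeD.
  by rewrite lee_wpmul2r// lee_fin.
by rewrite -[leLHS]mul1e lee_wpmul2r// lee_fin.
Qed.

Unset Implicit Arguments.
Section UpperBound.
Context (R : realType) (M K L : nat) (dY : measure_display) (Y : measurableType dY)
  (mu : {measure set Y -> \bar R}) (f g : Y -> R)
  (dO : measure_display) (Omega : measurableType dO)
  (dV : measure_display) (V : measurableType dV)
  (P : {set 'I_M} -> probability Omega R) (U : Omega -> V)
  (y : nat -> 'I_M -> Omega -> Y).
Hypotheses (L0 : (0 < L)%N) (LM : (L < M)%N) (K0 : (0 < K)%N).
Hypotheses (df : is_density mu f) (dg : is_density mu g).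
Hypotheses (kgf : (0 < KL mu g f < +oo)%E) (kfg : (0 < KL mu f g < +oo)%E).
Hypothesis mgf : exists2 eps : R, 0 < eps & forall s : R, `|s| < eps ->
     (\int[mu]_x (f x * expR (s * llr f g x))%:E < +oo)%E /\
     (\int[mu]_x (g x * expR (s * llr f g x))%:E < +oo)%E.
Hypothesis model : search_model L mu f g P U y.

Local Notation D1 := (fine (KL mu g f)).
Local Notation D2 := (fine (KL mu f g)).

Let mU : measurable_fun setT U. Proof. by case: model. Qed.
Let my n k : measurable_fun setT (y n k).
Proof. exact: (observation_measurable model). Qed.
Let ml : measurable_fun setT (llr f g).
Proof. by case: df dg => mf [f0 _] [mg [g0 _]]; exact: measurable_llr. Qed.
Let D1_gt0 : 0 < D1.
Proof. by apply: fine_gt0; rewrite kgf. Qed.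
Let D2_gt0 : 0 < D2.
Proof. by apply: fine_gt0; rewrite kfg. Qed.

Definition deviation (G : policy Omega M) m k b (w : Omega) : R :=
  Ssum f g y G m w k - mean_llr mu f g b * (visits (fun t => sel G t w) m k)%:R.

(** A weight that reacts to cell [k] alone, centred so that its product over the rounds is the
    exponential of a signed [deviation]. *)
Definition tilt b (sg : bool) s (k k' : 'I_M) (x : Y) : R :=
  if k' == k then expR (s * ((-1) ^+ sg * (llr f g x - mean_llr mu f g b))) else 1.

Lemma tilt_weightE G b sg s k m w :
  weight y G (tilt b sg s k) m w = expR (s * ((-1) ^+ sg * deviation G m k b w)).
Proof.
rewrite /deviation /Ssum /visits natr_sum mulr_sumr -sumrB !mulr_sumr expR_sum.
apply: eq_bigr => t _; rewrite (bigD1 k)//= big1 ?mulr1; last first.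
  by move=> k' k'k; rewrite /tilt (negbTE k'k); case: ifP.
rewrite /tilt eqxx; case: ifP => _; first by rewrite mulr1.
by rewrite mulr0 subrr !mulr0 expR0.
Qed.

Section Deviation.
Variables (G : policy Omega M).
Hypothesis adaptG : forall n (S : {set 'I_M}),
  hist_sigma U y G n [set w | sel G n w = S].

(** A round multiplies the expected weight by [mm] on the event that [k] is selected, which belongs
    to [F_ m], and by 1 off it; hence [Num.max 1 mm] per round. *)
Lemma tilt_weight_bound (A : {set 'I_M}) k (sg : bool) s mm : #|A| = L ->
  (forall n, \int[P A]_w (expR (s * ((-1) ^+ sg *
      (llr f g (y n k w) - mean_llr mu f g (k \in A)))))%:E = mm%:E)%E ->
  measurable_fun setT (weight y G (tilt (k \in A) sg s k) 0) /\
  forall m, measurable_fun setT (weight y G (tilt (k \in A) sg s k) m) /\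
  (\int[P A]_w (weight y G (tilt (k \in A) sg s k) m w)%:E <= (Num.max 1 mm ^+ m)%:E)%E.
Proof.
move=> AL hm; set r := tilt _ _ _ _.
have indA : indep_model (P A) U y by case: model => _ _ ind _ _; exact: ind.
have mr k' : measurable_fun setT (r k').
  rewrite /r /tilt; case: (k' == k); last exact: measurable_cst.
  apply: measurableT_comp => //; apply: measurable_funM => //.
  by apply: measurable_funM => //; exact: measurable_funB.
have r0 k' x : 0 <= r k' x by rewrite /r /tilt; case: (k' == k); rewrite ?expR_ge0.
have rint n k' : (\int[P A]_w (r k' (y n k' w))%:E = (if k' == k then mm else 1)%:E)%E.
  rewrite /r /tilt; case: eqVneq => [->|_]; last by rewrite integral_cst_probability.
  exact: hm.
have rfin n k' : (\int[P A]_w (r k' (y n k' w))%:E < +oo)%E by rewrite rint ltry.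
have mm0 : 0 <= mm.
  by rewrite -lee_fin -(hm 0%N); apply: integral_ge0 => w _; rewrite lee_fin expR_ge0.
have mW m : measurable_fun setT (weight y G r m).
  exact: (measurable_weight _ _ _ _ _ _ _ _ _ _ mU my).
have W0 m w : 0 <= weight y G r m w by exact: weight_ge0.
split=> // m; split => //.
elim: m => [|m IH].
  rewrite expr0; have e w : weight y G r 0 w = 1 by rewrite /weight big_ord0.
  by under eq_integral do rewrite e; rewrite integral_cst_probability.
have hsel := hist_sel adaptG m (fun S => k \in S).
have msel := hist_sigma_measurable mU my adaptG _ _ hsel.
have [_ H] := weight_indep _ _ _ _ _ _ _ _ _ _ mU my _ indA G r adaptG mr r0 rfin m.
have fac : factors R dO dY Omega Y M y (P A) (fun i x => r i.2 x)
    (fun i => if i.2 == k then mm else 1) by split.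
have ts (i' : nat * 'I_M) : i' \in [:: (m, k)] -> (m <= i'.1)%N.
  by rewrite inE => /eqP ->.
have := H _ hsel _ _ [:: (m, k)] fac isT ts.
rewrite (big_seq1 _ _ (fun i => if i.2 == k then mm else 1))/= eqxx => H1.
have WS w : weight y G r m.+1 w =
    \1_[set w | k \in sel G m w] w * (weight y G r m w * r k (y m k w)) +
    \1_(~` [set w | k \in sel G m w]) w * weight y G r m w.
  rewrite weightS !indicE in_setC.
  have [ks|ks] := boolP (w \in [set w | k \in sel G m w]).
    rewrite inE/= in ks; rewrite mul1r mul0r addr0; congr (_ * _).
    rewrite (bigD1 k)//= big1 ?mulr1// => k' /andP[_ k'k].
    by rewrite /r /tilt (negbTE k'k).
  rewrite notin_setE/= in ks; rewrite mul0r add0r mul1r.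
  rewrite big1 ?mulr1// => k' k's; rewrite /r /tilt; case: eqP => // e.
  by case: ks; rewrite -e.
have mI (E : set Omega) (F : Omega -> R) : measurable E -> measurable_fun setT F ->
    measurable_fun setT (fun w => \1_E w * F w).
  by move=> mE mF; apply: measurable_funM => //; exact: measurable_indic.
have mWr : measurable_fun setT (fun w => weight y G r m w * r k (y m k w)).
  by apply: measurable_funM => //; exact: measurableT_comp.
have mC := measurableC msel.
under eq_integral do rewrite WS.
rewrite integral_addr//.
all: try by apply: mI.
all: try by move=> w; rewrite !mulr_ge0.
rewrite !integral_indic_setT.
have H2 : (\int[P A]_(w in [set w | k \in sel G m w])
    (weight y G r m w * r k (y m k w))%:E =
    \int[P A]_(w in [set w | k \in sel G m w]) (weight y G r m w)%:E * mm%:E)%E.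
  by rewrite -H1; apply: eq_integral => w _; rewrite big_seq1.
rewrite H2.
set a := (\int[P A]_(w in _) _)%E; set b := (\int[P A]_(w in ~` _) _)%E.
have a0 : (0 <= a)%E by apply: integral_ge0 => w _; rewrite lee_fin.
have b0 : (0 <= b)%E by apply: integral_ge0 => w _; rewrite lee_fin.
have ab : (a + b <= (Num.max 1 mm ^+ m)%:E)%E.
  apply: le_trans IH; rewrite /a /b -ge0_integral_setU ?setUv//.
  - by apply/measurable_EFinP.
  - by move=> w _; rewrite lee_fin.
  - by rewrite disj_set2E setICr.
rewrite exprS EFinM [(a * _)%E]muleC.
have max1 : 1 <= Num.max 1 mm by rewrite le_max lexx.
have maxm : mm <= Num.max 1 mm by rewrite le_max lexx orbT.
apply: (@le_trans _ _ ((Num.max 1 mm)%:E * (a + b))%E); last first.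
  by apply: lee_wpmul2l => //; rewrite lee_fin (le_trans ler01).
exact: lee_mix.
Qed.

End Deviation.

(** Markov's inequality for the tilted weight, with [q = expR (- (s * eta)) * Num.max 1 mm]. All
    times [m <= n] are compared with the same level [eta * n], ready for a union over the past; [q]
    is chosen before the policy, so it does not depend on [c]. *)
Lemma deviation_tail1 b (sg : bool) (eta : R) : 0 < eta -> exists q, [/\ 0 <= q, q < 1 &
  forall G, (forall n (S : {set 'I_M}), hist_sigma U y G n [set w | sel G n w = S]) ->
  forall (A : {set 'I_M}) k m n, #|A| = L -> (k \in A) = b -> (m <= n)%N ->
  measurable [set w | eta * n%:R < (-1) ^+ sg * deviation G m k b w] /\
  (P A [set w | (eta * n%:R < (-1) ^+ sg * deviation G m k b w)%R] <= (q ^+ n)%:E)%E].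
Proof.
move=> eta0.
have [s [mm [s0 h1 h2 hm]]] :=
  observation_chernoff L0 LM df dg kgf kfg mgf model b sg eta eta0.
pose q := expR (- (s * eta)) * Num.max 1 mm.
exists q; split.
- by rewrite mulr_ge0 ?expR_ge0// le_max ler01.
- by rewrite /q /Num.max; case: ifP; rewrite ?mulr1.
move=> G adaptG A k m n AL kb mn; rewrite -kb.
have hm' n' : (\int[P A]_w (expR (s * ((-1) ^+ sg *
      (llr f g (y n' k w) - mean_llr mu f g (k \in A)))))%:E = mm%:E)%E.
  by have := hm A n' k AL kb; rewrite kb.
have [_ /(_ m)[mW bW]] := tilt_weight_bound G adaptG A k sg s mm AL hm'.
set E := [set w | _].
have EE : E = [set w | expR (s * (eta * n%:R)) < weight y G (tilt (k \in A) sg s k) m w].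
  by apply/seteqP; split => w; rewrite /E/= tilt_weightE ltr_expR ltr_pM2l.
have mE : measurable E.
  have mb : measurable_fun setT
      (fun w => expR (s * (eta * n%:R)) < weight y G (tilt (k \in A) sg s k) m w).
    by apply: measurable_fun_ltr => //; exact: measurable_cst.
  by have := mb measurableT [set true]; rewrite setTI EE; exact.
split => //.
have -> : P A E = (\int[P A]_w (\1_E w)%:E)%E by rewrite integral_indic// setIT.
apply: (@le_trans _ _ (\int[P A]_w (expR (- (s * eta)) ^+ n *
    weight y G (tilt (k \in A) sg s k) m w)%:E)%E).
  apply: integral_ler => //.
  all: try exact: measurable_indic.
  all: try exact: measurable_funM.
  - move=> w; rewrite indicE; case: (boolP (w \in E)) => [|_]; last first.
      by rewrite mulr_ge0 ?exprn_ge0 ?expR_ge0// tilt_weightE expR_ge0.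
    rewrite inE EE/= => /ltW h; rewrite -expRM_natl.
    have e : expR (n%:R * - (s * eta)) * expR (s * (eta * n%:R)) = 1.
      by rewrite -expRD -[RHS]expR0; congr expR; ring.
    apply: (@le_trans _ _ (expR (n%:R * - (s * eta)) * expR (s * (eta * n%:R)))).
      by rewrite e.
    by apply: ler_wpM2l; rewrite ?expR_ge0.
rewrite integral_scaler ?exprn_ge0 ?expR_ge0//; last first.
  by move=> w; rewrite tilt_weightE expR_ge0.
have max1 : 1 <= Num.max 1 mm by rewrite le_max lexx.
rewrite /q exprMn EFinM; apply: lee_wpmul2l; first by rewrite lee_fin exprn_ge0 ?expR_ge0.
by apply: le_trans bW _; rewrite lee_fin; apply: ler_weXn2l.
Qed.

Lemma deviation_tail (eta : R) : 0 < eta -> exists q, [/\ 0 <= q, q < 1 &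
  forall G, (forall n (S : {set 'I_M}), hist_sigma U y G n [set w | sel G n w = S]) ->
  forall (A : {set 'I_M}) k m n, #|A| = L -> (m <= n)%N ->
  measurable [set w | eta * n%:R < `|deviation G m k (k \in A) w|] /\
  (P A [set w | (eta * n%:R < `|deviation G m k (k \in A) w|)%R] <= (2 * q ^+ n)%:E)%E].
Proof.
move=> eta0.
have [q1 [a1 b1 h1]] := deviation_tail1 true true eta eta0.
have [q2 [a2 b2 h2]] := deviation_tail1 true false eta eta0.
have [q3 [a3 b3 h3]] := deviation_tail1 false true eta eta0.
have [q4 [a4 b4 h4]] := deviation_tail1 false false eta eta0.
pose q := Num.max (Num.max q1 q2) (Num.max q3 q4).
exists q; split; first by rewrite !le_max a1.
  by rewrite !gt_max b1 b2 b3 b4.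
move=> G adaptG A k m n AL mn.
have H (sg : bool) : measurable [set w | eta * n%:R < (-1) ^+ sg * deviation G m k (k \in A) w] /\
    (P A [set w | (eta * n%:R < (-1) ^+ sg * deviation G m k (k \in A) w)%R] <= (q ^+ n)%:E)%E.
  have le q' : 0 <= q' -> q' <= q -> ((q' ^+ n)%:E <= (q ^+ n)%:E)%E.
    by move=> q'0 q'q; rewrite lee_fin lerXn2r// nnegrE// (le_trans q'0).
  case kA : (k \in A); case: sg.
  - have [? h] := h1 G adaptG A k m n AL kA mn; split => //.
    by apply: le_trans h (le _ a1 _); rewrite !le_max lexx.
  - have [? h] := h2 G adaptG A k m n AL kA mn; split => //.
    by apply: le_trans h (le _ a2 _); rewrite !le_max lexx !orbT.
  - have [? h] := h3 G adaptG A k m n AL kA mn; split => //.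
    by apply: le_trans h (le _ a3 _); rewrite !le_max lexx !orbT.
  - have [? h] := h4 G adaptG A k m n AL kA mn; split => //.
    by apply: le_trans h (le _ a4 _); rewrite !le_max lexx !orbT.
have [m1 p1] := H true; have [m2 p2] := H false.
have -> : [set w | eta * n%:R < `|deviation G m k (k \in A) w|] =
    [set w | eta * n%:R < (-1) ^+ true * deviation G m k (k \in A) w] `|`
    [set w | eta * n%:R < (-1) ^+ false * deviation G m k (k \in A) w].
  apply/seteqP; split => w /=; rewrite expr0 expr1 mulN1r mul1r lter_normr orbC.
    by move=> /orP.
  by move=> ?; apply/orP.
split; first exact: measurableU.
apply: le_trans (measureU2 _ _ _) _ => //.
by rewrite mulr_natl mulr2n EFinD; apply: leeD.
Qed.

Let adapt c G : is_DGF K L D1 D2 f g U y c G ->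
  forall n (S : {set 'I_M}), hist_sigma U y G n [set w | sel G n w = S].
Proof. by case=> -[]. Qed.

(** The two rules of the [f] regime are those of the [g] regime in reversed order: the sums change
    sign, [A] becomes its complement and the drifts are exchanged, which leaves the constant
    unchanged by [greedy_constC]. *)
Lemma dgf_progress c G (A : {set 'I_M}) n w delta i j :
  is_DGF K L D1 D2 f g U y c G -> #|A| = L -> 0 <= delta ->
  (forall m k, (m <= n)%N -> `|deviation G m k (k \in A) w| <= delta) ->
  i \in A -> j \notin A ->
  I_star M K L D1 D2 * n%:R - greedy_const M D1 D2 * (delta + 1) <=
    Ssum f g y G n w i - Ssum f g y G n w j.
Proof.
move=> [[cardG _ _ _ _] selG _ _] AL d0 dev iA jA.
have cs m : #|sel G m w| = K by exact: cardG.
have A0 : (0 < #|A|)%N by rewrite AL.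
have AM : (#|A| < M)%N by rewrite AL.
have cAC : #|~: A| = (M - L)%N by rewrite cardsCs finset.setCK card_ord AL.
have C0 : (0 < #|~: A|)%N by rewrite cAC subn_gt0.
have CM : (#|~: A| < M)%N by rewrite cAC ltn_subrL L0 (leq_ltn_trans _ LM).
have close1 m k : (m <= n)%N -> `|Ssum f g y G m w k - (if k \in A
    then D1 * (visits (fun t => sel G t w) m k)%:R
    else - (D2 * (visits (fun t => sel G t w) m k)%:R))| <= delta.
  move=> mn; have := dev m k mn; rewrite /deviation /mean_llr.
  by case: (k \in A); rewrite ?mulNr.
have close2 m k : (m <= n)%N -> `|- Ssum f g y G m w k - (if k \in ~: A
    then D2 * (visits (fun t => sel G t w) m k)%:R
    else - (D1 * (visits (fun t => sel G t w) m k)%:R))| <= delta.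
  move=> mn; have := close1 m k mn; rewrite inE; case: (k \in A) => /=;
    rewrite -normrN; congr (`|_| <= _); ring.
have iC : i \notin ~: A by rewrite inE iA.
have jC : j \in ~: A by rewrite inE.
have swp (u v : R) : - u - - v = v - u by rewrite opprK addrC.
have permE (s : {perm 'I_M}) k : k = s (perm_inv s k) by rewrite permKV.
move: selG; rewrite /I_star /dgf_lo; case: ifP => cmp selG.
  rewrite /I_g; case: ifP selG => LK selG.
    rewrite -AL; apply: (greedy_top D1_gt0 D2_gt0 d0 A0 AM cs close1); rewrite ?AL//.
    move=> m k k' mn; have [s [rk ->]] := selG m w.
    rewrite (permE s k) (permE s k') !(mem_rank s) !leq0n !add0n/= -leqNgt => h1 h2.
    by apply: (rank_antimono rk); apply: leq_trans h2; exact: ltnW.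
  have KL : (K < L)%N by rewrite ltnNge LK.
  rewrite -AL; apply: (greedy_bottom_of_top D1_gt0 D2_gt0 d0 A0 cs close1);
    rewrite ?AL//; first exact: ltnW.
  move=> m mn; have [s [rk sG]] := selG m w.
  rewrite subnK in sG; last exact: ltnW.
  exists [set s i | i : 'I_M & (i < L)%N]; split.
  - rewrite sG; apply/fintype.subsetP => k; rewrite (permE s k) !(mem_rank s).
    by case/andP.
  - rewrite card_imset; last exact: perm_inj.
    by rewrite -[RHS](card_ord_lt (ltnW LM)); apply: eq_card => k; rewrite !inE.
  - move=> k k'; rewrite (permE s k) (permE s k') !(mem_rank s) -leqNgt => h1 h2.
    by apply: (rank_antimono rk); apply: leq_trans h2; exact: ltnW.
  - move=> k k'; rewrite sG (permE s k) (permE s k') !(mem_rank s) => /andP[h1 _] h2.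
    rewrite h2 andbT -ltnNge => h3.
    by apply: (rank_antimono rk); apply: leq_trans h1; exact: ltnW.
rewrite -swp greedy_constC /I_f; case: ifP selG => LK selG.
  have -> : (D2 + (K + L - M)%:R * D1 / L%:R) =
      D2 + (K - #|~: A|)%:R * D1 / (M - #|~: A|)%:R.
    by rewrite cAC subnBA ?(ltnW LM)// subKn// ltnW.
  apply: (greedy_top (S := fun m k => - Ssum f g y G m w k)
    D2_gt0 D1_gt0 d0 C0 CM cs close2); rewrite ?cAC//; first exact: ltnW.
  move=> m k k' mn; have [s [rk ->]] := selG m w.
  have KM : (K <= M)%N by rewrite -(cs 0%N) -[X in (_ <= X)%N]card_ord max_card.
  rewrite (permE s k) (permE s k') !(mem_rank s) subnK// !ltn_ord !andbT -ltnNge => h1 h2.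
  by rewrite lerN2; apply: (rank_antimono rk); apply: leq_trans h1; exact: ltnW.
have KL : (K <= M - L)%N by rewrite leqNgt LK.
rewrite -cAC; apply: (greedy_bottom_of_top (S := fun m k => - Ssum f g y G m w k)
  D2_gt0 D1_gt0 d0 C0 cs close2); rewrite ?cAC//.
move=> m mn; have [s [rk sG]] := selG m w.
exists [set s i | i : 'I_M & (L <= i)%N]; split.
- rewrite sG; apply/fintype.subsetP => k; rewrite (permE s k) !(mem_rank s).
  by case/andP.
- rewrite card_imset; last exact: perm_inj.
  have := card_ord_lt (ltnW LM); set B := finset _ => cB.
  transitivity #|~: B|; last by rewrite cardsCs finset.setCK cB card_ord.
  by apply: eq_card => k; rewrite !inE -leqNgt.
- move=> k k'; rewrite (permE s k) (permE s k') !(mem_rank s) -ltnNge => h1 h2.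
  by rewrite lerN2; apply: (rank_antimono rk); apply: leq_trans h1; exact: ltnW.
- move=> k k'; rewrite sG (permE s k) (permE s k') !(mem_rank s) => /andP[_ h1] h2.
  rewrite h2/= -leqNgt => h3.
  by rewrite lerN2; apply: (rank_antimono rk); apply: leq_trans h3; exact: ltnW.
Qed.

Lemma alive_DeltaL c G w n : 0 < c < 1 -> is_DGF K L D1 D2 f g U y c G ->
  alive G n w -> DeltaL L (Ssum f g y G n w) < - ln c.
Proof.
move=> c01 [_ _ stopG _] al; rewrite ltNge; apply/negP => h.
have ex : exists m, - ln c <= DeltaL L (Ssum f g y G m w) by exists n.
have := ex_minnP ex; case=> m hm mmin.
have sm : stop G w = Some m.
  apply/stopG; split => // m' m'm; rewrite ltNge; apply/negP => h'.
  by have := mmin _ h'; rewrite leqNgt m'm.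
by move: al; rewrite /alive sm ltnNge mmin.
Qed.

Lemma dgf_alive_tail eps : 0 < eps < I_star M K L D1 D2 ->
  exists n0 q C, [/\ 0 <= q, q < 1, 0 <= C & forall c G, 0 < c < 1 ->
    is_DGF K L D1 D2 f g U y c G -> forall (A : {set 'I_M}) n, #|A| = L ->
    (n0 <= n)%N -> - ln c <= (I_star M K L D1 D2 - eps) * n%:R ->
    (P A [set w | alive G n w] <= (C * (n.+1%:R * q ^+ n))%:E)%E].
Proof.
move=> /andP[eps0 epsI].
pose C0 := greedy_const M D1 D2.
have C00 : 0 <= C0.
  rewrite /C0 /greedy_const addr_ge0// mulr_ge0 ?mulr_ge0//.
  - by rewrite addr_ge0// ltW.
  - by rewrite !addr_ge0// divr_ge0// ltW.
(* The loss [C0 * (eta * n + 1)] is then at most [eps / 2 * n + C0], hence at most [eps * n] from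
   [n0] on. *)
pose eta := eps / (2 * (C0 + 1)).
have C01 : 0 < 2 * (C0 + 1) by lra.
have eta0 : 0 < eta by rewrite divr_gt0.
have C0eta : C0 * eta <= eps / 2.
  have e : eta * (2 * (C0 + 1)) = eps by rewrite divfK// gt_eqF.
  by rewrite -e; move: (ltW eta0); move: (eta) (C0) => u v u0; lra.
have [q [q0 q1 hq]] := deviation_tail eta eta0.
pose n0 := (Num.truncn (2 * C0 / eps)).+1.
exists n0, q, (2 * M%:R); split => // c G c01 dG A n AL n0n hn.
have adaptG := adapt c G dG.
pose dev k m := [set w | eta * n%:R < `|deviation G m k (k \in A) w|].
(* The balancing argument needs control of every cell at every time up to [n]; this union produces
   the factor [n.+1 * M]. *)
pose bad := \big[setU/set0]_(p <- enum {: 'I_n.+1 * 'I_M}) dev p.2 p.1.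
have mdev (p : 'I_n.+1 * 'I_M) : measurable (dev p.2 p.1).
  have mn : (p.1 <= n)%N by rewrite -ltnS.
  by have [] := hq G adaptG A p.2 p.1 n AL mn.
have mbad : measurable bad by apply: bigsetU_measurable.
have sub : [set w | alive G n w] `<=` bad.
  move=> w al; apply: contrapT => nb.
  have close m k : (m <= n)%N -> `|deviation G m k (k \in A) w| <= eta * n%:R.
    move=> mn; rewrite leNgt; apply/negP => h; apply: nb.
    rewrite /bad -bigcup_seq; exists (Ordinal (mn : (m < n.+1)%N), k) => //=.
    by rewrite mem_enum.
  have lt := alive_DeltaL c G w n c01 dG al.
  have lnc0 : 0 < - ln c by rewrite oppr_gt0 ln_lt0.
  suff : - ln c <= DeltaL #|A| (Ssum f g y G n w) by rewrite AL leNgt lt.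
  have [s [rk _]] : exists s, is_ranking (Ssum f g y G n w) s /\
      sel G n w = [set s i | i : 'I_M & (dgf_lo M K L D1 D2 <= i < dgf_lo M K L D1 D2 + K)%N].
    by case: dG => _ selG _ _; exact: selG.
  apply: (DeltaL_ge rk lnc0); first by rewrite AL L0.
  move=> i j iA jA; apply: le_trans hn _.
  have e0 : 0 <= eta * n%:R by rewrite mulr_ge0// ltW.
  apply: le_trans (dgf_progress c G A n w (eta * n%:R) i j dG AL e0 close iA jA).
  rewrite -/C0; have n0' : (2 * C0 / eps : R) <= n%:R.
    apply: (@le_trans _ _ n0%:R); last by rewrite ler_nat.
    by rewrite ltW// truncnS_gt.
  have h1 : C0 <= eps / 2 * n%:R.
    have := ler_wpM2r (ltW eps0) n0'; rewrite divfK ?gt_eqF// => h.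
    by lra.
  have h2 : C0 * (eta * n%:R) <= eps / 2 * n%:R by rewrite mulrA ler_wpM2r.
  rewrite mulrBl mulrDr mulr1; lra.
apply: (@le_trans _ _ (P A bad)).
  apply: le_measure; rewrite ?inE//.
  have admG : admissible K L U y G by case: dG.
  exact: (hist_sigma_measurable mU my adaptG _ _ (hist_alive admG n)).
apply: le_trans (measure_bigsetU_le _ _ _) _ => //.
apply: (@le_trans _ _ (\sum_(p <- enum {: 'I_n.+1 * 'I_M}) (2 * q ^+ n)%:E)%E).
  apply: lee_sum => p _; have mn : (p.1 <= n)%N by rewrite -ltnS.
  by have [] := hq G adaptG A p.2 p.1 n AL mn.
rewrite sumEFin lee_fin big_enum/= sumr_const card_prod !card_ord.
rewrite -[X in X <= _]mulr_natl natrM le_eqVlt; apply/orP; left; apply/eqP; ring.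
Qed.

(** The survival probabilities before [n1] are bounded by 1 and yield the main term; from [n1] on,
    the tail bound applies and is summable uniformly in [c]. *)
Lemma dgf_expected_time eps : 0 < eps < I_star M K L D1 D2 ->
  exists2 C, 0 <= C & forall c G, 0 < c < 1 -> is_DGF K L D1 D2 f g U y c G ->
    forall A : {set 'I_M}, #|A| = L ->
    (\int[P A]_w tau_e G w <= (- ln c / (I_star M K L D1 D2 - eps) + C)%:E)%E.
Proof.
move=> epsI; have [n0 [q [C1 [q0 q1 C10 hC]]]] := dgf_alive_tail eps epsI.
have q01 : 0 <= q < 1 by rewrite q0 q1.
have [C2 C20 hC2] := sum_natmulX_bound q01.
have I0 : 0 < I_star M K L D1 D2 - eps by rewrite subr_gt0; case/andP: epsI.
exists (n0.+1%:R + C1 * C2); first by rewrite addr_ge0// mulr_ge0.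
move=> c G c01 dG A AL; have admG : admissible K L U y G by case: dG.
rewrite (integral_tau_e model admG).
have lnc0 : 0 < - ln c by rewrite oppr_gt0 ln_lt0.
pose x := - ln c / (I_star M K L D1 D2 - eps).
have x0 : 0 <= x by rewrite divr_ge0// ltW.
pose n1 := ((Num.truncn x).+1 + n0)%N.
apply: lime_le; first exact: is_cvg_nneseries.
apply: nearW => N; rewrite big_mkord.
apply: (@le_trans _ _ (\sum_(t < N) ((t < n1)%:R + C1 * (t.+1%:R * q ^+ t))%:E)%E).
  apply: lee_sum => t _; case: ltnP => tn1.
    apply: (@le_trans _ _ 1%E); first exact: probability_le1 (alive_measurable model admG t).
    by rewrite lee_fin lerDl !mulr_ge0// exprn_ge0.
  have n0t : (n0 <= t)%N by apply: leq_trans tn1; rewrite /n1 leq_addl.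
  rewrite add0r; apply: (hC c G c01 dG A t AL n0t).
  rewrite mulrC -ler_pdivrMr// -/x; apply: (@le_trans _ _ n1%:R); last by rewrite ler_nat.
  rewrite /n1 natrD; apply: (@le_trans _ _ (Num.truncn x).+1%:R); last by rewrite lerDl.
  by rewrite ltW// truncnS_gt.
rewrite sumEFin lee_fin big_split/= -mulr_sumr.
have h1 : \sum_(t < N) (t < n1)%:R <= n1%:R :> R.
  by rewrite -natr_sum ler_nat sum_ltn_ord geq_minl.
have h2 := ler_wpM2l C10 (hC2 N).
have h3 : (Num.truncn x)%:R <= x by rewrite truncn_le.
rewrite -/x; apply: le_trans (lerD h1 h2) _.
rewrite /n1 natrD -addn1 natrD -[n0.+1]addn1 natrD; lra.
Qed.

(** Never stopping counts as an error, and the finite mean excludes it. A wrong set [B] contains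
    some [j] outside [A] and misses some [i] of [A]; when [B] is declared the threshold separates
    their sums, and one change of measure gains the factor [c]. The constant crudely counts all sets
    of cells. *)
Lemma dgf_error c G (A : {set 'I_M}) : 0 < c < 1 -> is_DGF K L D1 D2 f g U y c G ->
  #|A| = L -> (\int[P A]_w tau_e G w < +oo)%E ->
  (err_prob (P A) A G <= (#|{set 'I_M}|%:R * c)%:E)%E.
Proof.
move=> c01 dG AL fin; have admG : admissible K L U y G by case: dG.
have adaptG := adapt c G dG; have /andP[c0 c1] := c01.
have mF n E : hist_sigma U y G n E -> measurable E.
  exact: (hist_sigma_measurable mU my adaptG).
pose wrong B n := [set w | stop G w = Some n /\ dec G w = B].
have hw B n : hist_sigma U y G n (wrong B n) by case: admG => _ _ _ _ h; exact: h.
have mw B n : measurable (wrong B n) by exact: mF (hw B n).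
pose never := [set w | stop G w = None].
have mnever : measurable never.
  have -> : never = \bigcap_n [set w | alive G n w].
    apply/seteqP; split => w; rewrite /never/=; first by move=> e n _; rewrite /= /alive e.
    case e : (stop G w) => [m|//] h; have := h m I; rewrite /= /alive e ltnn//.
  by apply: bigcapT_measurable => n; exact: (alive_measurable model admG).
have Pnever : P A never = 0.
  have fn : P A never \is a fin_num by rewrite fin_num_measure.
  have [x ex] : exists x, P A never = x%:E by exists (fine (P A never)); rewrite fineK.
  have [T eT] : exists T, (\int[P A]_w tau_e G w = T%:E)%E.
    exists (fine (\int[P A]_w tau_e G w)); rewrite fineK// ge0_fin_numE//.
    by apply: integral_ge0 => w _; rewrite /tau_e; case: (stop G w) => // n; rewrite lee_fin.
  have x0 : 0 <= x by rewrite -lee_fin -ex.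
  have hN N : N%:R * x <= T.
    rewrite -lee_fin -eT (integral_tau_e model admG).
    apply: le_trans (@nneseries_lim_ge R (fun t => P A [set w | alive G t w]) predT 0 N _) => //.
    rewrite big_mkord mulr_natl -[N in _ *+ N]card_ord -sumr_const -sumEFin.
    apply: lee_sum => t _; rewrite -ex; apply: le_measure; rewrite ?inE//.
      exact: (alive_measurable model admG).
    by move=> w e; rewrite /= /alive e.
  rewrite ex; congr EFin; apply/eqP; rewrite eq_le x0 andbT leNgt; apply/negP => x1.
  have := hN (Num.truncn (T / x)).+1; rewrite leNgt -ltr_pdivrMr// truncnS_gt//.
have Pwrong (B : {set 'I_M}) : B != A -> #|B| = L ->
    (P A (\bigcup_n wrong B n) <= c%:E)%E.
  move=> BA BL.
  have [i iA iB] : exists2 i, i \in A & i \notin B.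
    apply/subsetPn; apply/negP => AB; move: BA.
    by rewrite eq_sym eqEcard AB AL BL leqnn.
  have [j jB jA] : exists2 j, j \in B & j \notin A.
    apply/subsetPn; apply/negP => AB; move: BA.
    by rewrite eqEcard AB AL BL leqnn.
  have tI : trivIset setT (wrong B).
    apply/trivIsetP => n n' _ _ nn'; apply/seteqP; split => w //= [[e _] [e' _]].
    by move/eqP: nn'; apply; move: e; rewrite e' => -[].
  have mbw : measurable (\bigcup_n wrong B n) by exact: bigcupT_measurable.
  rewrite measure_semi_bigcup//.
  apply: (@le_trans _ _ (\sum_(0 <= n <oo) (c%:E * P (j |: A :\ i) (wrong B n)))%E).
    apply: lee_nneseries => // n _.
    rewrite -(swap_change_of_measure df dg kgf kfg model i j adaptG AL iA jA n _ (hw B n)).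
    rewrite [X in (X <= _)%E](_ : _ = \int[P A]_(w in wrong B n) 1%:E)%E; last first.
      by rewrite integral_cst ?mul1e.
    have mS k : measurable_fun setT (fun w => Ssum f g y G n w k).
      apply: measurable_sum => t; apply: measurable_fun_ifT => //.
        apply: (measurable_fun_bool true); rewrite setTI.
        exact: mF (hist_sel adaptG t (fun S => k \in S)).
      exact: measurableT_comp.
    have mE : measurable_fun setT (fun w =>
        (expR (- (Ssum f g y G n w i - Ssum f g y G n w j)))%:E).
      apply/measurable_EFinP; apply: measurableT_comp => //.
      by apply: measurableT_comp => //; exact: measurable_funB.
    rewrite -ge0_integralZl_EFin ?(ltW c0)//; last 2 first.
    all: try by move=> w _; rewrite lee_fin expR_ge0.
    all: try exact: measurable_funS mE.
    apply: ge0_le_integral => //.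
    all: try by apply: measurable_funeM; exact: measurable_funS mE.
    all: try by move=> w _; rewrite -EFinM lee_fin mulr_ge0 ?expR_ge0// ltW.
    move=> w [sw dw]; rewrite -EFinM lee_fin.
    case: dG => _ _ stopG decG.
    have [h _] := (stopG w n).1 sw.
    have [s [rk ds]] := decG w n sw.
    have : - ln c <= Ssum f g y G n w j - Ssum f g y G n w i.
      apply: le_trans h _; rewrite -[j](permKV s) -[i](permKV s); apply: (DeltaL_le rk).
        by move: jB; rewrite -dw ds -[j in j \in _](permKV s) mem_rank.
      by move: iB; rewrite -dw ds -[i in i \notin _](permKV s) mem_rank -leqNgt.
    rewrite -ler_expR expRN lnK ?posrE// opprB => h'.
    by have := ler_wpM2l (ltW c0) h'; rewrite divff// gt_eqF.
  rewrite nneseriesZl// -measure_semi_bigcup//.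
  rewrite -[leRHS]mule1; apply: lee_wpmul2l; first by rewrite lee_fin ltW.
  by apply: probability_le1; apply: bigcupT_measurable.
rewrite /err_prob.
pose Fw (B : {set 'I_M}) := if (B != A) && (#|B| == L) then \bigcup_n wrong B n else set0.
have mFw B : measurable (Fw B).
  by rewrite /Fw; case: ifP => // _; exact: bigcupT_measurable.
have mU' := bigsetU_measurable (enum {set 'I_M}) (P := predT) (F := Fw) (fun B _ => mFw B).
apply: (@le_trans _ _ (P A (never `|` \big[setU/set0]_(B <- enum {set 'I_M}) Fw B))).
  apply: le_measure; rewrite ?inE//; last first.
  - move=> w /=; case e : (stop G w) => [n|]; last by left.
    move=> [] // dA; right; rewrite -bigcup_seq; exists (dec G w); first by rewrite /= mem_enum.
    have cd : #|dec G w| = L by case: admG.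
    by rewrite /Fw dA cd eqxx/=; exists n.
  - exact: measurableU.
  - have -> : [set w | stop G w = None \/ dec G w != A] =
       never `|` \big[setU/set0]_(B <- enum {set 'I_M}) Fw B; last exact: measurableU.
    rewrite -bigcup_seq; apply/seteqP; split => w.
      move=> /=; case e : (stop G w) => [n|]; last by left.
      move=> [] // dA; right; exists (dec G w); first by rewrite /= mem_enum.
      have cd : #|dec G w| = L by case: admG.
      by rewrite /Fw dA cd eqxx/=; exists n.
    move=> [e|[B _]]; first by left.
    by rewrite /Fw; case: ifP => // /andP[BA _] [n _ [_ dB]]; right; rewrite dB.
apply: le_trans (measureU2 _ _ _) _ => //.
rewrite [X in (X + _)%E](_ : _ = 0%E); last exact: Pnever.
rewrite add0e; apply: le_trans (measure_bigsetU_le _ _ _) _ => //.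
rewrite mulr_natl -sumr_const -sumEFin big_enum/=.
apply: lee_sum => B _; rewrite /Fw; case: ifP => [/andP[BA /eqP BL]|_].
  exact: Pwrong.
by rewrite measure0 lee_fin ltW.
Qed.

End UpperBound.
Set Implicit Arguments.

(** * Bayes risk *)

Lemma I_star_gt0 (R : realType) (M K L : nat) (D1 D2 : R) :
  (0 < L)%N -> (L < M)%N -> (0 < K)%N -> 0 < D1 -> 0 < D2 -> 0 < I_star M K L D1 D2.
Proof.
move=> L0 LM K0 D10 D20.
have L0' : (0 : R) < L%:R by rewrite ltr0n.
have K0' : (0 : R) < K%:R by rewrite ltr0n.
have ML0' : (0 : R) < (M - L)%:R by rewrite ltr0n subn_gt0.
rewrite /I_star /I_g /I_f; case: ifP => _; case: ifP => _.
- by rewrite ltr_wpDr// divr_ge0 ?mulr_ge0// ltW.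
- by rewrite divr_gt0// mulr_gt0.
- by rewrite ltr_wpDr// divr_ge0 ?mulr_ge0// ltW.
- by rewrite divr_gt0// mulr_gt0.
Qed.

(** The bounds with [eps = 1/2] make [F] finite near 0, after which convergence is that of real
    numbers. *)
Lemma cvg_right_one (R : realType) (F : R -> \bar R) :
  (forall eps : R, 0 < eps -> eps < 1 -> exists c0 : R, 0 < c0 /\
    forall c, 0 < c -> c < c0 -> ((1 - eps)%:E <= F c <= (1 + eps)%:E)%E) ->
  F c @[c --> 0^'+] --> 1%:E.
Proof.
move=> H; apply/fine_cvgP; split.
  have [||c0 [c00 h]] := H 2^-1; [by rewrite invr_gt0|by rewrite invf_lt1// ltr1n|].
  near=> c; have cpos : 0 < c by near: c; exact: nbhs_right_gt.
  have cc0 : c < c0 by near: c; exact: nbhs_right_lt.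
  have /andP[h1 h2] := h c cpos cc0.
  rewrite fin_real//; apply/andP; split.
    by apply: lt_le_trans h1; exact: ltNyr.
  by apply: le_lt_trans h2 _; exact: ltry.
apply/cvgrPdist_le => e e0.
pose eps := Num.min e 2^-1.
have eps0 : 0 < eps by rewrite lt_min e0 invr_gt0 ltr0n.
have eps1 : eps < 1 by rewrite gt_min invf_lt1// ltr1n orbT.
have [c0 [c00 h]] := H eps eps0 eps1.
near=> c; have cpos : 0 < c by near: c; exact: nbhs_right_gt.
  have cc0 : c < c0 by near: c; exact: nbhs_right_lt.
  have /andP[h1 h2] := h c cpos cc0.
have : eps <= e by rewrite ge_min lexx.
rewrite /comp; case: (F c) h1 h2 => [r| |]//=; rewrite !lee_fin => h1 h2 ee.
by rewrite ler_norml; apply/andP; split; lra.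
Unshelve. all: by end_near.
Qed.

(** The right side is the square of [expR (delta * x / 2)], which is at least [delta * x / 2]. *)
Lemma linear_le_expR (R : realType) (B delta x : R) : 0 <= B -> 0 < delta ->
  0 <= x -> 4 * B / delta ^+ 2 <= x -> B * x <= expR (delta * x).
Proof.
move=> B0 d0 x0; rewrite ler_pdivrMr ?exprn_gt0// => h.
have h1 : delta * x / 2 <= expR (delta * x / 2).
  by apply: le_trans (expR_ge1Dx _); rewrite lerDr.
have -> : delta * x = delta * x / 2 + delta * x / 2 by rewrite -splitr.
rewrite expRD; have d1 : 0 <= delta * x / 2 by rewrite divr_ge0// mulr_ge0// ltW.
apply: le_trans (ler_pM d1 d1 h1 h1).
have := ler_wpM2r x0 h; rewrite expr2; lra.
Qed.

Unset Implicit Arguments.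
Section Risk.
Context (R : realType) (M K L : nat) (dY : measure_display) (Y : measurableType dY)
  (mu : {measure set Y -> \bar R}) (f g : Y -> R)
  (dO : measure_display) (Omega : measurableType dO)
  (dV : measure_display) (V : measurableType dV) (pi : {set 'I_M} -> R)
  (P : {set 'I_M} -> probability Omega R) (U : Omega -> V)
  (y : nat -> 'I_M -> Omega -> Y).
Hypotheses (L0 : (0 < L)%N) (LM : (L < M)%N) (K0 : (0 < K)%N) (KM : (K <= M)%N).
Hypotheses (df : is_density mu f) (dg : is_density mu g).
Hypotheses (kgf : (0 < KL mu g f < +oo)%E) (kfg : (0 < KL mu f g < +oo)%E).
Hypothesis mgf : exists2 eps : R, 0 < eps & forall s : R, `|s| < eps ->
     (\int[mu]_x (f x * expR (s * llr f g x))%:E < +oo)%E /\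
     (\int[mu]_x (g x * expR (s * llr f g x))%:E < +oo)%E.
Hypothesis pi01 : forall A : {set 'I_M}, #|A| = L -> 0 < pi A < 1.
Hypothesis sum_pi : \sum_(A : {set 'I_M} | #|A| == L) pi A = 1.
Hypothesis model : search_model L mu f g P U y.

Local Notation I := (I_star M K L (fine (KL mu g f)) (fine (KL mu f g))).

Let I0 : 0 < I.
Proof. by apply: I_star_gt0 => //; apply: fine_gt0; rewrite ?kgf ?kfg. Qed.

Let pi0 (A : {set 'I_M}) : #|A| = L -> 0 <= pi A.
Proof. by move=> /pi01 /andP[/ltW]. Qed.

Let tau0 (A : {set 'I_M}) (G : policy Omega M) : (0 <= \int[P A]_w tau_e G w)%E.
Proof.
by apply: integral_ge0 => w _; rewrite /tau_e; case: (stop G w) => // n; rewrite lee_fin.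
Qed.

Lemma risk_upper (eps : R) : 0 < eps -> exists c0 : R, 0 < c0 /\ forall c G, 0 < c -> c < c0 -> c < 1 ->
  is_DGF K L (fine (KL mu g f)) (fine (KL mu f g)) f g U y c G ->
  (bayes_risk L pi P c G <= ((1 + eps) * (- c * ln c / I))%:E)%E.
Proof.
move=> eps0.
have eps2 : 0 < 2 + eps by lra.
(* Chosen so that [1 / (I - e) = (1 + eps / 2) / I]; the other [eps / 2] absorbs the constant
   [N + C] as soon as [x > x0]. *)
pose e := I * (eps / (2 + eps)).
have e0 : 0 < e by rewrite mulr_gt0// divr_gt0.
have Ie : I - e = I * (2 / (2 + eps)).
  rewrite /e -{1}[I]mulr1 -mulrBr; congr (_ * _).
  by apply: (mulIf (x := 2 + eps)); rewrite ?gt_eqF// mulrBl mul1r !divfK ?gt_eqF//; lra.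
have eI : e < I.
  by rewrite -subr_gt0 Ie mulr_gt0// divr_gt0.
have [|C C0 hC] := dgf_expected_time R M K L dY Y mu f g dO Omega dV V P U y L0 LM df dg kgf kfg mgf model e.
  by rewrite e0.
pose N : R := #|{set 'I_M}|%:R.
have N0 : 0 <= N by [].
pose x0 := 2 * I * (N + C) / eps.
exists (expR (- x0)); split; first exact: expR_gt0.
move=> c G c0 cx c1 dG.
have c01 : 0 < c < 1 by rewrite c0.
pose x := - ln c.
have xpos : 0 < x by rewrite oppr_gt0 ln_lt0.
have x0x : x0 < x.
  by rewrite ltrNr -ltr_expR lnK ?posrE.
have ht (A : {set 'I_M}) : #|A| = L -> (\int[P A]_w tau_e G w <= (x / (I - e) + C)%:E)%E by exact: hC.
have he (A : {set 'I_M}) : #|A| = L -> (err_prob (P A) A G <= (N * c)%:E)%E.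
  move=> AL; apply: (dgf_error R M K L dY Y mu f g dO Omega dV V P U y df dg kgf kfg model c G A c01 dG AL).
  by apply: le_lt_trans (ht A AL) _; exact: ltry.
rewrite /bayes_risk.
apply: (@le_trans _ _ ((N * c)%:E + c%:E * (x / (I - e) + C)%:E)%E).
  apply: leeD.
    apply: (@le_trans _ _ (\sum_(A : {set 'I_M} | #|A| == L) (pi A * (N * c))%:E)%E).
      apply: lee_sum => A /eqP AL; rewrite EFinM; apply: lee_wpmul2l; last exact: he.
      by rewrite lee_fin pi0.
    by rewrite sumEFin -mulr_suml sum_pi mul1r.
  apply: lee_wpmul2l; first by rewrite lee_fin ltW.
  apply: (@le_trans _ _ (\sum_(A : {set 'I_M} | #|A| == L) (pi A * (x / (I - e) + C))%:E)%E).
    apply: lee_sum => A /eqP AL; rewrite EFinM; apply: lee_wpmul2l; last exact: ht.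
    by rewrite lee_fin pi0.
  by rewrite sumEFin -mulr_suml sum_pi mul1r.
rewrite -EFinM -EFinD lee_fin.
have -> : (1 + eps) * (- c * ln c / I) = c * ((1 + eps) * x / I).
  by rewrite /x; ring.
rewrite mulrC -mulrDr; apply: ler_wpM2l; first exact: ltW.
have h1 : x / (I - e) = (1 + eps / 2) * x / I.
  rewrite Ie; field; rewrite ?gt_eqF//.
have h2 : N + C <= eps / 2 * x / I.
  rewrite ler_pdivlMr//; move/ltW: x0x; rewrite /x0 ler_pdivrMr//; lra.
rewrite h1.
have -> : (1 + eps) * x / I = (1 + eps / 2) * x / I + eps / 2 * x / I.
  by field; rewrite ?gt_eqF.
by lra.
Qed.

Lemma risk_lower (eps : R) : 0 < eps -> eps < 1 ->
  exists c0 : R, 0 < c0 /\ forall c G, 0 < c -> c < c0 -> c < 1 ->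
  admissible K L U y G ->
  (((1 - eps) * (- c * ln c / I))%:E <= bayes_risk L pi P c G)%E.
Proof.
move=> eps0 eps1.
have [p0 p00 hp0] : exists2 p0, 0 < p0 & forall A : {set 'I_M}, #|A| = L -> p0 <= pi A.
  pose p0 := \big[Num.min/1]_(A : {set 'I_M} | #|A| == L) pi A.
  exists p0.
    rewrite /p0; elim/big_ind: _ => [|a b a0 b0|A /eqP /pi01 /andP[]//]; first exact: ltr01.
    by rewrite lt_min a0.
  by move=> A AL; apply: bigmin_le_cond; rewrite AL.
(* Three losses of [delta]: in the exponent of [p], in the factor [1 - p], and for the additive
   [- 1] of [expected_time_lower]. *)
pose delta := eps / 3.
have d0 : 0 < delta by rewrite divr_gt0.
have d1 : delta <= 2^-1 by rewrite /delta; lra.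
have e3 : eps = 3 * delta by rewrite /delta; lra.
pose B := (I * p0)^-1.
have B0 : 0 <= B by rewrite invr_ge0 mulr_ge0 ?ltW.
(* The first term gives [B * x <= expR (delta * x)], so that the error bound [c * (B * x)] is at
   most [p]. The second gives [2 <= delta * x], used both for [p <= delta] and to absorb the
   [- 1]. *)
pose x0 := 4 * B / delta ^+ 2 + 2 / delta.
exists (expR (- x0)); split; first exact: expR_gt0.
move=> c G c0 cx c1 admG.
pose x := - ln c.
have xpos : 0 < x by rewrite oppr_gt0 ln_lt0// c0.
have x0x : x0 < x.
  by rewrite ltrNr -ltr_expR lnK ?posrE.
have cE : c = expR (- x) by rewrite /x opprK lnK ?posrE.
have B1 : 0 <= 4 * B / delta ^+ 2 by apply: divr_ge0; [exact: mulr_ge0|exact: sqr_ge0].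
have D1 : 0 <= 2 / delta by apply: divr_ge0 => //; exact: ltW.
have x1 : 4 * B / delta ^+ 2 <= x by move: x0x; rewrite /x0; lra.
have x2 : 2 <= delta * x.
  by rewrite mulrC -ler_pdivrMr//; move: x0x; rewrite /x0; lra.
have rhoE : (1 - eps) * (- c * ln c / I) = c * ((1 - eps) * x / I).
  by rewrite /x; ring.
rewrite rhoE; set rho := c * _.
rewrite leNgt; apply/negP => lt.
have s1 : (0 <= \sum_(A : {set 'I_M} | #|A| == L) (pi A)%:E * err_prob (P A) A G)%E.
  by apply: sume_ge0 => A /eqP AL; rewrite mule_ge0// lee_fin pi0.
have s2 : (0 <= \sum_(A : {set 'I_M} | #|A| == L) (pi A)%:E * \int[P A]_w tau_e G w)%E.
  by apply: sume_ge0 => A /eqP AL; rewrite mule_ge0// lee_fin pi0.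
pose p := expR (- ((1 - delta) * x)).
have d1x : 0 <= (1 - delta) * x by rewrite mulr_ge0 ?ltW//; lra.
have p01 : 0 < p <= 1.
  by rewrite expR_gt0 /= -expR0 ler_expR oppr_le0.
have rho0 : 0 <= rho.
  by rewrite mulr_ge0 ?ltW// divr_gt0// mulr_gt0//; lra.
have rhop : rho / p0 <= p.
  have h := linear_le_expR B0 d0 (ltW xpos) x1.
  have h2 : rho / p0 <= c * (B * x).
    have -> : rho / p0 = (1 - eps) * (c * (B * x)).
      by rewrite /rho /B invfM; ring.
    rewrite ler_piMl//; last by lra.
    by rewrite mulr_ge0 ?mulr_ge0// ltW.
  apply: le_trans h2 _; apply: le_trans (ler_wpM2l (ltW c0) h) _.
  rewrite {1}cE -expRD ler_expR le_eqVlt; apply/orP; left; apply/eqP; ring.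
have err (B' : {set 'I_M}) : #|B'| = L -> (err_prob (P B') B' G <= p%:E)%E.
  move=> BL; apply: (@le_trans _ _ (rho / p0)%:E); last by rewrite lee_fin.
  have e0 : (0 <= err_prob (P B') B' G)%E by [].
  have h : ((pi B')%:E * err_prob (P B') B' G <= rho%:E)%E.
    apply: le_trans (ltW lt); rewrite /bayes_risk.
    apply: (@le_trans _ _ (\sum_(A : {set 'I_M} | #|A| == L) (pi A)%:E * err_prob (P A) A G)%E).
      rewrite (bigD1 B') ?BL//= leeDl//.
      by apply: sume_ge0 => A /andP[/eqP AL _]; rewrite mule_ge0// lee_fin pi0.
    by rewrite leeDl// mule_ge0// lee_fin ltW.
  have {}h : (p0%:E * err_prob (P B') B' G <= rho%:E)%E.
    by apply: le_trans h; apply: lee_wpmul2r => //; rewrite lee_fin hp0.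
  case: (err_prob _ _ _) e0 h => [r| |]// _.
    by rewrite -EFinM !lee_fin => h; rewrite ler_pdivlMr// mulrC.
  by rewrite gt0_muley ?lte_fin.
have time (A : {set 'I_M}) : #|A| = L -> (((1 - eps) * x / I)%:E <= \int[P A]_w tau_e G w)%E.
  move=> AL.
  have := expected_time_lower R M K L dY Y mu f g dO Omega dV V P U y L0 LM df dg kgf kfg mgf
    model G admG A p AL KM p01 err (ltW I0).
  have pd : p <= delta.
    have h1 : x / 2 <= (1 - delta) * x.
      by rewrite mulrC; apply: ler_wpM2r; [exact: ltW|lra].
    apply: (@le_trans _ _ (expR (- (x / 2)))); first by rewrite ler_expR lerN2.
    rewrite expRN invf_ple ?posrE ?expR_gt0//.
    apply: le_trans (expR_ge1Dx _).
    have -> : delta^-1 = (delta * x / 2) / delta * (2 / (delta * x)).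
      by field; rewrite ?gt_eqF.
    have -> : delta * x / 2 / delta = x / 2 by field; rewrite gt_eqF.
    have h2 : 2 / (delta * x) <= 1 by rewrite ler_pdivrMr ?mul1r// mulr_gt0.
    have h3 : 0 <= x / 2 by rewrite divr_ge0 ?ltW.
    by have := ler_wpM2l h3 h2; lra.
  have -> : - ln p = (1 - delta) * x by rewrite /p expRK opprK.
  move=> h; have {}h : (((1 - eps) * x)%:E <= I%:E * \int[P A]_w tau_e G w)%E.
    apply: le_trans h; rewrite lee_fin e3.
    have h1 : (1 - delta) * x * (1 - delta) <= (1 - delta) * x * (1 - p).
      by apply: ler_wpM2l => //; lra.
    have h2 : 0 <= delta * (delta * x) by rewrite !mulr_ge0 ?ltW.
    by lra.
  rewrite mulrC EFinM; move: h; case: (\int[P A]_w _)%E (tau0 A G) => [t| |]//.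
    by move=> _; rewrite -!EFinM !lee_fin => h; rewrite ler_pdivrMl.
  by move=> _ _; rewrite leey.
move: lt; rewrite ltNge => /negP; apply; rewrite /bayes_risk.
apply: (@le_trans _ _ (c%:E * \sum_(A : {set 'I_M} | #|A| == L)
   (pi A)%:E * \int[P A]_w tau_e G w)%E); last by rewrite leeDr.
rewrite /rho EFinM; apply: lee_wpmul2l; first by rewrite lee_fin ltW.
apply: (@le_trans _ _ (\sum_(A : {set 'I_M} | #|A| == L) (pi A * ((1 - eps) * x / I))%:E)%E).
  by rewrite sumEFin -mulr_suml sum_pi mul1r.
apply: lee_sum => A /eqP AL; rewrite EFinM; apply: lee_wpmul2l; last exact: time.
by rewrite lee_fin pi0.
Qed.

End Risk.

Unset Implicit Arguments.

Theorem theorem3 (R : realType) (M K L : nat)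
  (dY : measure_display) (Y : measurableType dY)
  (mu : {measure set Y -> \bar R}) (f g : Y -> R)
  (dO : measure_display) (Omega : measurableType dO)
  (dV : measure_display) (V : measurableType dV)
  (pi : {set 'I_M} -> R)
  (P : {set 'I_M} -> probability Omega R) (U : Omega -> V)
  (y : nat -> 'I_M -> Omega -> Y)
  (DGF : R -> policy Omega M) :
  (2 <= M)%N -> (1 <= L)%N -> (L <= M - 1)%N -> (1 <= K)%N -> (K <= M)%N ->
  is_density mu f -> is_density mu g ->
  (0 < KL mu g f < +oo)%E -> (0 < KL mu f g < +oo)%E ->
  (exists2 eps : R, 0 < eps & forall s : R, `|s| < eps ->
     (\int[mu]_x (f x * expR (s * llr f g x))%:E < +oo)%E /\
     (\int[mu]_x (g x * expR (s * llr f g x))%:E < +oo)%E) ->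
  (forall A : {set 'I_M}, #|A| = L -> 0 < pi A < 1) ->
  \sum_(A : {set 'I_M} | #|A| == L) pi A = 1 ->
  search_model L mu f g P U y ->
  (forall c : R, 0 < c < 1 ->
     is_DGF K L (fine (KL mu g f)) (fine (KL mu f g)) f g U y c (DGF c)) ->
  let Istar := I_star M K L (fine (KL mu g f)) (fine (KL mu f g)) in
  ((bayes_risk L pi P c (DGF c) * (Istar / (- c * ln c))%:E)%E
     @[c --> 0^'+] --> 1%:E)
  /\
  ((ereal_inf [set bayes_risk L pi P c G | G in
                 [set G : policy Omega M | admissible K L U y G]]
      * (Istar / (- c * ln c))%:E)%E
     @[c --> 0^'+] --> 1%:E).
Proof.
move=> M2 L0 LM1 K0 KM df dg kgf kfg mgf pi01 sum_pi model dgf Istar.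
have LM : (L < M)%N by apply: leq_ltn_trans LM1 _; rewrite subn1 ltn_predL ltnW.
have I0 : 0 < Istar.
  by apply: I_star_gt0 => //; apply: fine_gt0; rewrite ?kgf ?kfg.
have upper := risk_upper R M K L dY Y mu f g dO Omega dV V pi P U y L0 LM K0
  df dg kgf kfg mgf pi01 sum_pi model.
have lower := risk_lower R M K L dY Y mu f g dO Omega dV V pi P U y L0 LM K0 KM
  df dg kgf kfg mgf pi01 sum_pi model.
have scale (c s : R) : 0 < c -> c < 1 ->
    0 < Istar / (- c * ln c) /\ s * (- c * ln c / Istar) * (Istar / (- c * ln c)) = s.
  move=> c0 c1; have h : 0 < - c * ln c.
    by rewrite mulNr -mulrN mulr_gt0// oppr_gt0 ln_lt0// c0.
  split; first by rewrite divr_gt0.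
  move: (- c * ln c) h => t t0.
  by field; rewrite !gt_eqF.
(* [F] stands for the risk of the DGF policy and for the infimum alike: both lie below that risk and
   above every common lower bound of the admissible risks. *)
have bounds (F : R -> \bar R) :
    (forall c, 0 < c -> c < 1 -> (F c <= bayes_risk L pi P c (DGF c))%E) ->
    (forall c v, 0 < c -> c < 1 -> (forall G, admissible K L U y G ->
       (v%:E <= bayes_risk L pi P c G)%E) -> (v%:E <= F c)%E) ->
    (F c * (Istar / (- c * ln c))%:E)%E @[c --> 0^'+] --> 1%:E.
  move=> Fle Fge; apply: cvg_right_one => eps eps0 eps1.
  have [c1 [c10 h1]] := upper eps eps0.
  have [c2 [c20 h2]] := lower eps eps0 eps1.
  exists (Num.min (Num.min c1 c2) 1); split; first by rewrite !lt_min c10 c20 ltr01.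
  move=> c c0; rewrite !lt_min => /andP[/andP[cc1 cc2] c_lt1].
  have [k0 _] := scale c 1 c0 c_lt1.
  have [_ e1] := scale c (1 - eps) c0 c_lt1.
  have [_ e2] := scale c (1 + eps) c0 c_lt1.
  have k0' : (0 <= (Istar / (- c * ln c))%:E)%E by rewrite lee_fin ltW.
  rewrite -{1}e1 -{1}e2 [in X in (X <= _)%E]EFinM [in X in _ && (_ <= X)%E]EFinM.
  apply/andP; split; apply: lee_wpmul2r => //.
    by apply: Fge => // G admG; exact: h2.
  apply: le_trans (Fle c c0 c_lt1) _; apply: h1 => //.
  by apply: dgf; rewrite c0.
split; apply: bounds => // c.
- by move=> v c0 c1 h; apply: h; have [] := dgf c _; rewrite ?c0.
- move=> c0 c1; apply: ereal_inf_lbound; exists (DGF c) => //.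
  by have [] := dgf c _; rewrite ?c0.
- move=> v c0 c1 h; apply: le_ereal_inf_tmp => _ [G admG <-]; exact: h.
Qed.
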